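(* Let $G$ be a connected edge-transitive finite simple graph with minimum degree $\delta$ and maximum degree $\Delta$. Then $G$ is globally rigid (in the Euclidean plane $\mathbb{R}^2$) if and only if one of the following holds: (i) $\delta \geq 4$; (ii) $\delta = 3$ and $\Delta \geq 6$; (iii) $G$ is isomorphic to one of $K_{3,4}$, $K_{3,5}$, $H_{6,10}$, or $G$ is a complete graph.
   Context: All graphs are finite and simple. A graph is edge-transitive if for every pair of edges $e,f$ there is a graph automorphism mapping $e$ to $f$. A realisation of a graph $G=(V,E)$ is a map $p:V\to\mathbb{R}^2$. Two realisations $p,q$ are equivalent if $\|p(x)-p(y)\|=\|q(x)-q(y)\|$ for all edges $xy\in E$, and congruent if this holds for all pairs $x,y\in V$. A realisation $p$ is globally rigid if every realisation equivalent to $p$ is congruent to $p$. A realisation is generic if its $2|V|$ coordinates form an algebraically independent set over $\mathbb{Q}$. A graph is globally rigid if it has a globally rigid generic realisation (equivalently, all its generic realisations are globally rigid). $K_{a,b}$ denotes the complete bipartite graph. $H_{6,10}$ is the bipartite graph on vertex set $\{0,\dots,15\}$ with parts $\{0,\dots,5\}$ and $\{6,\dots,15\}$ and adjacency: $0:\{6,8,9,10,15\}$, $1:\{7,9,10,12,13\}$, $2:\{6,8,11,12,13\}$, $3:\{6,7,10,11,14\}$, $4:\{9,11,12,14,15\}$, $5:\{7,8,13,14,15\}$ (each of $6,\dots,15$ then has degree 3). *)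

(* Defs.v *)
From HB Require Import structures.
From mathcomp Require Import all_boot all_order all_algebra all_fingroup.
From mathcomp Require Import reals.
From mathcomp Require Import mpoly.

Set Implicit Arguments.
Unset Strict Implicit.
Unset Printing Implicit Defensive.

Import Order.TTheory GRing.Theory Num.Theory.
Local Open Scope ring_scope.

Definition simple_graph (T : finType) (e : rel T) : Prop :=
  irreflexive e /\ ssrbool.symmetric e.

Definition connected_graph (T : finType) (e : rel T) : Prop :=
  forall x y : T, connect e x y.

Definition is_automorphism (T : finType) (e : rel T) (f : {perm T}) : Prop :=
  forall x y : T, e (f x) (f y) = e x y.

Definition edge_transitive (T : finType) (e : rel T) : Prop :=
  forall x y u v : T, e x y -> e u v ->
    exists f : {perm T}, is_automorphism e f /\
      ((f x = u /\ f y = v) \/ (f x = v /\ f y = u)).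

Definition degree (T : finType) (e : rel T) (x : T) : nat :=
  #|[set y | e x y]|.

(* minimum degree (the default #|T| is never attained when T is nonempty) *)
Definition min_degree (T : finType) (e : rel T) : nat :=
  \big[minn/#|T|]_(x : T) degree e x.

Definition max_degree (T : finType) (e : rel T) : nat :=
  (\max_(x : T) degree e x)%N.

Definition complete_graph (T : finType) (e : rel T) : Prop :=
  forall x y : T, x != y -> e x y.

Definition isomorphic (T T' : finType) (e : rel T) (e' : rel T') : Prop :=
  exists f : T -> T', bijective f /\ forall x y : T, e' (f x) (f y) = e x y.

Definition Kbip (a b : nat) : rel 'I_(a + b) :=
  fun i j => (i < a)%N != (j < a)%N.

Arguments Kbip : clear implicits.

Definition H610_nbrs (i : nat) : seq nat :=
  match i with
  | 0 => [:: 6; 8; 9; 10; 15]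
  | 1 => [:: 7; 9; 10; 12; 13]
  | 2 => [:: 6; 8; 11; 12; 13]
  | 3 => [:: 6; 7; 10; 11; 14]
  | 4 => [:: 9; 11; 12; 14; 15]
  | 5 => [:: 7; 8; 13; 14; 15]
  | _ => [::]
  end%N.

Definition H610 : rel 'I_16 :=
  fun i j => ((val j \in H610_nbrs (val i)) || (val i \in H610_nbrs (val j))).

Definition realisation (R : realType) (T : finType) := T -> 'I_2 -> R.

Definition dist (R : realType) (T : finType) (p : realisation R T) (x y : T) : R :=
  Num.sqrt ((p x 0 - p y 0) ^+ 2 + (p x 1 - p y 1) ^+ 2).

Definition equivalent (R : realType) (T : finType) (e : rel T)
  (p q : realisation R T) : Prop :=
  forall x y : T, e x y -> dist p x y = dist q x y.

Definition congruent (R : realType) (T : finType) (p q : realisation R T) : Prop :=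
  forall x y : T, dist p x y = dist q x y.

Definition globally_rigid_realisation (R : realType) (T : finType) (e : rel T)
  (p : realisation R T) : Prop :=
  forall q : realisation R T, equivalent e p q -> congruent p q.

(* a finite family (x_i)_{i in I} of reals is algebraically independent over Q:
   no nonzero rational polynomial in #|I| variables vanishes at it
   (this also forces the x_i to be pairwise distinct) *)
Definition alg_indep (R : realType) (I : finType) (x : I -> R) : Prop :=
  forall P : {mpoly rat[#|I|]}, P != 0 ->
    mmap (fun c : rat => ratr c) (fun k => x (enum_val k)) P != 0.

Definition generic (R : realType) (T : finType) (p : realisation R T) : Prop :=
  alg_indep (fun vk : T * 'I_2 => p vk.1 vk.2).

Definition globally_rigid (R : realType) (T : finType) (e : rel T) : Prop :=
  exists p : realisation R T, generic p /\ globally_rigid_realisation e p.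

(* Main.v *)
(** For a connected edge-transitive graph that is not complete, global rigidity
is equivalent to: minimum degree at least 3 and |E| >= 2|V| - 2.

Algebraic dependence over Q of squared edge lengths at a generic point is the
combinatorial (2,3)-sparsity matroid (Laman's theorem, with independence
transferred from stress-freeness by a local inverse function argument).  If a
vertex [v] lies outside a rigid set containing all its neighbours, the
distances between these neighbours are determined by the edge lengths: expand
the length equations at [v] in the coordinates of [p v], which are generic over
the rest.  Deleting vertices one at a time, this makes every graph that stays
rigid after removal of any one vertex globally rigid.  Under edge-transitivity,
if the removal of a vertex destroyed rigidity, the images of a maximal rigid
proper subset would pairwise meet in at most one vertex and partition the
edges, and counting would exhibit too many independent edges.  When only the
vertices of the lower-degree side can be removed, the argument is repeated for
the cliques spanned by their neighbourhoods on the other side.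

Conversely, a vertex of degree at most 2 can be reflected, and a flexible graph
can be deformed, so |E| >= 2|V| - 3; in the case of equality the graph is
K_(3,3).  There the distance of two vertices of one side parametrises a closed
curve of realisations of the graph minus the third one, on which the remaining
equation changes sign at [p], hence also at another point.  The bipartite
graphs with degrees 3 and 5 are identified with the help of an automorphism of
5-power order fixing one vertex of degree 5. *)
Require Import Defs.
From HB Require Import structures.
From mathcomp Require Import all_boot all_order all_algebra all_fingroup.
From mathcomp Require Import cyclic pgroup sylow.
From mathcomp Require Import boolp reals zify ring lra.
From mathcomp Require classical_sets.
From mathcomp Require mpoly.
Import (canonicals, coercions) mpoly.

Set Implicit Arguments.
Unset Strict Implicit.
Unset Printing Implicit Defensive.

Import Order.TTheory GRing.Theory Num.Theory.
Local Open Scope ring_scope.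


(** * Relative algebraic closure *)

(** A distance counts as spanned by edges when it is algebraic over their squared lengths at a
    generic point. The exchange property then does the work of Jacobian ranks: gluing and deleting
    vertices reduce to the fact that five distances of four points determine the sixth up to
    finitely many values.

    Finitely many is not one, and an equivalent realisation [q] need not be generic. Uniqueness
    comes from the freedom of a single vertex [v]: the distances of [q] on a rigid set without [v]
    are algebraic over the points of [p] other than [p v], while the two coordinates of [p v] are
    independent over these points; a polynomial relation between them therefore holds coefficient by
    coefficient.

    The bound 2|V| - 2 is one more than the size of a minimally rigid graph. It is automatic if all
    degrees are at least 4, and for bipartite graphs with degrees 3 and at least 6 on the two sides.
    The exceptional graphs come from the degrees 3, 4 and 3, 5, where it leaves finitely many
    sizes. *)

Section Acl.
Variable E : fieldType.
Implicit Types (S D : E -> Prop) (x y : E).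

(** With closure under roots built in, transitivity is a plain induction. That an element is a root
    of one polynomial over the generators is recovered in [acl_subring]. *)
Inductive acl S : E -> Prop :=
| acl_in x : S x -> acl S x
| acl1 : acl S 1
| aclB x y : acl S x -> acl S y -> acl S (x - y)
| aclM x y : acl S x -> acl S y -> acl S (x * y)
| aclV x : acl S x -> acl S x^-1
| acl_root (P : {poly E}) x :
    P != 0 -> (forall i, acl S P`_i) -> root P x -> acl S x.

Lemma acl0 S : acl S 0.
Proof. by rewrite -(subrr 1); apply: aclB; apply: acl1. Qed.

Lemma aclN S x : acl S x -> acl S (- x).
Proof. by move=> hx; rewrite -sub0r; apply: aclB => //; apply: acl0. Qed.

Lemma aclD S x y : acl S x -> acl S y -> acl S (x + y).
Proof. by move=> hx hy; rewrite -[y]opprK; apply: aclB => //; apply: aclN. Qed.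

Lemma acl_sum S (I : Type) (r : seq I) (P : pred I) (F : I -> E) :
  (forall i, P i -> acl S (F i)) -> acl S (\sum_(i <- r | P i) F i).
Proof. by move=> h; apply: big_ind => //; [exact: acl0 | exact: aclD]. Qed.

Lemma aclX S x n : acl S x -> acl S (x ^+ n).
Proof.
move=> hx; elim: n => [|n ih]; first by rewrite expr0; exact: acl1.
by rewrite exprS; apply: aclM.
Qed.

Lemma acl_nat S n : acl S n%:R.
Proof. by elim: n => [|n ih]; rewrite ?mulr0n ?mulrS; [exact: acl0|apply: aclD ih; exact: acl1]. Qed.

Lemma acl_trans S S' x : acl S x -> (forall y, S y -> acl S' y) -> acl S' x.
Proof.
move=> hx h; elim: hx => {x} [x /h//||||x hx|P x nzP _ hP rx].
- exact: acl1.
- by move=> x y _ hx _ hy; apply: aclB.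
- by move=> x y _ hx _ hy; apply: aclM.
- by move=> hx'; apply: aclV.
- exact: acl_root nzP hP rx.
Qed.

Lemma acl_sub S S' x : (forall y, S y -> S' y) -> acl S x -> acl S' x.
Proof. by move=> h hx; apply: acl_trans hx _ => y /h; apply: acl_in. Qed.

Definition subring_pred D :=
  [/\ D 1, forall x y, D x -> D y -> D (x - y)
         & forall x y, D x -> D y -> D (x * y)].

(** The fraction field of [D] inside [E]. Its Boolean form lets it become a subfield type, to which
    the theory of algebraic elements applies. *)
Definition fracs D (hD : subring_pred D) : {pred E} :=
  fun x => `[< exists a b, [/\ D a, D b, b != 0 & x = a / b] >].

Lemma fracs_divring_closed D (hD : subring_pred D) :
  divring_closed (fracs hD).
Proof.
have [D1 DB DM] := hD.
split=> [|x y|x y].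
- by apply/asboolP; exists 1, 1; rewrite divr1 oner_eq0.
- move=> /asboolP[a [b [Da Db nb ->]]] /asboolP[c [d [Dc Dd nd ->]]].
  apply/asboolP; exists (a * d - c * b), (b * d); split.
  + by apply: DB; apply: DM.
  + exact: DM.
  + by rewrite mulf_neq0.
  + by rewrite -mulNr addf_div // mulNr.
- move=> /asboolP[a [b [Da Db nb ->]]] /asboolP[c [d [Dc Dd nd ->]]].
  have D0 : D 0 by rewrite -(subrr 1); apply: DB.
  have [->|nc] := eqVneq c 0.
    rewrite mul0r invr0 mulr0; apply/asboolP; exists 0, 1.
    by rewrite divr1 oner_eq0.
  apply/asboolP; exists (a * d), (b * c); split; try exact: DM.
    by rewrite mulf_neq0.
  by rewrite invf_div mulf_div.
Qed.

HB.instance Definition _ D (hD : subring_pred D) :=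
  GRing.isDivringClosed.Build E (fracs hD) (fracs_divring_closed hD).

Record frac_type D (hD : subring_pred D) :=
  FracType { frac_val :> E; frac_valP : frac_val \in fracs hD }.

HB.instance Definition _ D (hD : subring_pred D) :=
  [isSub for @frac_val D hD].
HB.instance Definition _ D (hD : subring_pred D) :=
  [Choice of frac_type hD by <:].
HB.instance Definition _ D (hD : subring_pred D) :=
  [SubChoice_isSubIntegralDomain of frac_type hD by <:].
HB.instance Definition _ D (hD : subring_pred D) :=
  [SubIntegralDomain_isSubField of frac_type hD by <:].

Lemma common_denominator D (hD : subring_pred D) (r : seq E) :
  all [in fracs hD] r ->
  exists d, [/\ d != 0, D d & forall x, x \in r -> D (d * x)].
Proof.
have [D1 DB DM] := hD.
elim: r => [|x r ih] /=; first by exists 1; split=> //; rewrite oner_eq0.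
case/andP=> /asboolP[a [b [Da Db nb ->]]] /ih [d [nd Dd hd]].
exists (d * b); split=> [||y]; first by rewrite mulf_neq0.
  exact: DM.
rewrite inE => /orP[/eqP->|/hd h].
  by rewrite -mulrA [b * _]mulrC divfK //; apply: DM.
by rewrite mulrAC; apply: DM.
Qed.

(** The elements algebraic over the fraction field of [D] form a field closed under roots, so they
    contain the closure; a common denominator then moves the coefficients into [D]. *)
Lemma acl_subring D (hD : subring_pred D) y : acl D y ->
  exists P : {poly E}, [/\ P != 0, forall i, D P`_i & root P y].
Proof.
move=> hy; have [D1 DB DM] := hD.
have D0 : D 0 by rewrite -(subrr 1); apply: DB.
pose v : {rmorphism frac_type hD -> E} := val.
have : algebraicOver v y.
  elim: hy => {y} [x Dx||x y _ hx _ hy|x y _ hx _ hy|x _ hx|P x nzP _ hP rx].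
  - have xF : x \in fracs hD.
      by apply/asboolP; exists x, 1; rewrite divr1 oner_eq0.
    by rewrite -[x]/(v (FracType xF)); apply: algebraic_id.
  - exact: algebraic1.
  - exact: algebraic_sub.
  - exact: algebraic_mul.
  - exact: algebraic_inv.
  apply/integral_algebraic; apply: (integral_root nzP rx) => z /(nthP 0)[i _ <-].
  exact/integral_algebraic.
case=> P nzP rP; pose Q := map_poly v P.
have [|d [nd Dd hd]] := @common_denominator _ hD Q.
  apply/allP => x /(nthP 0)[i _ <-]; rewrite coef_map /=; exact: valP.
exists (d *: Q); split.
- by rewrite scaler_eq0 negb_or nd map_poly_eq0.
- move=> i; rewrite coefZ; have [h|h] := ltnP i (size Q).
    by apply: hd; apply: mem_nth.
  by rewrite nth_default // mulr0.
- by rewrite rootE hornerZ (rootP rP) mulr0.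
Qed.

Definition adjoin S x : E -> Prop := fun y => y = x \/ S y.

Lemma acl_exchange S x y :
  acl (adjoin S x) y -> ~ acl S y -> acl (adjoin S y) x.
Proof.
move=> hy nSy.
pose D z := exists2 C : {poly E}, (forall i, acl S C`_i) & z = C.[x].
have hD : subring_pred D.
  split.
  - exists 1; last by rewrite hornerC.
    by move=> i; rewrite coef1; case: eqP => _; [exact: acl1|exact: acl0].
  - move=> _ _ [A hA ->] [B hB ->]; exists (A - B); last by rewrite !hornerE.
    by move=> i; rewrite coefB; apply: aclB.
  - move=> _ _ [A hA ->] [B hB ->]; exists (A * B); last by rewrite !hornerE.
    by move=> i; rewrite coefM; apply: acl_sum => j _; apply: aclM.
have : acl D y.
  apply: acl_sub hy => z [->|Sz].
    exists 'X; last by rewrite hornerX.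
    by move=> i; rewrite coefX; case: eqP => _; [exact: acl1|exact: acl0].
  exists z%:P; last by rewrite hornerC.
  by move=> i; rewrite coefC; case: eqP => _; [exact: acl_in|exact: acl0].
case/(acl_subring hD) => P [nzP cP rP].
have {}cP i : exists C : {poly E}, (forall i, acl S C`_i) /\ P`_i = C.[x].
  by have [C ? ?] := cP i; exists C.
have {cP} [C hC] := choice cP.
(* The relation for [y], read as a polynomial in [x] with coefficients algebraic over [S] and [y].
   If it is nonzero, [x] is one of its roots. If it is zero, its coefficients are relations for [y]
   over the closure of [S], one of them nontrivial. *)
pose Q := \sum_(i < size P) y ^+ i *: C i.
have Qx : root Q x.
  rewrite rootE /Q horner_sum; apply/eqP.
  rewrite -[RHS](rootP rP) [RHS]horner_coef.
  by apply: eq_bigr => i _; rewrite hornerZ mulrC (hC i).2.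
have [Q0|nQ] := eqVneq Q 0; last first.
  apply: (acl_root nQ) Qx => j; rewrite coef_sum; apply: acl_sum => i _.
  rewrite coefZ; apply: aclM; first by apply: aclX; apply: acl_in; left.
  by apply: acl_sub ((hC i).1 j) => z; right.
case: nSy; have [i nPi] : exists i : 'I_(size P), P`_i != 0.
  rewrite -size_poly_gt0 in nzP; have h : ((size P).-1 < size P)%N by rewrite prednK.
  by exists (Ordinal h); rewrite -lead_coefE lead_coef_eq0 -size_poly_gt0.
have [j nCj] : exists j, (C i)`_j != 0.
  apply: contrapT => h; move: nPi; rewrite (hC i).2.
  suff -> : C i = 0 by rewrite horner0 eqxx.
  apply/polyP => j; rewrite coef0; apply/eqP/negP => /negP k; apply: h.
  by exists j.
apply: (@acl_root S (\poly_(k < size P) (C k)`_j)).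
- apply/eqP => /polyP /(_ i); rewrite coef_poly ltn_ord coef0.
  exact/eqP.
- by move=> k; rewrite coef_poly; case: ifP => _; [exact: (hC k).1|exact: acl0].
- rewrite rootE horner_poly; apply/eqP.
  move/polyP: Q0 => /(_ j); rewrite coef0 coef_sum => Q0.
  rewrite -[RHS]Q0.
  by apply: eq_bigr => k _; rewrite coefZ mulrC.
Qed.

End Acl.

(** * Algebraic matroid of a finite family *)

Section AlgMatroid.
Variables (E : fieldType) (I : finType) (f : I -> E).
Implicit Types (F G : {set I}) (i j : I).

Definition vals F : E -> Prop := fun x => exists2 i, i \in F & x = f i.

Definition aspan F i := acl (vals F) (f i).

Definition indep F := forall i, i \in F -> ~ aspan (F :\ i) i.

Lemma aspan_in F i : i \in F -> aspan F i.
Proof. by move=> h; apply: acl_in; exists i. Qed.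

Lemma aspan_sub F G i : F \subset G -> aspan F i -> aspan G i.
Proof. by move=> /subsetP h; apply: acl_sub => _ [j /h jG ->]; exists j. Qed.

Lemma aspan_trans F G i : aspan F i -> (forall j, j \in F -> aspan G j) -> aspan G i.
Proof. by move=> hi h; apply: acl_trans hi _ => _ [j /h jG ->]. Qed.

Lemma aspan_exchange F i j : aspan (j |: F) i -> ~ aspan F i -> aspan (i |: F) j.
Proof.
move=> h1 h2; have /acl_exchange : acl (adjoin (vals F) (f j)) (f i).
  apply: acl_sub h1 => _ [k /setU1P[->|kF] ->]; first by left.
  by right; exists k.
move=> /(_ h2); apply: acl_sub => x [->|[k kF ->]].
  by exists i; rewrite ?setU11.
by exists k; rewrite ?setU1r.
Qed.

Lemma indep_sub F G : F \subset G -> indep G -> indep F.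
Proof.
move=> sFG iG i iF h; apply: (iG i); first exact: (subsetP sFG).
by apply: aspan_sub h; apply: setSD.
Qed.

Lemma indepU1 F i : indep F -> ~ aspan F i -> indep (i |: F).
Proof.
move=> iF ni j /setU1P[->|jF] h.
  by apply: ni; apply: aspan_sub h; apply/subsetP => k; rewrite !inE => /andP[/negPf->].
have [eji|nji] := eqVneq j i; first by apply: ni; rewrite -eji; apply: aspan_in.
have h' : aspan (i |: F :\ j) j.
  apply: aspan_sub h; apply/subsetP => k; rewrite !inE.
  by case/andP=> -> /orP[->|->]; rewrite ?orbT.
apply: ni; have := aspan_exchange h' (iF j jF).
by rewrite setD1K.
Qed.

(** Steinitz exchange, by induction on [F :\: G]: an [i] in [F] outside [G] is replaced by some [j]
    in [G] that the rest of [F] does not span; without such a [j] the rest would span [i]. *)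
Lemma indep_card F G : indep F -> (forall i, i \in F -> aspan G i) ->
  (#|F| <= #|G|)%N.
Proof.
have [n] := ubnP #|F :\: G|; elim: n F => // n ih F hn iF sF.
have [/eqP/[!setD_eq0] sub|[i iFG]] := set_0Vmem (F :\: G).
  exact: subset_leq_card.
have /setDP[iF' niG] := iFG.
have [j jG nj] : exists2 j, j \in G & ~ aspan (F :\ i) j.
  apply: contrapT => h; apply: (iF i iF'); apply: aspan_trans (sF i iF') _ => j jG.
  by apply: contrapT => k; apply: h; exists j.
have njF : j \notin F :\ i by apply/negP => /aspan_in.
have -> : #|F| = #|j |: (F :\ i)|.
  by rewrite cardsU1 njF [LHS](cardsD1 i) iF'.
apply: ih.
- rewrite -ltnS; apply: leq_trans hn; rewrite ltnS [X in (_ < X)%N](cardsD1 i) iFG ltnS.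
  apply/subset_leq_card/subsetP => k; rewrite !inE => /andP[kG].
  by case/orP=> [/eqP ekj|/andP[-> ->]]; [rewrite ekj jG in kG|rewrite kG].
- by apply: indepU1 nj; apply: indep_sub iF; apply: subsetDl.
- move=> k /setU1P[->|/setD1P[_ /sF//]]; exact: aspan_in.
Qed.

Lemma indep_span F G : indep F -> (forall i, i \in F -> aspan G i) ->
  (#|G| <= #|F|)%N -> forall i, aspan G i -> aspan F i.
Proof.
move=> iF sF cGF i sGi; apply: aspan_trans sGi _ => j jG.
apply: contrapT => nj.
have njF : j \notin F by apply/negP => /aspan_in.
have := indep_card (indepU1 iF nj) (G := G); rewrite cardsU1 njF.
move=> h; suff : (1 + #|F| <= #|G|)%N by rewrite leqNgt ltnS cGF.
by apply: h => k /setU1P[->|/sF//]; apply: aspan_in.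
Qed.

Lemma basis_exists G : exists F, [/\ F \subset G, indep F &
  forall i, i \in G -> aspan F i].
Proof.
pose P (F : {set I}) := (F \subset G) && `[< indep F >].
have P0 : P set0.
  by rewrite /P sub0set; apply/asboolP => i; rewrite inE.
have [F /maxsetP [/andP[sF /asboolP iF] mF] _] := maxset_exists P0.
exists F; split=> // i iG; apply: contrapT => ni.
have niF : i \notin F by apply/negP => /aspan_in.
have : i |: F = F.
  apply: mF; last exact: subsetUr.
  rewrite /P subUset sub1set iG sF; apply/asboolP; exact: indepU1.
by move/setP => /(_ i); rewrite setU11 (negPf niF).
Qed.

End AlgMatroid.


(** * Polynomial functions with rational coefficients and generic points *)

Section QPoly.
Variables (R : realType) (I : finType).
Implicit Types (x : I -> R) (g : (I -> R) -> R) (P Q : mpoly.mpoly #|I| rat).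

Definition qeval x (P : mpoly.mpoly #|I| rat) : R :=
  mpoly.mmap (fun c : rat => ratr c) (fun k => x (enum_val k)) P.

Lemma qevalB x P Q : qeval x (P - Q) = qeval x P - qeval x Q.
Proof. exact: (rmorphB (mpoly.mmap (@ratr R) _)). Qed.

Lemma qevalM x P Q : qeval x (P * Q) = qeval x P * qeval x Q.
Proof. exact: (rmorphM (mpoly.mmap (@ratr R) _)). Qed.

Lemma qeval1 x : qeval x 1 = 1.
Proof. exact: (rmorph1 (mpoly.mmap (@ratr R) _)). Qed.

Lemma qevalC x c : qeval x (mpoly.mpolyC #|I| c) = ratr c.
Proof. exact: (mpoly.mmapC _ (@ratr R)). Qed.

Lemma qevalX x i : qeval x (mpoly.mpolyX rat (mpoly.mnm1 (enum_rank i))) = x i.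
Proof.
rewrite /qeval (mpoly.mmapX _ (@ratr R)) mpoly.mmap1U.
by rewrite enum_rankK.
Qed.

(** Polynomial functions with rational coefficients; no division is involved. *)
Definition ratfun g := exists P, forall x, g x = qeval x P.

Lemma ratfun_proj i : ratfun (fun x => x i).
Proof. by eexists=> x; rewrite -(qevalX x i). Qed.

Lemma ratfun_rat c : ratfun (fun=> ratr c).
Proof. by eexists=> x; rewrite -(qevalC x c). Qed.

Lemma ratfun1 : ratfun (fun=> 1).
Proof. by exists 1 => x; rewrite qeval1. Qed.

Lemma ratfunB g h : ratfun g -> ratfun h -> ratfun (fun x => g x - h x).
Proof. by move=> [P hP] [Q hQ]; exists (P - Q) => x; rewrite hP hQ qevalB. Qed.

Lemma ratfunM g h : ratfun g -> ratfun h -> ratfun (fun x => g x * h x).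
Proof. by move=> [P hP] [Q hQ]; exists (P * Q) => x; rewrite hP hQ qevalM. Qed.

Lemma ratfun_ext g h : (forall x, g x = h x) -> ratfun g -> ratfun h.
Proof. by move=> e [P hP]; exists P => x; rewrite -e. Qed.

Lemma ratfun0 : ratfun (fun=> 0).
Proof. by apply: ratfun_ext (ratfunB ratfun1 ratfun1) => x; rewrite subrr. Qed.

Lemma ratfunN g : ratfun g -> ratfun (fun x => - g x).
Proof. by move/(ratfunB ratfun0); apply: ratfun_ext => x; rewrite sub0r. Qed.

Lemma ratfunD g h : ratfun g -> ratfun h -> ratfun (fun x => g x + h x).
Proof. by move=> hg /ratfunN/(ratfunB hg); apply: ratfun_ext => x; rewrite opprK. Qed.

Lemma ratfun_sum (A : Type) (r : seq A) (P : pred A) (G : A -> (I -> R) -> R) :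
  (forall a, ratfun (G a)) -> ratfun (fun x => \sum_(a <- r | P a) G a x).
Proof.
move=> h; elim: r => [|a r ih].
  by apply: ratfun_ext ratfun0 => x; rewrite big_nil.
apply: ratfun_ext (_ : ratfun (fun x => (if P a then G a x else 0) + \sum_(a <- r | P a) G a x)) => [x|].
  by rewrite big_cons; case: ifP; rewrite ?add0r.
by apply: ratfunD => //; case: (P a); [exact: h | exact: ratfun0].
Qed.

Lemma ratfun_prod (A : Type) (r : seq A) (G : A -> (I -> R) -> R) :
  (forall a, ratfun (G a)) -> ratfun (fun x => \prod_(a <- r) G a x).
Proof.
move=> h; elim: r => [|a r ih].
  by apply: ratfun_ext ratfun1 => x; rewrite big_nil.
by apply: ratfun_ext (ratfunM (h a) ih) => x; rewrite big_cons.
Qed.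

Lemma ratfunX g n : ratfun g -> ratfun (fun x => g x ^+ n).
Proof.
move=> h; elim: n => [|n ih]; first exact: ratfun_ext ratfun1.
by apply: ratfun_ext (ratfunM h ih) => x; rewrite exprS.
Qed.

Lemma ratfun_det n (A : (I -> R) -> 'M[R]_n) :
  (forall i j, ratfun (fun x => A x i j)) -> ratfun (fun x => \det (A x)).
Proof.
move=> h; rewrite /determinant; apply: ratfun_sum => s.
apply: ratfunM; last exact: ratfun_prod.
by apply: ratfunX; apply: ratfunN; apply: ratfun1.
Qed.

(** Only the zero polynomial vanishes at [x0]. Every use of genericity passes through this transfer
    from one point to all. *)
Lemma generic_ratfun x0 g : alg_indep x0 -> ratfun g -> g x0 = 0 ->
  forall x, g x = 0.
Proof.
move=> gx [P hP] g0 x; rewrite hP.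
have [->|nP] := eqVneq P 0.
  by rewrite -(subrr 0) qevalB subrr.
by have := gx P nP; rewrite -/(qeval x0 P) -hP g0 eqxx.
Qed.

Lemma generic_indep x0 : alg_indep x0 -> indep x0 [set: I].
Proof.
move=> gx i _ h.
pose upd y := fun j => if j == i then y else x0 j.
(* Values of polynomial functions that do not change with coordinate [i]. A relation over them is a
   polynomial identity at [x0], hence everywhere; moving coordinate [i] alone then makes every real
   a root of [P]. *)
pose D r := exists2 g, ratfun g & forall y, g (upd y) = r.
have hD : subring_pred D.
  split.
  - by exists (fun=> 1) => //; exact: ratfun1.
  - by move=> a b [g hg ga] [k hk kb]; exists (fun x => g x - k x); [exact: ratfunB|move=> y; rewrite ga kb].
  - by move=> a b [g hg ga] [k hk kb]; exists (fun x => g x * k x); [exact: ratfunM|move=> y; rewrite ga kb].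
have {}h : acl D (x0 i).
  apply: acl_sub h => _ [j /setD1P[nj _] ->]; exists (fun x => x j).
    exact: ratfun_proj.
  by move=> y; rewrite /upd (negPf nj).
have [P [nP cP rP]] := acl_subring hD h.
have {}cP k : exists g, ratfun g /\ forall y, g (upd y) = P`_k.
  by have [g ? ?] := cP k; exists g.
have {cP} [g hg] := choice cP.
have updx : upd (x0 i) = x0 by apply: funext => j; rewrite /upd; case: eqP => // ->.
have q0 : ratfun (fun x => \sum_(k < size P) g k x * x i ^+ k).
  apply: ratfun_sum => k; apply: ratfunM; first exact: (hg k).1.
  by apply: ratfunX; apply: ratfun_proj.
have H := generic_ratfun gx q0.
have {}H y : root P y.
  rewrite rootE horner_coef; apply/eqP.
  transitivity (\sum_(k < size P) g k (upd y) * upd y i ^+ k); last first.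
    apply: H.
    rewrite -[RHS](rootP rP) [RHS]horner_coef; apply: eq_bigr => k _.
    by rewrite -{1}updx (hg k).2.
  by apply: eq_bigr => k _; rewrite (hg k).2 /upd eqxx.
have := @max_poly_roots _ P [seq k%:R | k <- iota 0 (size P)] nP.
rewrite size_map size_iota ltnn => C; suff : false by [].
apply: C; first by apply/allP => y _; exact: H.
by rewrite map_inj_uniq ?iota_uniq // => a b /eqP; rewrite eqr_nat => /eqP.
Qed.

End QPoly.

(** * Existence of generic points *)

Lemma digits_inj n B (m m' : 'I_n -> nat) :
  (forall i, m i < B)%N -> (forall i, m' i < B)%N ->
  (\sum_(i < n) m i * B ^ i = \sum_(i < n) m' i * B ^ i)%N -> forall i, m i = m' i.
Proof.
elim: n m m' => [|n ih] m m' hm hm'; first by move=> _ [].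
have E (a : 'I_n.+1 -> nat) : (\sum_(i < n.+1) a i * B ^ i =
    a ord0 + (\sum_(i < n) a (lift ord0 i) * B ^ i) * B)%N.
  rewrite big_ord_recl expn0 muln1 big_distrl; congr (_ + _)%N.
  by apply: eq_bigr => i _; rewrite lift0 expnS mulnA mulnAC.
rewrite !E => h.
have e0 : m ord0 = m' ord0.
  by have := congr1 (modn^~ B) h; rewrite ![(_ + _ * B)%N]addnC !modnMDl !modn_small.
have {}h : (\sum_(i < n) m (lift ord0 i) * B ^ i = \sum_(i < n) m' (lift ord0 i) * B ^ i)%N.
  have B0 : (0 < B)%N by apply: leq_ltn_trans (hm ord0).
  move/eqP: h; rewrite e0 eqn_add2l eqn_pmul2r //; exact/eqP.
move=> i; case: (unliftP ord0 i) => [j|] -> //.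
exact: (ih (fun j => m (lift ord0 j)) (fun j => m' (lift ord0 j))).
Qed.

Lemma mpoly_nonvanishing n (P : mpoly.mpoly n rat) : P != 0 ->
  exists a : 'I_n -> rat, mpoly.mmap idfun a P != 0.
Proof.
move=> nP; pose B := (\max_(m <- mpoly.msupp P) \max_(i < n) m i).+1.
have hB m i : m \in mpoly.msupp P -> (m i < B)%N.
  move=> hm; rewrite ltnS.
  apply: leq_trans (leq_bigmax_seq _ hm isT).
  exact: (leq_bigmax (F := fun i => m i)).
(* Kronecker substitution: distinct monomials of P get distinct powers of 'X *)
pose e (m : mpoly.multinom n) := (\sum_(i < n) m i * B ^ i)%N.
pose Q : {poly rat} := \sum_(m <- mpoly.msupp P) mpoly.mcoeff m P *: 'X^(e m).
have QE t : Q.[t] = mpoly.mmap idfun (fun i : 'I_n => t ^+ (B ^ i)%N) P.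
  rewrite /Q horner_sum; apply: eq_bigr => m _; rewrite hornerZ hornerXn.
  congr (_ * _); rewrite /mpoly.mmap1 /e -prodrXr /=.
  by apply: eq_bigr => i _; rewrite -exprM mulnC.
have nQ : Q != 0.
  move: (nP); rewrite -mpoly.msupp_eq0; case E : (mpoly.msupp P) => [//|m0 s] _.
  have hm0 : m0 \in mpoly.msupp P by rewrite E mem_head.
  apply/eqP => /polyP /(_ (e m0)); rewrite coef0 coef_sum.
  rewrite (bigD1_seq m0) ?mpoly.msupp_uniq //= coefZ coefXn eqxx mulr1.
  rewrite big1_seq ?addr0 => [/eqP|m /andP[nm hm]].
    by rewrite -[_ == 0]negbK -mpoly.mcoeff_msupp hm0.
  rewrite coefZ coefXn; case: eqP => [h|]; last by rewrite mulr0.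
  case/negP: nm; apply/eqP/mpoly.mnmP => i.
  by apply: esym; apply: (digits_inj (B := B)) h i => i; apply: hB.
have [t nt] : exists t, Q.[t] != 0.
  have := @max_poly_roots _ Q [seq k%:R | k <- iota 0 (size Q)] nQ.
  rewrite size_map size_iota ltnn => C; apply: contrapT => h.
  suff : false by []. apply: C.
    apply/allP => y _; apply/negP => /negP k; apply: h; exists y.
    by move: k; rewrite rootE.
  by rewrite map_inj_uniq ?iota_uniq // => a b /eqP; rewrite eqr_nat => /eqP.
by exists (fun i => t ^+ (B ^ i)%N); rewrite -QE.
Qed.


Lemma avoid_finite (R : realType) (s : seq R) (a b : R) : a < b ->
  exists c d, [/\ a <= c, c < d, d <= b & forall x, c <= x <= d -> x \notin s].
Proof.
elim: s a b => [|y s ih] a b ab; first by exists a, b; split.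
have [c' [d' [ac cd db hy]]] : exists c d, [/\ a <= c, c < d, d <= b & ~~ (c <= y <= d)].
  have [h|h] := ltP y ((a + b + b) / 3).
    by exists ((a + b + b) / 3), b; split; rewrite ?lexx //; lra.
  by exists a, ((a + a + b) / 3); split; rewrite ?lexx //; lra.
have [c [d [cc cd' dd hs]]] := ih _ _ cd.
exists c, d; split=> // [||x xcd]; [lra|lra|].
rewrite inE negb_or hs // andbT; apply: contraNneq hy => <-; lra.
Qed.

(** Cantor's nested intervals, the [n]-th one avoiding the [n]-th finite set. The index type will
    consist of codes of polynomials. *)
Lemma real_uncountable (R : realType) (C : countType) (F : C -> seq R) :
  exists x : R, forall c, x \notin F c.
Proof.
pose G n := if @unpickle C n is Some c then F c else [::].
pose ok (u v : R * R) n := [/\ u.1 <= v.1, v.2 <= u.2, v.1 < v.2 &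
  forall x, v.1 <= x <= v.2 -> x \notin G n].
have step (u : R * R) n : exists v, u.1 < u.2 -> ok u v n.
  have [h|h] := pselect (u.1 < u.2); last by exists u.
  have [c [d [h1 h2 h3 h4]]] := avoid_finite (G n) h.
  by exists (c, d).
have [nxt nxtP] := choice (fun un : (R * R) * nat => step un.1 un.2).
pose w := fix w n : R * R := if n is m.+1 then nxt (w m, m) else (0, 1).
have wlt n : (w n).1 < (w n).2.
  by elim: n => [|n ih] /=; [rewrite ltr01|have [] := nxtP (w n, n) ih].
have wok n : ok (w n) (w n.+1) n by apply: (nxtP (w n, n) (wlt n)).
have w1 n m : (w n).1 <= (w (n + m)%N).1.
  elim: m => [|m ih]; first by rewrite addn0.
  by rewrite addnS; apply: le_trans ih _; have [] := wok (n + m)%N.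
have w2 n m : (w (n + m)%N).2 <= (w n).2.
  elim: m => [|m ih]; first by rewrite addn0.
  by rewrite addnS; apply: le_trans _ ih; have [] := wok (n + m)%N.
have w12 n m : (w n).1 <= (w m).2.
  apply: le_trans (w1 n m) _; apply: le_trans (ltW (wlt _)) _.
  by rewrite addnC; apply: w2.
pose A : classical_sets.set R := fun r => exists n, r = (w n).1.
have hA : classical_sets.has_sup A.
  by split; [exists (w 0%N).1; exists 0%N|exists (w 0%N).2 => _ [n ->]].
exists (sup A) => c.
have [_ _ _ /(_ (sup A))] := wok (pickle c); rewrite /G pickleK; apply.
apply/andP; split; first by apply: ub_le_sup; [case: hA|exists (pickle c).+1].
by apply: ge_sup; [case: hA|move=> _ [n ->]].
Qed.

Lemma poly_roots_finite (E : fieldType) (P : {poly E}) : P != 0 ->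
  exists s : seq E, forall y, root P y -> y \in s.
Proof.
have [n] := ubnP (size P); elim: n P => // n ih P sP nP.
have [[y ry]|nr] := pselect (exists y, root P y); last first.
  by exists [::] => y ry; case: nr; exists y.
have /factor_theorem [Q eP] := ry.
have nQ : Q != 0 by apply: contraNneq nP => Q0; rewrite eP Q0 mul0r.
have [|//|s hs] := ih Q.
  by move: sP; rewrite eP size_Mmonic ?monicXsubC // size_XsubC addn2 /= ltnS.
exists (y :: s) => z; rewrite eP rootM root_XsubC inE.
by case/orP=> [/hs->|->//]; rewrite orbT.
Qed.

(** Polynomials over the ring generated by [x] have codes in a countable type, lists of lists of
    rational multiples of monomials. Each nonzero one has finitely many roots, so some real escapes
    them all. *)
Lemma acl_not_all (R : realType) (n : nat) (x : 'I_n -> R) :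
  exists y, ~ acl (fun z => exists i, z = x i) y.
Proof.
pose ev (c : seq (rat * mpoly.multinom n)) : R :=
  \sum_(t <- c) ratr t.1 * mpoly.mmap1 x t.2.
have /choice[rts rtsP] (P : {poly R}) :
    exists s : seq R, P != 0 -> forall y, root P y -> y \in s.
  have [->|/poly_roots_finite[s hs]] := eqVneq P 0; first by exists [::].
  by exists s.
have [y hy] := real_uncountable
  (fun cs : seq (seq (rat * mpoly.multinom n)) => rts (Poly (map ev cs))).
exists y => h.
pose D z := exists P, z = mpoly.mmap (@ratr R) x P.
have hD : subring_pred D.
  split.
  - by exists 1; rewrite rmorph1.
  - by move=> _ _ [P ->] [Q ->]; exists (P - Q); rewrite rmorphB.
  - by move=> _ _ [P ->] [Q ->]; exists (P * Q); rewrite rmorphM.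
have [|P [nP cP rP]] := acl_subring hD (y := y).
  apply: acl_sub h => _ [i ->]; exists (mpoly.mpolyX rat (mpoly.mnm1 i)).
  by rewrite mpoly.mmapX mpoly.mmap1U.
have /choice[c hc] i : exists c, ev c = P`_i.
  have [Q ->] := cP i; exists [seq (mpoly.mcoeff m Q, m) | m <- mpoly.msupp Q].
  by rewrite /ev big_map.
have := hy [seq c i | i <- iota 0 (size P)]; case/negP.
set Q := Poly _; suff -> : Q = P by apply: rtsP.
apply/polyP => i; rewrite coef_Poly; have [h1|h1] := ltnP i (size P).
  rewrite (nth_map [::]) ?size_map ?size_iota //.
  by rewrite (nth_map 0%N) ?size_iota // nth_iota // add0n hc.
by rewrite !nth_default // !size_map size_iota.
Qed.

Lemma generic_exists (R : realType) (I : finType) : exists x : I -> R, alg_indep x.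
Proof.
pose N := #|I|.
(* Each new coordinate is chosen outside the closure of the earlier ones. *)
have seq_ex k : exists x : nat -> R, forall j, (j < k)%N ->
    ~ acl (fun z => exists2 i, (i < j)%N & z = x i) (x j).
  elim: k => [|k [x hx]]; first by exists (fun=> 0).
  have [y hy] := acl_not_all (fun i : 'I_k => x i).
  exists (fun i => if i == k then y else x i) => j.
  rewrite ltnS leq_eqVlt => /predU1P[->|jk].
    rewrite eqxx => h; apply: hy; apply: acl_sub h => _ [i ik ->].
    by exists (Ordinal ik); rewrite ltn_eqF.
  rewrite ltn_eqF // => h; apply: (hx j jk); apply: acl_sub h => _ [i ij ->].
  by exists i; rewrite // ltn_eqF // (ltn_trans ij).
have [x hx] := seq_ex N.
exists (fun i => x (enum_rank i)) => P nP; apply/negP => /eqP P0.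
have {P0} P0 : mpoly.mmap (@ratr R) (fun k : 'I_N => x k) P = 0.
  rewrite -[RHS]P0; congr mpoly.mmap; apply: funext => k.
  by rewrite enum_valK.
have [a /negP] := mpoly_nonvanishing nP; apply.
(* the coordinates of the generic point are replaced by rationals one at a
   time, starting with the last one *)
pose z k : 'I_N -> R := fun i => if (i < k)%N then x i else ratr (a i).
suff /(_ 0%N (leq0n _)) : forall k, (k <= N)%N -> mpoly.mmap (@ratr R) (z k) P = 0.
  move=> h; rewrite -(fmorph_eq0 (@ratr R)); apply/eqP; rewrite -[RHS]h.
  rewrite /mpoly.mmap rmorph_sum; apply: eq_bigr => m _; rewrite rmorphM.
  by congr (_ * _); rewrite rmorph_prod; apply: eq_bigr => i _; rewrite rmorphXn.
suff h j : (j <= N)%N -> mpoly.mmap (@ratr R) (z (N - j)%N) P = 0.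
  by move=> k kN; rewrite -(subKn kN); apply: h; apply: leq_subr.
elim: j => [_|j ih jN].
  rewrite subn0 -[RHS]P0; congr mpoly.mmap; apply: funext => i.
  by rewrite /z ltn_ord.
have {ih} ih := ih (ltnW jN).
have [k kN ek] : exists2 k, (k < N)%N & (N - j)%N = k.+1.
  by exists (N - j.+1)%N; lia.
rewrite ek in ih; have -> : (N - j.+1)%N = k by rewrite subnS ek.
pose zX : 'I_N -> {poly R} := fun i => if (i < k)%N then (x i)%:P else
  if i == k :> nat then 'X else (ratr (a i))%:P.
(* [P] as a polynomial in coordinate [k] alone, the later coordinates being rational already. Its
   coefficients are algebraic over the earlier coordinates and its root [x k] is not, so [Q] is zero
   and [x k] may be replaced by [a k]. *)
pose Q := mpoly.mmap (polyC \o @ratr R) zX P.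
have QE y : Q.[y] = mpoly.mmap (@ratr R)
   (fun i => if (i < k)%N then x i else if i == k :> nat then y else ratr (a i)) P.
  rewrite /Q /mpoly.mmap horner_sum; apply: eq_bigr => m _ /=.
  rewrite hornerM hornerC; congr (_ * _); rewrite /mpoly.mmap1 horner_prod.
  apply: eq_bigr => i _; rewrite horner_exp; congr (_ ^+ _).
  by rewrite /zX; case: ifP => _; [|case: ifP => _]; rewrite !hornerE.
have Qx : root Q (x k).
  rewrite rootE QE -[X in _ == X]ih; apply/eqP; congr mpoly.mmap; apply: funext => i.
  by rewrite /z ltnS; case: (ltngtP i k) => // ->.
have Q0 : Q = 0.
  apply/eqP/negP => /negP nQ; apply: (hx k kN); apply: (acl_root nQ) Qx.
  move=> i; have cP (A B : {poly R}) S : (forall i, acl S A`_i) -> (forall i, acl S B`_i) ->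
     forall i, acl S (A * B)`_i.
    by move=> hA hB l; rewrite coefM; apply: acl_sum => ? _; apply: aclM.
  have cC c S : acl S c -> forall i, acl S (c%:P)`_i.
    by move=> hc l; rewrite coefC; case: ifP => _ //; apply: acl0.
  have crat c S : acl S (ratr c : R).
    rewrite /ratr; apply: aclM; last apply: aclV.
      case: (numq c) => l; first exact: acl_nat.
      by rewrite NegzE mulrNz; apply: aclN; apply: acl_nat.
    case: (denq c) => l; first exact: acl_nat.
    by rewrite NegzE mulrNz; apply: aclN; apply: acl_nat.
  rewrite /Q /mpoly.mmap coef_sum; apply: acl_sum => m _.
  apply: (cP) => [l /=|]; first by apply: cC; apply: crat.
  apply: (big_ind (fun A : {poly R} => forall b, acl _ A`_b)) => [l||l _].
  - by apply: cC; apply: acl1.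
  - by move=> A B hA hB; apply: cP.
  - have hz : forall i0 : nat, acl (fun z0 : R => exists2 i1 : nat, (i1 < k)%N & z0 = x i1) (zX l)`_i0.
      move=> i0; rewrite /zX; case: ltnP => lk.
        by apply: cC; apply: acl_in; exists l.
      case: ifP => _; last by apply: cC; apply: crat.
      by rewrite coefX; case: (_ == _); [exact: acl1|exact: acl0].
    elim: (m l) => [|b ih']; first by rewrite expr0; apply: cC; apply: acl1.
    by rewrite exprS; apply: cP.
have := QE (if insub k is Some i then ratr (a i) else 0).
rewrite Q0 horner0 => e0; rewrite [RHS]e0; congr mpoly.mmap; apply: funext => i.
rewrite /z; case: (ltnP i k) => // ki; case: (nat_of_ord i =P k) => // eik.
by rewrite -eik valK.
Qed.


(** * Squared lengths *)

Section Lengths.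
Variables (R : realType) (T : finType).
Implicit Types (p q : realisation R T) (x y i j v : T) (W X Y : {set T})
  (h : {set T}) (F E : {set {set T}}).

Definition d2 p x y : R := (p x 0 - p y 0) ^+ 2 + (p x 1 - p y 1) ^+ 2.

Lemma d2C p x y : d2 p x y = d2 p y x.
Proof. by rewrite /d2; ring. Qed.

Lemma d2xx p x : d2 p x x = 0.
Proof. by rewrite /d2; ring. Qed.

Lemma d2_ge0 p x y : 0 <= d2 p x y.
Proof. by rewrite /d2 addr_ge0 // sqr_ge0. Qed.

Lemma dist_eq p q x y : dist p x y = dist q x y <-> d2 p x y = d2 q x y.
Proof.
rewrite /dist -!/(d2 _ x y); split=> [h|->//].
by rewrite -[LHS]sqr_sqrtr ?d2_ge0 // h sqr_sqrtr // d2_ge0.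
Qed.

(** The halved sum over ordered pairs gives the squared length of a two-element set without ordering
    its ends, so that sets can index the matroid. *)
Definition len p h : R := (\sum_(x in h) \sum_(y in h) d2 p x y) / 2.

Lemma len2 p x y : len p [set x; y] = d2 p x y.
Proof.
have [->|nxy] := eqVneq x y.
  by rewrite /len setUid !big_set1 !d2xx mul0r.
rewrite /len !big_setU1 ?inE //= !big_set1 !big_setU1 ?inE //= !big_set1.
by rewrite !d2xx d2C; lra.
Qed.

Definition restr E W := [set h in E | h \subset W].

Definition pairs W := [set h : {set T} | (#|h| == 2) && (h \subset W)].

(** For [W] with at most one vertex the truncated bound is 0, which two-element edges respect. *)
Definition sparse F := (forall h, h \in F -> #|h| = 2%N) /\
  (forall W, (#|restr F W| <= 2 * #|W| - 3)%N).

Lemma pair_in x y W : x \in W -> y \in W -> x != y -> [set x; y] \in pairs W.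
Proof. by move=> xW yW nxy; rewrite inE cards2 nxy subUset !sub1set xW yW. Qed.

Lemma pairsP h W : h \in pairs W ->
  exists x y, [/\ x \in W, y \in W, x != y & h = [set x; y]].
Proof.
rewrite inE => /andP[/cards2P[x [y [nxy ->]]]]; rewrite subUset !sub1set.
by case/andP=> xW yW; exists x, y.
Qed.

Lemma acl_sqrt S (x : R) : acl S (x ^+ 2) -> acl S x.
Proof.
move=> h; apply: (@acl_root _ S ('X^2 - (x ^+ 2)%:P)).
- by rewrite -size_poly_gt0 size_XnsubC.
- move=> i; rewrite coefB coefXn coefC; apply: aclB; first exact: acl_nat.
  by case: (i == 0%N); [|exact: acl0].
- by rewrite rootE !hornerE subrr.
Qed.

Lemma acl_half S (x : R) : acl S (2 * x) -> acl S x.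
Proof.
move=> h; have -> : x = 2^-1 * (2 * x) by rewrite mulKf // pnatr_eq0.
by apply: aclM => //; apply: aclV; apply: acl_nat.
Qed.

(** * Points relative to two base points *)

Section Frame.
Variables (S : R -> Prop) (q : realisation R T) (i j : T).
Hypotheses (nij : d2 q i j != 0) (Sij : acl S (d2 q i j)).

Let dotu x := (q x 0 - q i 0) * (q j 0 - q i 0) + (q x 1 - q i 1) * (q j 1 - q i 1).
Let crossu x := (q x 0 - q i 0) * (q j 1 - q i 1) - (q x 1 - q i 1) * (q j 0 - q i 0).

Let acl_dot x : acl S (d2 q i x) -> acl S (d2 q j x) -> acl S (dotu x).
Proof.
move=> h1 h2; apply: acl_half.
have -> : 2 * dotu x = d2 q i x + d2 q i j - d2 q j x by rewrite /dotu /d2; ring.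
by apply: aclB => //; apply: aclD.
Qed.

Let acl_cross x : acl S (d2 q i x) -> acl S (d2 q j x) -> acl S (crossu x).
Proof.
move=> h1 h2; apply: acl_sqrt.
have -> : crossu x ^+ 2 = d2 q i x * d2 q i j - dotu x ^+ 2.
  by rewrite /crossu /dotu /d2; ring.
by apply: aclB; [apply: aclM|apply: aclX; apply: acl_dot].
Qed.

(** In the frame of [i] and [j], the dot product of a point and the square of its cross product are
    polynomials in the distances; the cross product itself is determined up to sign. *)
Lemma acl_five x y : acl S (d2 q i x) -> acl S (d2 q j x) ->
  acl S (d2 q i y) -> acl S (d2 q j y) -> acl S (d2 q x y).
Proof.
move=> h1 h2 h3 h4.
have -> : d2 q x y = d2 q i x + d2 q i y -
    2 * ((dotu x * dotu y + crossu x * crossu y) / d2 q i j).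
  apply: (mulIf nij); rewrite mulrBl -mulrA divfK //.
  by rewrite /dotu /crossu /d2; ring.
apply: aclB; first exact: aclD.
apply: aclM; first exact: acl_nat.
apply: aclM; last exact: aclV.
by apply: aclD; apply: aclM; do ?[exact: acl_dot|exact: acl_cross].
Qed.

Lemma acl_coord x : (forall k, acl S (q i k)) -> (forall k, acl S (q j k)) ->
  acl S (d2 q i x) -> acl S (d2 q j x) -> forall k, acl S (q x k).
Proof.
move=> hi hj h1 h2.
have e0 : q x 0 = q i 0 + (dotu x * (q j 0 - q i 0) + crossu x * (q j 1 - q i 1)) / d2 q i j.
  by apply: (mulIf nij); rewrite mulrDl divfK // /dotu /crossu /d2; ring.
have e1 : q x 1 = q i 1 + (dotu x * (q j 1 - q i 1) - crossu x * (q j 0 - q i 0)) / d2 q i j.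
  by apply: (mulIf nij); rewrite mulrDl divfK // /dotu /crossu /d2; ring.
have hd := acl_dot h1 h2; have hc := acl_cross h1 h2.
move=> k; have : (k == 0) || (k == 1) by case: k => [[|[|//]]].
case/orP=> /eqP->; rewrite ?e0 ?e1; (apply: aclD; first exact: hi);
  (apply: aclM; last exact: aclV).
- by apply: aclD; apply: aclM => //; apply: aclB.
- by apply: aclB; apply: aclM => //; apply: aclB.
Qed.

End Frame.

(** The edge [ij] with all edges from [i] and [j] to the rest of [W]: a minimally rigid graph, used
    as the standard spanning set of all pairs of [W]. *)
Definition star W i j : {set {set T}} :=
  [set i; j] |: ([set [set i; x] | x in W :\ i :\ j] :|: [set [set j; x] | x in W :\ i :\ j]).

Lemma card_star W i j : i \in W -> j \in W -> i != j -> (#|star W i j| <= 2 * #|W| - 3)%N.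
Proof.
move=> iW jW nij.
have e : #|W| = (#|W :\ i :\ j|).+2.
  by rewrite (cardsD1 i) iW (cardsD1 j) !inE eq_sym nij jW.
apply: (@leq_trans (1 + (#|W :\ i :\ j| + #|W :\ i :\ j|))); last by lia.
rewrite /star cardsU1; apply: leq_add; first by case: (_ \notin _).
by apply: leq_trans (leq_card_setU _ _) _; apply: leq_add; apply: leq_imset_card.
Qed.

Lemma star_span q W i j : i \in W -> j \in W -> d2 q i j != 0 ->
  forall h, h \in pairs W -> aspan (len q) (star W i j) h.
Proof.
move=> iW jW nij h /pairsP[x [y [xW yW nxy ->]]]; rewrite /aspan len2.
set S := vals _ _.
have Sij : acl S (d2 q i j).
  by apply: acl_in; exists [set i; j]; rewrite ?len2 // setU11.
have Si z : z \in W -> acl S (d2 q i z).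
  move=> zW; have [->|nzi] := eqVneq z i; first by rewrite d2xx; apply: acl0.
  have [->//|nzj] := eqVneq z j; apply: acl_in; exists [set i; z]; last by rewrite len2.
  by apply/setU1P; right; apply/setUP; left; apply: imset_f; rewrite !inE nzi nzj.
have Sj z : z \in W -> acl S (d2 q j z).
  move=> zW; have [->|nzi] := eqVneq z i; first by rewrite d2C.
  have [->|nzj] := eqVneq z j; first by rewrite d2xx; apply: acl0.
  apply: acl_in; exists [set j; z]; last by rewrite len2.
  by apply/setU1P; right; apply/setUP; right; apply: imset_f; rewrite !inE nzi nzj.
by apply: (acl_five nij); do ?[exact: Si|exact: Sj].
Qed.

Lemma indep_card_pairs q W F i j : i \in W -> j \in W -> d2 q i j != 0 ->
  F \subset pairs W -> indep (len q) F -> (#|F| <= 2 * #|W| - 3)%N.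
Proof.
move=> iW jW nij /subsetP sF iF; apply: leq_trans (card_star iW jW _); last first.
  by apply: contraNneq nij => ->; rewrite d2xx.
by apply: indep_card iF _ => h /sF; apply: star_span.
Qed.

Section Generic.
Variable p : realisation R T.
Hypothesis gp : generic p.

Lemma generic_coords_indep : indep (fun vk : T * 'I_2 => p vk.1 vk.2) [set: T * 'I_2].
Proof. exact: generic_indep. Qed.

Lemma generic_neq0 (g : realisation R T -> R) (q : realisation R T) :
  ratfun (fun z : T * 'I_2 -> R => g (fun v k => z (v, k))) -> g q != 0 -> g p != 0.
Proof.
move=> hg nq; apply: contraNneq nq => g0; apply/eqP.
exact: (generic_ratfun gp hg _ (fun vk => q vk.1 vk.2)).
Qed.

Lemma ratfun_d2 x y : ratfun (fun z : T * 'I_2 -> R => d2 (fun v k => z (v, k)) x y).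
Proof.
by apply: ratfunD; apply: ratfunX; apply: ratfunB; apply: ratfun_proj.
Qed.

Lemma generic_d2_neq0 x y : x != y -> d2 p x y != 0.
Proof.
move=> nxy; apply: (@generic_neq0 (fun p => d2 p x y) (fun z _ => (z == x)%:R)).
  exact: ratfun_d2.
by rewrite /d2 eqxx [y == x]eq_sym (negPf nxy) !subr0 !expr1n -(natrD _ 1 1) pnatr_eq0.
Qed.

Lemma indep_sparse F : (forall h, h \in F -> #|h| = 2%N) ->
  indep (len p) F -> sparse F.
Proof.
move=> F2 iF; split=> // W.
have sub h : h \in restr F W -> h \in pairs W by rewrite !inE => /andP[/F2->->].
have [E|] := eqVneq (restr F W) set0; first by rewrite E cards0.
case/set0Pn=> h0 /sub /pairsP[x [y [xW yW nxy _]]].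
apply: (indep_card_pairs xW yW (generic_d2_neq0 nxy)); first exact/subsetP.
by apply: indep_sub iF; apply/subsetP => h; rewrite inE => /andP[].
Qed.

Let fam (a : {set T} + T * 'I_2) : R :=
  match a with inl h => len p h | inr vk => p vk.1 vk.2 end.

(** Three coordinates, both of [p i] and one of [p j], remove the isometries of the plane. Together
    with the lengths in [E] they make all [2 * #|W|] coordinates algebraic, and these are
    independent. [fam] joins lengths and coordinates into one family for this comparison. *)
Lemma aspan_pairs_card E W : (2 <= #|W|)%N ->
  (forall h, h \in pairs W -> aspan (len p) E h) -> (2 * #|W| - 3 <= #|E|)%N.
Proof.
case/card_gt1P=> i [j [iW jW nij]] sE.
pose C : {set {set T} + T * 'I_2} := [set inr vk | vk in setX W [set: 'I_2]].
pose B : {set {set T} + T * 'I_2} := [set inl h | h in E] :|: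
  [set inr (i, 0); inr (i, 1); inr (j, 0)].
have cC : #|C| = (2 * #|W|)%N.
  by rewrite card_imset ?cardsX ?cardsT ?card_ord 1?mulnC // => a b [].
have cB : (#|B| <= #|E| + 3)%N.
  apply: leq_trans (leq_card_setU _ _) _; apply: leq_add; first exact: leq_imset_card.
  by rewrite -setUA !cardsU1 cards1; do 2!case: (_ \notin _).
suff : (#|C| <= #|B|)%N by lia.
apply: (@indep_card _ _ fam).
  move=> _ /imsetP[vk hvk ->] h; apply: (generic_coords_indep (i := vk)); rewrite ?inE //.
  apply: acl_sub h => _ [a /setD1P[n /imsetP[wl hwl ea]] ->]; exists wl; last by rewrite ea.
  by rewrite !inE andbT; apply: contra n => /eqP e; rewrite ea e.
set S := vals fam B.
have SB a : a \in B -> acl S (fam a) by move=> h; apply: acl_in; exists a.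
have Sd x y : x \in W -> y \in W -> x != y -> acl S (d2 p x y).
  move=> xW yW nxy; rewrite -len2; apply: acl_sub (sE _ (pair_in xW yW nxy)).
  move=> _ [h hE ->]; exists (inl h) => //; rewrite inE imset_f //.
have Si k : acl S (p i k).
  have : (k == 0) || (k == 1) by case: k => [[|[|//]]].
  by case/orP=> /eqP->; [apply: (SB (inr (i, 0)))|apply: (SB (inr (i, 1)))]; rewrite !inE eqxx ?orbT.
have Sj0 : acl S (p j 0) by apply: (SB (inr (j, 0))); rewrite !inE eqxx ?orbT.
have Sj1 : acl S (p j 1).
  have -> : p j 1 = (p j 1 - p i 1) + p i 1 by rewrite subrK.
  apply: aclD => //; apply: acl_sqrt.
  have -> : (p j 1 - p i 1) ^+ 2 = d2 p i j - (p j 0 - p i 0) ^+ 2 by rewrite /d2; ring.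
  by apply: aclB; [exact: Sd|apply: aclX; apply: aclB].
have Sj k : acl S (p j k).
  have : (k == 0) || (k == 1) by case: k => [[|[|//]]].
  by case/orP=> /eqP->.
move=> _ /imsetP[[x k] /setXP[xW _] ->]; rewrite /aspan /=.
have [->//|nxi] := eqVneq x i; have [->//|nxj] := eqVneq x j.
apply: (acl_coord (generic_d2_neq0 nij)) => //; first exact: Sd.
  by apply: Sd => //; rewrite eq_sym.
by apply: Sd => //; rewrite eq_sym.
Qed.

End Generic.
End Lengths.


(** * Sparse edge sets *)

Section Sparse.
Variable T : finType.
Implicit Types (x y a b c w : T) (W X Y A B : {set T}) (h : {set T})
  (F E : {set {set T}}).

Lemma restr_sub E W : restr E W \subset E.
Proof. by apply/subsetP => h; rewrite inE => /andP[]. Qed.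

Lemma restrS E F W : E \subset F -> restr E W \subset restr F W.
Proof. by move/subsetP=> s; apply/subsetP => h; rewrite !inE => /andP[/s->]. Qed.

Lemma sparse_sub E F : E \subset F -> sparse F -> sparse E.
Proof.
move=> s [F2 hF]; split=> [h /(subsetP s)/F2//|W].
by apply: leq_trans (hF W); apply/subset_leq_card/restrS.
Qed.

Lemma restrUI E A B :
  (#|restr E A| + #|restr E B| <= #|restr E (A :|: B)| + #|restr E (A :&: B)|)%N.
Proof.
rewrite -cardsUI; apply: leq_add; apply: subset_leq_card.
  rewrite subUset; apply/andP; split; apply/subsetP => h; rewrite !inE => /andP[-> s] /=.
    exact: subset_trans s (subsetUl _ _).
  exact: subset_trans s (subsetUr _ _).
by apply/subsetP => h; rewrite !inE subsetI => /andP[/andP[-> ->] /andP[_ ->]].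
Qed.

Definition tight F X := (2 <= #|X|)%N && (#|restr F X| == 2 * #|X| - 3)%N.

(** Induced edge counts are supermodular ([restrUI]), whereas [2 * #|W| - 3] is modular as long as
    it is not truncated; hence the two common vertices. *)
Lemma tightU F X Y : sparse F -> tight F X -> tight F Y -> (2 <= #|X :&: Y|)%N ->
  tight F (X :|: Y).
Proof.
move=> [_ sF] /andP[X2 /eqP tX] /andP[Y2 /eqP tY] I2.
have := restrUI F X Y; have := sF (X :|: Y); have := sF (X :&: Y).
have := subset_leq_card (subsetUl X Y); have := cardsUI X Y => *; apply/andP; split; first by lia.
by apply/eqP; lia.
Qed.

Lemma subset1_restr F X : (forall h, h \in F -> #|h| = 2%N) ->
  (#|X| <= 1)%N -> restr F X = set0.
Proof.
move=> F2 X1; apply/eqP; rewrite -subset0; apply/subsetP => h.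
by rewrite !inE => /andP[/F2 h2 /subset_leq_card]; rewrite h2 leqNgt ltnS X1.
Qed.

(** The pairwise intersections carry no edge, and three sets closing up to a triangle have sizes
    adding up to [n + 3], where [n] is the size of the union: [2 * (n + 3) - 9 = 2 * n - 3]. *)
Lemma tightU3 F X Y Z : sparse F -> tight F X -> tight F Y -> tight F Z ->
  (#|X :&: Y| <= 1)%N -> (#|X :&: Z| <= 1)%N -> (#|Y :&: Z| <= 1)%N ->
  (3 <= #|(X :&: Y) :|: (X :&: Z) :|: (Y :&: Z)|)%N ->
  tight F (X :|: Y :|: Z).
Proof.
move=> [F2 sF] /andP[X2 /eqP tX] /andP[Y2 /eqP tY] /andP[Z2 /eqP tZ] xy xz yz tri.
have rU : (#|restr F X| + #|restr F Y| + #|restr F Z| <= #|restr F (X :|: Y :|: Z)|)%N.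
  have d1 : restr F X :&: restr F Y = set0.
    apply/eqP; rewrite -subset0 -(subset1_restr F2 xy).
    by apply/subsetP => h; rewrite !inE subsetI => /andP[/andP[-> ->] /andP[_ ->]].
  have d2 : (restr F X :|: restr F Y) :&: restr F Z = set0.
    apply/eqP; rewrite -subset0 setIUl subUset.
    rewrite -{1}(subset1_restr F2 xz) -(subset1_restr F2 yz).
    by apply/andP; split; apply/subsetP => h; rewrite !inE subsetI => /andP[/andP[-> ->] /andP[_ ->]].
  have := cardsUI (restr F X) (restr F Y); rewrite d1 cards0 => e1.
  have := cardsUI (restr F X :|: restr F Y) (restr F Z); rewrite d2 cards0 => e2.
  suff : (#|restr F X :|: restr F Y :|: restr F Z| <= #|restr F (X :|: Y :|: Z)|)%N by lia.
  apply: subset_leq_card; apply/subsetP => h; rewrite !inE => /orP[/orP[]|] /andP[-> s] /=.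
  - by apply: subset_trans s _; rewrite -setUA subsetUl.
  - by apply: subset_trans s _; rewrite setUAC subsetUr.
  - by apply: subset_trans s _; rewrite subsetUr.
have c1 := cardsUI X Y; have c2 := cardsUI (X :|: Y) Z; rewrite setIUl in c2.
have [c3 _] := leq_card_setU (X :&: Z) (Y :&: Z).
have [c4 _] := leq_card_setU ((X :&: Y) :|: (X :&: Z)) (Y :&: Z).
have [c5 _] := leq_card_setU (X :&: Y) (X :&: Z).
have c6 : (2 <= #|(X :&: Z) :|: (Y :&: Z)|)%N.
  by have [] := leq_card_setU (X :&: Y) ((X :&: Z) :|: (Y :&: Z)); rewrite setUA; lia.
have := subset_leq_card (subsetUl (X :|: Y) Z); have := subset_leq_card (subsetUl X Y).
have := sF (X :|: Y :|: Z) => h; move=> *; apply/andP; split; first by lia.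
by apply/eqP; lia.
Qed.

Lemma sparse_add F a b : sparse F -> a != b ->
  (forall X, tight F X -> a \in X -> b \in X -> False) -> sparse ([set a; b] |: F).
Proof.
move=> [F2 sF] nab h; split=> [g /setU1P[->|/F2//]|W]; first by rewrite cards2 nab.
have sub : restr ([set a; b] |: F) W \subset [set a; b] |: restr F W.
  by apply/subsetP => g; rewrite !inE => /andP[/orP[->//|->] ->]; rewrite orbT.
have sW := sF W.
have [/andP[aW bW]|nW] := boolP ((a \in W) && (b \in W)); last first.
  apply: leq_trans sW; apply: subset_leq_card; apply/subsetP => g.
  rewrite !inE => /andP[/predU1P[->|->]] //; rewrite subUset !sub1set.
  by rewrite (negPf nW).
have W2 : (2 <= #|W|)%N.
  apply: (@leq_trans #|[set a; b]|); first by rewrite cards2 nab.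
  apply: subset_leq_card.
  by rewrite subUset !sub1set aW bW.
have : (#|restr F W| < 2 * #|W| - 3)%N.
  rewrite ltn_neqAle sW andbT; apply/negP => /eqP e.
  by apply: (h W) => //; apply/andP; split=> //; apply/eqP.
move=> lt; apply: leq_trans (subset_leq_card sub) _; rewrite cardsU1.
by case: (_ \notin _); lia.
Qed.

Definition inc F x := [set h in F | x \in h].

Lemma sum_inc F : (forall h, h \in F -> #|h| = 2%N) ->
  (\sum_(x : T) #|inc F x| = 2 * #|F|)%N.
Proof.
move=> F2; transitivity (\sum_(h in F) #|h|)%N; last first.
  by rewrite (eq_bigr (fun=> 2%N)) ?sum_nat_const 1?mulnC.
under eq_bigr => x _ do rewrite -sum1_card.
under [RHS]eq_bigr => h _ do rewrite -sum1_card.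
rewrite (exchange_big_dep (mem F)) /=; last by move=> x h _; rewrite inE => /andP[].
by apply: eq_bigr => h hF; apply: eq_bigl => x; rewrite inE hF.
Qed.

(** Otherwise all vertices of the set [W] of non-isolated vertices have degree at least 4, and [4 *
    #|W| <= 2 * #|F| <= 2 * (2 * #|W| - 3)]. *)
Lemma sparse_low_degree F : sparse F -> F != set0 ->
  exists x, (0 < #|inc F x| <= 3)%N.
Proof.
move=> [F2 sF] nF; apply: contrapT => h.
pose W := [set x | (0 < #|inc F x|)%N].
have FW : restr F W = F.
  apply/setP => g; rewrite !inE; case: (boolP (g \in F)) => //= gF.
  apply/subsetP => x xg; rewrite inE; apply/card_gt0P; exists g.
  by rewrite inE gF.
have := sF W; rewrite FW.
have : (\sum_(x in W) 4 <= \sum_(x : T) #|inc F x|)%N.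
  rewrite [X in (_ <= X)%N](bigID (mem W)) /=; apply: leq_trans (leq_addr _ _).
  apply: leq_sum => x; rewrite inE => x0; rewrite ltnNge; apply/negP => x3.
  by apply: h; exists x; rewrite x0.
rewrite sum_inc // sum_nat_const.
have : (0 < #|F|)%N by rewrite card_gt0.
lia.
Qed.

Lemma restr_incU F w X : w \in X ->
  restr F X = restr F (X :\ w) :|: [set h in inc F w | h \subset X].
Proof.
move=> wX; apply/setP => h; rewrite !inE subsetD1 andbA.
by case: (h \in F) => //=; case: (h \subset X); case: (w \in h); rewrite ?andbF.
Qed.

Lemma restr_no_inc F w X : sparse F -> inc F w = set0 -> tight F X ->
  (3 <= #|X|)%N -> w \notin X.
Proof.
move=> [_ sF] iw /andP[_ /eqP tX] X3; apply/negP => wX.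
have := sF (X :\ w); have := cardsD1 w X; rewrite wX.
have : restr F X = restr F (X :\ w).
  rewrite (restr_incU _ wX) iw; apply/setP => h; rewrite !inE; exact: orbF.
by move=> e; rewrite e in tX; lia.
Qed.

(** A replacement edge is blocked only by a set tight in [F'] that contains its ends; an edge
    already in [F] is its own blocking set. If all three are blocked, two or three blocking sets
    have a tight union containing [a], [b] and [c]. *)
Lemma henneberg F w a b c : sparse F ->
  a != b -> b != c -> a != c -> w \notin [set a; b; c] ->
  inc F w = [set [set w; a]; [set w; b]; [set w; c]] ->
  let F' := F :\: inc F w in
  [\/ [set a; b] \notin F /\ sparse ([set a; b] |: F'),
      [set b; c] \notin F /\ sparse ([set b; c] |: F')
    | [set a; c] \notin F /\ sparse ([set a; c] |: F')].
Proof.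
move=> sF nab nbc nac; rewrite !inE !negb_or -andbA => /and3P[nwa nwb nwc] iw F'.
have [F2 _] := sF.
have sF' : sparse F' by apply: sparse_sub sF; apply: subsetDl.
have iF' : inc F' w = set0.
  by apply/setP => h; rewrite !inE; case: (h \in F); case: (w \in h).
have pair2 (x y : T) : x != y -> [set x; y] \in F' -> tight F' [set x; y].
  move=> nxy hF; rewrite /tight cards2 nxy /= eqn_leq.
  have [_ /(_ [set x; y])] := sF'; rewrite cards2 nxy /= => ->.
  by apply/card_gt0P; exists [set x; y]; rewrite inE hF /=.
have inF' (x y : T) : w != x -> w != y -> ([set x; y] \in F') = ([set x; y] \in F).
  by move=> wx wy; rewrite !inE (negPf wx) (negPf wy) andbF.
(* With [w] and its three edges, [w |: X] would carry [2 * #|X|] edges, one more than sparsity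
   allows. *)
have key X : tight F' X -> a \in X -> b \in X -> c \in X -> False.
  move=> tX aX bX cX; have X3 : (3 <= #|X|)%N.
    apply: (@leq_trans #|[set a; b; c]|).
      by rewrite -setUA !cardsU1 !inE !negb_or nab nac nbc cards1.
    by apply: subset_leq_card; rewrite !subUset !sub1set aX bX cX.
  have wX := restr_no_inc sF' iF' tX X3.
  have [_ /(_ (w |: X))] := sF; rewrite cardsU1 wX.
  rewrite (restr_incU _ (setU11 w X)) setU1K // cardsU.
  have -> : restr F X :&: [set h in inc F w | h \subset w |: X] = set0.
    apply/setP => h; rewrite !inE; apply/negP.
    case/andP=> /andP[_ /subsetP s] /andP[/andP[_ /s h2] _]; by rewrite h2 in wX.
  have -> : [set h in inc F w | h \subset w |: X] = inc F w.
    apply/setP => h; rewrite inE iw; case: (boolP (h \in _)) => //= hh.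
    move: hh; rewrite !inE -orbA => /or3P[] /eqP->; rewrite subUset !sub1set !inE eqxx.
    - by rewrite aX orbT.
    - by rewrite bX orbT.
    - by rewrite cX orbT.
  have -> : #|inc F w| = 3%N.
    rewrite iw -setUA !cardsU1 !inE !negb_or cards1.
    have nn (x y : T) : w != y -> x != y -> [set w; x] != [set w; y].
      move=> wy xy; apply/eqP => /setP /(_ y); rewrite !inE eqxx orbT.
      by rewrite eq_sym (negPf wy) eq_sym (negPf xy).
    by rewrite !nn.
  move: tX => /andP[_]; have -> : restr F' X = restr F X.
    apply/setP => h; rewrite !inE; case: (boolP (h \subset X)) => [/subsetP s|]; rewrite ?andbF //.
    by case: (boolP (w \in h)) => [/s|]; [rewrite (negPf wX)|case: (h \in F)].
  by move=> /eqP ->; rewrite cards0; lia.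
have block (x y : T) : x != y -> w != x -> w != y ->
    ~ ([set x; y] \notin F /\ sparse ([set x; y] |: F')) ->
    exists X, [/\ tight F' X, x \in X & y \in X].
  move=> nxy wx wy h; apply: contrapT => nX; apply: h.
  have xyF : [set x; y] \notin F.
    apply/negP; rewrite -inF' // => xF; apply: nX; exists [set x; y].
    by split; [exact: pair2|exact: set21|exact: set22].
  split=> //; apply: sparse_add => // X tX xX yX; apply: nX; exists X; split=> //.
apply: contrapT => nn.
have [X [tX aX bX]] : exists X, [/\ tight F' X, a \in X & b \in X].
  by apply: block => // h; apply: nn; apply: Or31.
have [Y [tY bY cY]] : exists X, [/\ tight F' X, b \in X & c \in X].
  by apply: block => // h; apply: nn; apply: Or32.
have [Z [tZ aZ cZ]] : exists X, [/\ tight F' X, a \in X & c \in X].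
  by apply: block => // h; apply: nn; apply: Or33.
have sm (A B : {set T}) : tight F' A -> tight F' B ->
   (a \in A :|: B) -> b \in A :|: B -> c \in A :|: B -> (#|A :&: B| <= 1)%N.
  move=> tA tB aa bb cc; rewrite leqNgt; apply/negP => I2.
  exact: (key _ (tightU sF' tA tB I2)).
have tU : tight F' (X :|: Y :|: Z).
  apply: tightU3 => //; do ?[by apply: sm => //; rewrite inE ?aX ?bX ?cY ?aZ ?cZ ?bY ?orbT].
  apply: (@leq_trans #|[set b; a; c]|).
    by rewrite -setUA !cardsU1 !inE !negb_or eq_sym nab nac nbc cards1.
  by apply: subset_leq_card; rewrite !subUset !sub1set !inE aX bX bY cY aZ cZ ?orbT.
by apply: (key _ tU); rewrite !inE ?aX ?bX ?cY ?orbT.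
Qed.

End Sparse.


(** * Stresses and Laman's theorem *)

Section Stress.
Variables (R : realType) (T : finType).
Implicit Types (p q : realisation R T) (x y a b c w : T) (h : {set T})
  (F E : {set {set T}}) (om : {set T} -> R).

(** Linear independence of the rows of the rigidity matrix. The summand [y = x] contributes
    nothing. *)
Definition stressfree F p := forall om, (forall h, h \notin F -> om h = 0) ->
  (forall x k, \sum_y om [set x; y] * (p x k - p y k) = 0) -> forall h, om h = 0.

Definition rigidity_row p h (vk : T * 'I_2) : R :=
  \sum_y (h == [set vk.1; y])%:R * (p vk.1 vk.2 - p y vk.2).

Definition rigidity_mx F p : 'M[R]_(#|F|, #|{: T * 'I_2}|) :=
  \matrix_(i, c) rigidity_row p (enum_val i) (enum_val c).

Lemma sum_rigidity_row F p om x k : (forall h, h \notin F -> om h = 0) ->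
  \sum_(h in F) om h * rigidity_row p h (x, k) =
  \sum_y om [set x; y] * (p x k - p y k).
Proof.
move=> om0; rewrite /rigidity_row /=.
under eq_bigr => h _ do rewrite mulr_sumr.
rewrite exchange_big /=; apply: eq_bigr => y _.
have [hF|hF] := boolP ([set x; y] \in F).
  rewrite (bigD1 _ hF) /= eqxx mul1r big1 ?addr0 // => h /andP[_ /negPf->].
  by rewrite mul0r mulr0.
rewrite (om0 _ hF) mul0r big1 // => h hF'.
case: eqP => [e|_]; last by rewrite mul0r mulr0.
by rewrite -e hF' in hF.
Qed.

(** Over the reals a vector with zero self-product vanishes, so independent rows have an invertible
    Gram matrix. Its determinant is one polynomial in the coordinates, which is what lets
    independence pass to generic points. *)
Lemma gram_unit F p : stressfree F p ->
  rigidity_mx F p *m (rigidity_mx F p)^T \in unitmx.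
Proof.
move=> sf; set M := rigidity_mx F p; rewrite -row_free_unit; apply: inj_row_free => u uG.
have uM : u *m M = 0.
  have : (u *m M) *m (u *m M)^T = 0 by rewrite trmx_mul mulmxA -(mulmxA u) uG mul0mx.
  move: (u *m M) => v vv; apply/rowP => c; rewrite mxE.
  move/matrixP: vv => /(_ 0 0); rewrite !mxE.
  under eq_bigr => j _ do rewrite mxE -expr2.
  move/eqP; rewrite psumr_eq0 => [/allP /(_ c)|j _]; last by rewrite sqr_ge0.
  by rewrite mem_index_enum sqrf_eq0 => /(_ isT)/eqP.
pose om h := \sum_(i < #|F|) (enum_val i == h)%:R * u 0 i.
have omE i : om (enum_val i) = u 0 i.
  rewrite /om (bigD1 i) //= eqxx mul1r big1 ?addr0 // => j nji.
  by rewrite (inj_eq enum_val_inj) (negPf nji) mul0r.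
have om0 h : h \notin F -> om h = 0.
  move=> hF; rewrite /om big1 // => i _; case: eqP => [e|]; rewrite ?mul0r //.
  by rewrite -e enum_valP in hF.
apply/rowP => i; rewrite mxE -omE; apply: sf => // x k.
rewrite -(sum_rigidity_row p x k om0) big_enum_val.
move/rowP: uM => /(_ (enum_rank (x, k))); rewrite !mxE => e; rewrite -[RHS]e.
by apply: eq_bigr => j _; rewrite omE mxE enum_rankK.
Qed.

Lemma unit_stressfree F p :
  rigidity_mx F p *m (rigidity_mx F p)^T \in unitmx -> stressfree F p.
Proof.
set M := rigidity_mx F p => uG om om0 eq.
have u0 : \row_i om (enum_val i) = 0 :> 'rV_#|F|.
  have uM : \row_i om (enum_val i) *m M = 0.
    apply/rowP => c; rewrite !mxE; case E : (enum_val c) => [x k].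
    rewrite -[RHS](eq x k) -[RHS](sum_rigidity_row p x k om0) [RHS]big_enum_val.
    by apply: eq_bigr => i _; rewrite !mxE E.
  by rewrite -[LHS](mulmxK uG) mulmxA uM !mul0mx.
move=> h; have [hF|/om0//] := boolP (h \in F).
move/rowP: u0 => /(_ (enum_rank_in hF h)); rewrite !mxE enum_rankK_in //.
Qed.

Lemma stressfree_generic F p q : generic p -> stressfree F q -> stressfree F p.
Proof.
move=> gp /gram_unit uq; apply: unit_stressfree; rewrite unitmxE unitfE.
rewrite unitmxE unitfE in uq.
apply: (@generic_neq0 _ _ p gp (fun p => \det (rigidity_mx F p *m (rigidity_mx F p)^T)) q) => //.
apply: ratfun_det => i j.
apply: (@ratfun_ext _ _ (fun z : T * 'I_2 -> R => \sum_c rigidity_row (fun v k => z (v, k)) (enum_val i) (enum_val c) *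
   rigidity_row (fun v k => z (v, k)) (enum_val j) (enum_val c))).
  by move=> z; rewrite !mxE; apply: eq_bigr => c _; rewrite !mxE.
have rr (l : 'I_#|F|) (c : T * 'I_2) : ratfun (fun z : T * 'I_2 -> R => rigidity_row (fun v k => z (v, k)) (enum_val l) c).
  apply: ratfun_sum => y; apply: ratfunM; last by apply: ratfunB; apply: ratfun_proj.
  by case: (_ == _); [exact: ratfun1|exact: ratfun0].
by apply: ratfun_sum => c; apply: ratfunM.
Qed.

Definition edge_set F := forall h, h \in F -> #|h| = 2%N.

Lemma stressfree_extend F p w : edge_set F ->
  (forall f : T -> R, (forall y, [set w; y] \notin F -> f y = 0) ->
    (forall k, \sum_y f y * (p w k - p y k) = 0) -> forall y, f y = 0) ->
  stressfree (F :\: inc F w) p -> stressfree F p.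
Proof.
move=> F2 hw sf om om0 eq.
have omw y : om [set w; y] = 0.
  by apply: (hw (fun y => om [set w; y])) => // z; apply: om0.
apply: sf => // h; rewrite !inE; have [hF|hF] := boolP (h \in F); last by rewrite om0.
have /eqP/cards2P[x [y [_ eh]]] := F2 _ hF.
rewrite andbT negbK {1}eh !inE => /orP[]/eqP e; first by rewrite eh -e.
by rewrite eh setUC -e.
Qed.

Definition cross p a b c : R :=
  (p b 0 - p a 0) * (p c 1 - p a 1) - (p b 1 - p a 1) * (p c 0 - p a 0).

Lemma generic_cross_neq0 p a b c : generic p -> a != b -> a != c -> b != c ->
  cross p a b c != 0.
Proof.
move=> gp nab nac nbc.
apply: (@generic_neq0 _ _ p gp (fun p => cross p a b c)
   (fun z k => if k == 0 then (z == b)%:R else (z == c)%:R)).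
  by apply: ratfunB; apply: ratfunM; apply: ratfunB; apply: ratfun_proj.
by rewrite /cross /= !eqxx (negPf nab) (negPf nac) (negPf nbc) [c == b]eq_sym (negPf nbc) !subr0 mul1r mul0r subr0 oner_eq0.
Qed.

Lemma sum2 (f g : T -> R) a b : a != b -> (forall y, y != a -> y != b -> f y = 0) ->
  \sum_y f y * g y = f a * g a + f b * g b.
Proof.
move=> nab f0; rewrite (bigD1 a) //= (bigD1 b) 1?eq_sym //= big1 ?addr0 // => y.
by case/andP=> ya yb; rewrite f0 // mul0r.
Qed.

Lemma stressfree_ext2 F p w a b : generic p -> edge_set F -> a != b -> w != a -> w != b ->
  (forall y, [set w; y] \in F -> y \in [set a; b]) ->
  stressfree (F :\: inc F w) p -> stressfree F p.
Proof.
move=> gp F2 nab nwa nwb hN; apply: stressfree_extend => // f f0 eq.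
have fab y : y != a -> y != b -> f y = 0.
  by move=> ya yb; apply: f0; apply/negP => /hN; rewrite !inE (negPf ya) (negPf yb).
have := eq 0; rewrite (sum2 _ nab fab) => e0.
have := eq 1; rewrite (sum2 _ nab fab) => e1.
have nc := generic_cross_neq0 gp nwa nwb nab.
have fa : f a = 0.
  apply: (mulIf nc); rewrite mul0r /cross.
  transitivity ((f a * (p w 0 - p a 0) + f b * (p w 0 - p b 0)) * (p w 1 - p b 1)
    - (f a * (p w 1 - p a 1) + f b * (p w 1 - p b 1)) * (p w 0 - p b 0)); first by ring.
  by rewrite e0 e1; ring.
have fb : f b = 0.
  apply: (mulIf nc); rewrite mul0r /cross.
  transitivity ((f a * (p w 1 - p a 1) + f b * (p w 1 - p b 1)) * (p w 0 - p a 0)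
    - (f a * (p w 0 - p a 0) + f b * (p w 0 - p b 0)) * (p w 1 - p a 1)); first by ring.
  by rewrite e0 e1; ring.
move=> y; have [->//|ya] := eqVneq y a; have [->//|yb] := eqVneq y b.
exact: fab.
Qed.

Lemma stressfree_ext1 F p w a : generic p -> edge_set F -> w != a ->
  (forall y, [set w; y] \in F -> y = a) ->
  stressfree (F :\: inc F w) p -> stressfree F p.
Proof.
move=> gp F2 nwa hN; apply: stressfree_extend => // f f0 eq.
have fab y : y != a -> f y = 0.
  by move=> ya; apply: f0; apply: contraNN ya => /hN/eqP.
have E k : f a * (p w k - p a k) = 0.
  rewrite -[RHS](eq k) (bigD1 a) //= big1 ?addr0 // => y ya.
  by rewrite fab // mul0r.
have fa : f a = 0.
  apply: (mulIf (generic_d2_neq0 gp nwa)); rewrite mul0r /d2 mulrDr !expr2 !mulrA !E.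
  by rewrite !mul0r addr0.
by move=> y; have [->//|ya] := eqVneq y a; apply: fab.
Qed.

(* the new vertex is placed at the midpoint of the removed edge [ab]: its two
   collinear edges then carry the stress of [ab] *)
Lemma stressfree_ext3 F p w a b c : generic p -> edge_set F ->
  a != b -> b != c -> a != c -> w != a -> w != b -> w != c ->
  [set a; b] \notin F ->
  (forall y, [set w; y] \in F -> y \in [set a; b; c]) ->
  stressfree ([set a; b] |: (F :\: inc F w)) p -> stressfree F p.
Proof.
move=> gp F2 nab nbc nac nwa nwb nwc abF hN sf.
pose q : realisation R T := fun x k => if x == w then (p a k + p b k) / 2 else p x k.
have qw k : q w k = (p a k + p b k) / 2 by rewrite /q eqxx.
have qE x k : x != w -> q x k = p x k by rewrite /q => /negPf->.
apply: (@stressfree_generic F p q) => // om om0 eq.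
have omN y : y != a -> y != b -> y != c -> om [set w; y] = 0.
  by move=> ya yb yc; apply: om0; apply/negP => /hN; rewrite !inE (negPf ya) (negPf yb) (negPf yc).
have E k : (om [set w; a] - om [set w; b]) * ((p b k - p a k) / 2) +
    om [set w; c] * ((p a k + p b k) / 2 - p c k) = 0.
  rewrite -[RHS](eq w k) (bigD1 a) //= (bigD1 b) 1?eq_sym //= (bigD1 c); last first.
    by rewrite ![c == _]eq_sym nac nbc.
  rewrite /= big1 => [|y /andP[/andP[ya yb] yc]]; last by rewrite omN // mul0r.
  rewrite qw !qE; try by rewrite eq_sym.
  by rewrite addr0; lra.
have nc := generic_cross_neq0 gp nab nac nbc.
have omc : om [set w; c] = 0.
  apply: (mulIf nc); rewrite mul0r /cross.
  transitivity (((om [set w; a] - om [set w; b]) * ((p b 1 - p a 1) / 2) +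
    om [set w; c] * ((p a 1 + p b 1) / 2 - p c 1)) * (p a 0 - p b 0) -
   ((om [set w; a] - om [set w; b]) * ((p b 0 - p a 0) / 2) +
    om [set w; c] * ((p a 0 + p b 0) / 2 - p c 0)) * (p a 1 - p b 1)); first by field.
  by rewrite !E; ring.
have omab : om [set w; a] = om [set w; b].
  have nd := generic_d2_neq0 gp nab; apply/eqP; rewrite -subr_eq0; apply/eqP.
  have E' k : (om [set w; a] - om [set w; b]) * (p a k - p b k) = 0.
    by have := E k; rewrite omc mul0r addr0; lra.
  by apply: (mulIf nd); rewrite mul0r /d2 mulrDr !expr2 !mulrA !E' !mul0r addr0.
pose om' h := if w \in h then 0 else om h + (h == [set a; b])%:R * (om [set w; a] / 2).
have wab : w \notin [set a; b] by rewrite !inE negb_or nwa nwb.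
have om'0 : forall h, om' h = 0.
  apply: sf => [h|x k].
    rewrite !inE negb_or => /andP[/negPf hab hF]; rewrite /om' hab mul0r addr0.
    case: ifP => // wh; apply: om0; move: hF; rewrite wh andbF //.
  have [->|xw] := eqVneq x w.
    by rewrite big1 // => y _; rewrite /om' set21 mul0r.
  rewrite -[RHS](eq x k) [RHS](bigD1 w) //= [LHS](bigD1 w) //=.
  rewrite {1}/om' set22 mul0r add0r.
  have e1 y : y != w -> w \notin [set x; y].
    by move=> yw; rewrite !inE negb_or ![w == _]eq_sym xw yw.
  transitivity (\sum_(y | y != w) (om [set x; y] * (q x k - q y k) +
      ([set x; y] == [set a; b])%:R * (om [set w; a] / 2) * (p x k - p y k))).
    by apply: eq_bigr => y yw; rewrite /om' (negPf (e1 y yw)) !qE // mulrDl.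
  rewrite big_split /= addrC; congr (_ + _).
  have [xa|xa] := eqVneq x a.
    rewrite (bigD1 b) /=; last by rewrite eq_sym.
    rewrite xa eqxx mul1r big1 ?addr0 => [|y /andP[_ yb]]; last first.
      suff -> : ([set a; y] == [set a; b]) = false by rewrite !mul0r.
      apply/eqP => /setP /(_ b); rewrite !inE eqxx orbT [b == a]eq_sym (negPf nab).
      by rewrite [b == y]eq_sym (negPf yb).
    by rewrite [[set a; w]]setUC qw qE 1?eq_sym //; lra.
  have [xb|xb] := eqVneq x b.
    rewrite (bigD1 a) /=; last by rewrite eq_sym.
    rewrite xb setUC eqxx mul1r big1 ?addr0 => [|y /andP[_ ya]]; last first.
      suff -> : ([set b; y] == [set a; b]) = false by rewrite !mul0r.
      apply/eqP => /setP /(_ a); rewrite !inE eqxx /= (negPf nab).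
      by rewrite [a == y]eq_sym (negPf ya).
    by rewrite [[set b; w]]setUC -omab qw qE 1?eq_sym //; lra.
  rewrite big1 => [|y _]; last first.
    suff -> : ([set x; y] == [set a; b]) = false by rewrite !mul0r.
    by apply/eqP => /setP /(_ x); rewrite !inE eqxx (negPf xa) (negPf xb).
  rewrite setUC; have [->|xc] := eqVneq x c; first by rewrite omc mul0r.
  by rewrite omN // mul0r.
have oma : om [set w; a] = 0.
  have := om'0 [set a; b]; rewrite /om' (negPf wab) eqxx (om0 _ abF) mul1r; lra.
move=> h; have := om'0 h; rewrite /om' oma mul0r mulr0 addr0.
case: ifP => // wh _; have [hF|/om0//] := boolP (h \in F).
have /eqP/cards2P[x [y [_ eh]]] := F2 _ hF.
have omw y' : om [set w; y'] = 0.
  have [->//|ya] := eqVneq y' a; have [->|yb] := eqVneq y' b; first by rewrite -omab.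
  by have [->//|yc] := eqVneq y' c; apply: omN.
move: wh; rewrite eh !inE => /orP[]/eqP <- //.
by rewrite setUC.
Qed.

(** Henneberg's construction read backwards at a vertex of degree at most 3: degrees 1 and 2 are
    removed, degree 3 is traded for an edge between two neighbours. *)
Theorem laman F p : generic p -> sparse F -> stressfree F p.
Proof.
move=> gp; have [n] := ubnP #|F|; elim: n F => // n ih F nF sF.
have F2 : edge_set F by case: sF.
have [F0|/(sparse_low_degree sF)[w /andP[w0 w3]]] := eqVneq F set0.
  by move=> om om0 _ h; apply: om0; rewrite F0 inE.
have lt : (#|F :\: inc F w| < #|F|)%N.
  by rewrite cardsD (setIidPr _) ?ltn_subrL ?w0 ?(leq_trans w0) ?subset_leq_card //;
     apply/subsetP => h; rewrite inE => /andP[].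
have sF' : sparse (F :\: inc F w) by apply: sparse_sub sF; apply: subsetDl.
have ihF' : stressfree (F :\: inc F w) p by apply: ih => //; apply: leq_trans lt _.
pose N := [set y | [set w; y] \in F].
have incE : inc F w = [set [set w; y] | y in N].
  apply/setP => h; rewrite inE; apply/andP/imsetP => [[hF wh]|[y yN ->]].
    have /eqP/cards2P[x [y [_ eh]]] := F2 _ hF.
    move: wh; rewrite eh !inE => /orP[]/eqP e.
      by exists y; rewrite ?inE e // -eh.
    by exists x; rewrite ?inE e setUC // -eh.
  by rewrite inE in yN; rewrite yN set21.
have wN y : y \in N -> w != y.
  by rewrite inE => /F2 h; apply/eqP => e; rewrite e setUid cards1 in h.
have cN : #|inc F w| = #|N|.
  rewrite incE card_in_imset // => y z yN zN /setP /(_ y).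
  rewrite !inE eqxx orbT [y == w]eq_sym (negPf (wN y yN)) /= => /esym/eqP //.
have : (#|N| == 1) || (#|N| == 2) || (#|N| == 3)%N by rewrite -cN; lia.
case/orP; first case/orP.
- case/cards1P=> a Na; have aN : a \in N by rewrite Na set11.
  apply: (stressfree_ext1 gp F2 (wN _ aN)) => // y yF; apply/set1P; rewrite -Na inE.
  exact: yF.
- case/cards2P=> a [b [nab Nab]].
  have [aN bN] : a \in N /\ b \in N by rewrite Nab set21 set22.
  apply: (stressfree_ext2 gp F2 nab (wN _ aN) (wN _ bN)) => // y yF; rewrite -Nab inE.
  exact: yF.
- move/eqP => N3; have [a aN] : exists a, a \in N by apply/card_gt0P; rewrite N3.
  have /cards2P[b [c [nbc Nbc]]] : #|N :\ a| == 2%N.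
    by rewrite -(eqn_add2l (a \in N)) -cardsD1 N3 aN.
  have [/setD1P[ba bN] /setD1P[ca cN']] : b \in N :\ a /\ c \in N :\ a.
    by rewrite Nbc set21 set22.
  have Nabc : N = [set a; b; c] by rewrite -setUA -Nbc setD1K.
  have nab : a != b by rewrite eq_sym.
  have nac : a != c by rewrite eq_sym.
  have wabc : w \notin [set a; b; c].
    by rewrite -Nabc; apply/negP => /wN; rewrite eqxx.
  have incw : inc F w = [set [set w; a]; [set w; b]; [set w; c]].
    by rewrite incE Nabc -setUA !imsetU1 imset_set1 setUA.
  have lt2 x y : (#|[set x; y] |: F :\: inc F w| < n)%N.
    have : #|F :\: inc F w| = (#|F| - 3)%N.
      rewrite cardsD (setIidPr _) ?cN ?N3 //.
      by apply/subsetP => h; rewrite inE => /andP[].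
    have : (3 <= #|F|)%N.
      by rewrite -N3 -cN; apply/subset_leq_card/subsetP => h; rewrite inE => /andP[].
    rewrite cardsU1; set b1 := (_ \notin _); have := leq_b1 b1 => h1 h2 ->.
    by move: (nat_of_bool b1) h1 (#|F|) h2 nF => k h1 m h2 nF; lia.
  have hN y : [set w; y] \in F -> y \in [set a; b; c] by rewrite -Nabc inE.
  have [] := henneberg sF nab nbc nac wabc incw => -[nF' sF''].
  + by apply: (@stressfree_ext3 F p w a b c) => //; do ?[exact: wN]; apply: ih.
  + apply: (@stressfree_ext3 F p w b c a) => //; do ?[exact: wN]; do ?[by rewrite eq_sym]; last exact: ih.
    by move=> y /hN; rewrite !inE; case: (y == a); case: (y == b); case: (y == c).
  + apply: (@stressfree_ext3 F p w a c b) => //; do ?[exact: wN]; do ?[by rewrite eq_sym]; last exact: ih.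
    by move=> y /hN; rewrite !inE; case: (y == a); case: (y == b); case: (y == c).
Qed.

End Stress.


(** * Local solvability of the length equations *)

Section Solve.
Variable R : realType.

Lemma archi_half (c x : R) : (forall n, x <= c / 2 ^+ n) -> x <= 0.
Proof.
move=> h; rewrite leNgt; apply/negP => x0.
have c0 : 0 < c.
  by have := h 0%N; rewrite expr0 divr1; apply: lt_le_trans.
have [n hn] : exists n : nat, c / x < n%:R.
  exists (Num.bound (c / x)); have := archi_boundP (divr_ge0 (ltW c0) (ltW x0)) => //.
have hn2 : (n%:R : R) <= 2 ^+ n by rewrite -natrX ler_nat ltnW // ltn_expl.
have := h n; rewrite leNgt => /negP; apply.
rewrite ltr_pdivrMr ?exprn_gt0 // -ltr_pdivrMl // mulrC.
exact: lt_le_trans hn hn2.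
Qed.

(** The intervals of radius [2 * c / 2 ^+ n] about [s n] are nested; the supremum of their left ends
    is the limit. *)
Lemma geometric_limit (s : nat -> R) (c : R) :
  (forall n, `|s n.+1 - s n| <= c / 2 ^+ n) ->
  exists l, forall n, `|l - s n| <= 2 * c / 2 ^+ n.
Proof.
move=> hs; pose lo n := s n - 2 * c / 2 ^+ n; pose hi n := s n + 2 * c / 2 ^+ n.
have p2 n : 0 < 2 ^+ n :> R by rewrite exprn_gt0.
have c0 : 0 <= c by have := le_trans (normr_ge0 _) (hs 0%N); rewrite expr0 divr1.
have half n : 2 * c / 2 ^+ n.+1 = c / 2 ^+ n.
  by rewrite exprS; field; rewrite lt0r_neq0.
have dbl n : 2 * c / 2 ^+ n = c / 2 ^+ n + c / 2 ^+ n.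
  by rewrite -mulrDl; congr (_ / _); ring.
have lo_mono n m : lo n <= lo (n + m)%N.
  elim: m => [|m ih]; first by rewrite addn0.
  apply: le_trans ih _; rewrite addnS /lo half dbl.
  by have := hs (n + m)%N; rewrite ler_norml => /andP[]; lra.
have hi_mono n m : hi (n + m)%N <= hi n.
  elim: m => [|m ih]; first by rewrite addn0.
  apply: le_trans _ ih; rewrite addnS /hi half dbl.
  by have := hs (n + m)%N; rewrite ler_norml => /andP[]; lra.
have lohi n m : lo n <= hi m.
  apply: le_trans (lo_mono n m) _; apply: (@le_trans _ _ (hi (n + m)%N)).
    rewrite /lo /hi; suff : 0 <= 2 * c / 2 ^+ (n + m) by lra.
    by rewrite divr_ge0 ?mulr_ge0 // ltW.
  by rewrite addnC; apply: hi_mono.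
pose A : classical_sets.set R := fun r => exists n, r = lo n.
have hA : classical_sets.has_sup A.
  by split; [exists (lo 0%N); exists 0%N|exists (hi 0%N) => _ [n ->]].
exists (sup A) => n; rewrite ler_norml; apply/andP; split.
  suff : lo n <= sup A by rewrite /lo; lra.
  by apply: ub_le_sup; [case: hA|exists n].
suff : sup A <= hi n by rewrite /hi; lra.
by apply: ge_sup; [case: hA|move=> _ [m ->]].
Qed.

Variables (I : finType) (Q : (I -> R) -> I -> R) (C : R).
Hypothesis Q0 : forall i, Q (fun=> 0) i = 0.
(** The Lipschitz bound of a homogeneous quadratic map: the constant shrinks with the radius of the
    ball. *)
Hypothesis Qlip : forall (u v : I -> R) (r s : R),
  (forall i, `|u i| <= r) -> (forall i, `|v i| <= r) -> (forall i, `|u i - v i| <= s) ->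
  forall i, `|Q u i - Q v i| <= C * r * s.

(* Newton-type iteration u -> (tau - Q u) / 2, a contraction on a small ball *)
Lemma quadratic_solve (r : R) (tau : I -> R) : 0 <= r -> C * r <= 1 ->
  (forall i, `|tau i| <= r) ->
  exists u : I -> R, (forall i, `|u i| <= r) /\ forall i, 2 * u i + Q u i = tau i.
Proof.
move=> r0 Cr ht.
pose w := fix w n : I -> R :=
  if n is m.+1 then fun i => (tau i - Q (w m) i) / 2 else fun=> 0.
have wr n i : `|w n i| <= r.
  elim: n i => [|n ih] i /=; first by rewrite normr0.
  have := Qlip ih (v := fun=> 0) (s := r) _ _ i; rewrite Q0 subr0 => h.
  have {}h : `|Q (w n) i| <= r.
    apply: le_trans (h _ _) _ => [j|j|]; rewrite ?normr0 ?subr0 //.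
    by rewrite -[leRHS]mul1r ler_wpM2r.
  move: (ht i) h; rewrite !ler_norml => /andP[? ?] /andP[? ?]; apply/andP; split; lra.
have wd n i : `|w n.+1 i - w n i| <= r / 2 ^+ n.
  elim: n i => [|n ih] i.
    by have := wr 1%N i; rewrite /= expr0 divr1 subr0.
  have h := Qlip (wr n.+1) (wr n) ih i.
  have {}h : `|Q (w n.+1) i - Q (w n) i| <= r / 2 ^+ n.
    apply: le_trans h _; rewrite -[leRHS]mul1r ler_wpM2r //.
    by rewrite divr_ge0 // exprn_ge0.
  have -> : w n.+2 i - w n.+1 i = - (Q (w n.+1) i - Q (w n) i) / 2.
    by rewrite /=; field.
  rewrite normrM normrN normfV (@ger0_norm _ 2) // exprS invfM [2^-1 * _]mulrC mulrA.
  by rewrite ler_wpM2r // invr_ge0.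
have /choice[l hl] i : exists l, forall n, `|l - w n i| <= 2 * r / 2 ^+ n.
  exact: geometric_limit (fun n => wd n i).
have lr i : `|l i| <= r.
  rewrite -subr_le0; apply: (@archi_half (2 * r)) => n.
  have := hl i n; have := wr n i; have := ler_distD (w n i) (l i) 0.
  rewrite !subr0; lra.
exists l; split=> // i; apply/eqP; rewrite -subr_eq0 -normr_le0.
apply: (@archi_half (4 * r)) => n.
have e : 2 * w n.+1 i + Q (w n) i = tau i by rewrite /=; field.
have -> : 2 * l i + Q l i - tau i = 2 * (l i - w n.+1 i) + (Q l i - Q (w n) i).
  by rewrite -e; ring.
have h1 := hl i n.+1.
have h2 := Qlip lr (wr n) (fun j => hl j n) i.
have h3 : C * r * (2 * r / 2 ^+ n) <= 2 * r / 2 ^+ n.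
  by rewrite -[leRHS]mul1r ler_wpM2r // divr_ge0 ?mulr_ge0 // exprn_ge0.
have e4 : 2 * r / 2 ^+ n = 2 * (2 * r / 2 ^+ n.+1).
  by rewrite exprS; field; rewrite expf_neq0 // pnatr_eq0.
have e5 : 4 * r / 2 ^+ n = 2 * (2 * r / 2 ^+ n) by field; rewrite expf_neq0 // pnatr_eq0.
apply: le_trans (ler_normD _ _) _; rewrite normrM (@ger0_norm _ 2) // e5.
rewrite e4 in h3 h2 *; lra.
Qed.

End Solve.

Section Flex.
Variables (R : realType) (T : finType).
Implicit Types (p q d : realisation R T) (h : {set T}) (F : {set {set T}}).

Definition displace p d : realisation R T := fun x k => p x k + d x k.

Lemma sum_I2 (f : 'I_2 -> R) : \sum_k f k = f 0 + f 1.
Proof. by rewrite big_ord_recl big_ord1; congr (f _ + f _); apply: val_inj. Qed.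

Lemma len_displace p d h : #|h| = 2%N ->
  len (displace p d) h = len p h +
    2 * (\sum_x \sum_k rigidity_row p h (x, k) * d x k) + len d h.
Proof.
move/eqP/cards2P => [a [b [nab ->]]]; rewrite !len2.
have rowE x k : rigidity_row p [set a; b] (x, k) =
    (x == a)%:R * (p a k - p b k) + (x == b)%:R * (p b k - p a k).
  rewrite /rigidity_row /=.
  have [->|xa] := eqVneq x a.
    rewrite (negPf nab) mul0r addr0 mul1r (bigD1 b) //= eqxx mul1r big1 ?addr0 // => y yb.
    suff -> : ([set a; b] == [set a; y]) = false by rewrite mul0r.
    by apply/eqP => /setP /(_ b); rewrite !inE eqxx orbT eq_sym (negPf nab) eq_sym (negPf yb).
  have [->|xb] := eqVneq x b.
    rewrite mul0r add0r mul1r (bigD1 a) //= setUC eqxx mul1r big1 ?addr0 // => y ya.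
    suff -> : ([set b; a] == [set b; y]) = false by rewrite mul0r.
    by apply/eqP => /setP /(_ a); rewrite !inE eqxx orbT (negPf nab) eq_sym (negPf ya).
  rewrite !mul0r addr0 big1 // => y _.
  suff -> : ([set a; b] == [set x; y]) = false by rewrite mul0r.
  by apply/eqP => /setP /(_ x); rewrite !inE eqxx (negPf xa) (negPf xb).
have -> : \sum_x \sum_k rigidity_row p [set a; b] (x, k) * d x k =
    (p a 0 - p b 0) * (d a 0 - d b 0) + (p a 1 - p b 1) * (d a 1 - d b 1).
  under eq_bigr => x _ do rewrite sum_I2 !rowE.
  rewrite (bigD1 a) //= (bigD1 b) 1?eq_sym //= big1 => [|x /andP[/negPf xa /negPf xb]].
    by rewrite !eqxx ![b == a]eq_sym (negPf nab) !mul0r !mul1r; ring.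
  by rewrite xa xb !mul0r addr0 !mul0r addr0.
by rewrite /d2 /displace; ring.
Qed.

(** Squared lengths are exactly quadratic in a displacement. On the range of a right inverse [N] of
    the rigidity matrix the length equations read [2 * u + Q u = tau], and [quadratic_solve] applies
    with [tau] supported on [e]. *)
Lemma local_flex F p (e : {set T}) : edge_set F -> stressfree F p ->
  forall eta : R, 0 < eta -> exists2 del : R, 0 < del & forall t, `|t| <= del ->
    exists q, [/\ forall x k, `|q x k - p x k| <= eta,
      forall h, h \in F -> h != e -> len q h = len p h
      & e \in F -> len q e = len p e + t].
Proof.
move=> F2 sf eta eta0; have uG := gram_unit sf.
set M := rigidity_mx F p in uG.
pose N := M^T *m invmx (M *m M^T).
have MN : M *m N = 1%:M by rewrite mulmxA mulmxV.
pose D (u : 'I_#|F| -> R) : realisation R T :=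
  fun x k => \sum_i N (enum_rank (x, k)) i * u i.
pose Q (u : 'I_#|F| -> R) (i : 'I_#|F|) := len (D u) (enum_val i).
pose B := 1 + \sum_c \sum_i `|N c i|.
have B0 : 0 <= \sum_c \sum_i `|N c i| by apply: sumr_ge0 => c _; apply: sumr_ge0.
have DB (u : 'I_#|F| -> R) r x k : 0 <= r -> (forall i, `|u i| <= r) -> `|D u x k| <= B * r.
  move=> r0 hu; apply: le_trans (ler_norm_sum _ _ _) _.
  apply: (@le_trans _ _ ((\sum_c \sum_i `|N c i|) * r)); last first.
    by rewrite ler_wpM2r // /B; lra.
  rewrite mulr_suml (bigD1 (enum_rank (x, k))) //=.
  rewrite -[leLHS]addr0 lerD //; last first.
    by apply: sumr_ge0 => c _; rewrite mulr_ge0 // sumr_ge0.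
  rewrite mulr_suml; apply: ler_sum => i _; rewrite normrM ler_wpM2l //.
have DD (u v : 'I_#|F| -> R) x k : D u x k - D v x k = D (fun i => u i - v i) x k.
  by rewrite /D -sumrB; apply: eq_bigr => i _; rewrite mulrBr.
have Q0 i : Q (fun=> 0) i = 0.
  have D0 x k : D (fun=> 0) x k = 0 by rewrite /D big1 // => j _; rewrite mulr0.
  rewrite /Q; have /eqP/cards2P[a [b [_ ->]]] := F2 _ (enum_valP i).
  by rewrite len2 /d2 !D0 subrr expr0n addr0.
(* Each of the two coordinates gives a difference of squares, at most [2 * (B * s)] times
   [4 * (B * r)]. *)
have Qlip (u v : 'I_#|F| -> R) (r s : R) :
  (forall i, `|u i| <= r) -> (forall i, `|v i| <= r) -> (forall i, `|u i - v i| <= s) ->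
  forall i, `|Q u i - Q v i| <= (16 * B ^+ 2) * r * s.
  move=> hu hv hs i.
  have r0 : 0 <= r by apply: le_trans (hu i).
  have s0 : 0 <= s by apply: le_trans (hs i).
  rewrite /Q; have /eqP/cards2P[a [b [_ ->]]] := F2 _ (enum_valP i).
  rewrite !len2 /d2.
  have dk k : `|(D u a k - D u b k) ^+ 2 - (D v a k - D v b k) ^+ 2| <= 8 * B ^+ 2 * r * s.
    rewrite subr_sqr normrM.
    have -> : 8 * B ^+ 2 * r * s = (2 * (B * s)) * (4 * (B * r)) by ring.
    apply: ler_pM => //.
      have -> : D u a k - D u b k - (D v a k - D v b k) =
         D (fun i => u i - v i) a k - D (fun i => u i - v i) b k by rewrite -!DD; ring.
      apply: le_trans (ler_normB _ _) _.
      by have := DB _ _ a k s0 hs; have := DB _ _ b k s0 hs; lra.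
    apply: le_trans (ler_normD _ _) _.
    have := ler_normB (D u a k) (D u b k); have := ler_normB (D v a k) (D v b k).
    have := DB _ _ a k r0 hu; have := DB _ _ b k r0 hu.
    by have := DB _ _ a k r0 hv; have := DB _ _ b k r0 hv; lra.
  have := dk 0; have := dk 1; set A0 := D u a 0 - _; set A1 := D u a 1 - _.
  set B0' := D v a 0 - _; set B1 := D v a 1 - _; move=> h1 h0.
  have -> : A0 ^+ 2 + A1 ^+ 2 - (B0' ^+ 2 + B1 ^+ 2) =
    (A0 ^+ 2 - B0' ^+ 2) + (A1 ^+ 2 - B1 ^+ 2) by ring.
  apply: le_trans (ler_normD _ _) _.
  have -> : 16 * B ^+ 2 * r * s = 8 * B ^+ 2 * r * s + 8 * B ^+ 2 * r * s by ring.
  exact: lerD.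
have B1 : 0 < B by rewrite /B; lra.
(* The first bound makes the iteration converge, the second keeps the displacement, at most [B * r],
   within [eta]. *)
pose r := Num.min ((16 * B ^+ 2)^-1) (eta / B).
have r0 : 0 < r by rewrite lt_min invr_gt0 divr_gt0 // mulr_gt0 // exprn_gt0.
have rB : B * r <= eta.
  by rewrite -ler_pdivlMl // mulrC /r ge_min lexx orbT.
have rC : 16 * B ^+ 2 * r <= 1.
  rewrite -ler_pdivlMl ?mulr1; last by rewrite mulr_gt0 // exprn_gt0.
  by rewrite /r ge_min lexx.
exists r => // t ht.
have [|//||u [ur eu]] := @quadratic_solve R _ Q (16 * B ^+ 2) Q0 Qlip r
    (fun i => if enum_val i == e then t else 0).
- exact: ltW.
- by move=> i; case: ifP => // _; rewrite normr0 ltW.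
have lenE (i : 'I_#|F|) : len (displace p (D u)) (enum_val i) =
    len p (enum_val i) + (2 * u i + Q u i).
  rewrite len_displace ?(F2 _ (enum_valP i)) // -/(Q u i) -!addrA; congr (_ + (2 * _ + _)).
  transitivity (\sum_c M i c * (\sum_j N c j * u j)).
    rewrite pair_bigA /= (reindex (@enum_val _ {: T * 'I_2})) /=; last first.
      by exists enum_rank => c _; [rewrite enum_valK|rewrite enum_rankK].
    by apply: eq_bigr => c _; rewrite mxE /D -surjective_pairing enum_valK.
  transitivity (\sum_j (M *m N) i j * u j).
    under eq_bigr => c _ do rewrite mulr_sumr.
    rewrite exchange_big; apply: eq_bigr => j _; rewrite mxE mulr_suml.
    by apply: eq_bigr => c _; rewrite mulrA.
  rewrite MN (bigD1 i) //= mxE eqxx mul1r big1 ?addr0 // => j ji.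
  by rewrite mxE eq_sym (negPf ji) mul0r.
exists (displace p (D u)); split.
- move=> x k; rewrite /displace addrC addKr; apply: le_trans rB.
  exact: DB (ltW r0) ur.
- move=> h hF nhe; have := lenE (enum_rank_in hF h); rewrite eu enum_rankK_in //.
  by rewrite (negPf nhe) addr0.
- move=> eF; have := lenE (enum_rank_in eF e); rewrite eu enum_rankK_in // eqxx.
  by [].
Qed.

End Flex.


(** * Generic rigidity *)

Section Rigid.
Variables (R : realType) (T : finType).
Implicit Types (p q : realisation R T) (x y a b w : T) (X Y : {set T})
  (h e : {set T}) (E F : {set {set T}}).

Lemma ratfun_len h : ratfun (fun z : T * 'I_2 -> R => len (fun v k => z (v, k)) h).
Proof.
apply: ratfunM; first by apply: ratfun_sum => x; apply: ratfun_sum => y; apply: ratfun_d2.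
apply: ratfun_ext (ratfun_rat R (T * 'I_2)%type (2^-1)) => z.
by rewrite (fmorphV (@ratr R)) /= (rmorph_nat (@ratr R)).
Qed.

(** The coefficients of an algebraic relation at [p] can be taken as polynomial functions that are
    constant on the realisations agreeing with [p] on [F]. By genericity the relation holds for all
    of these, so a spanned length takes finitely many values on them. *)
Lemma relation_transfer p F e : generic p -> aspan (len p) F e ->
  exists2 P : {poly R}, P != 0 &
    forall q, (forall h, h \in F -> len q h = len p h) -> root P (len q e).
Proof.
move=> gp se.
pose D r := exists2 g : realisation R T -> R,
  ratfun (fun z : T * 'I_2 -> R => g (fun v k => z (v, k))) &
  forall q, (forall h, h \in F -> len q h = len p h) -> g q = r.
have hD : subring_pred D.
  split.
  - by exists (fun=> 1) => //; exact: ratfun1.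
  - move=> r s [g hg gr] [k hk ks]; exists (fun q => g q - k q); first exact: ratfunB.
    by move=> q hq; rewrite gr ?ks.
  - move=> r s [g hg gr] [k hk ks]; exists (fun q => g q * k q); first exact: ratfunM.
    by move=> q hq; rewrite gr ?ks.
have {}se : acl D (len p e).
  apply: acl_sub se => _ [h hF ->]; exists (fun q => len q h); first exact: ratfun_len.
  by move=> q; apply.
have [P [nP cP rP]] := acl_subring hD se.
have /choice[g hg] k : exists g : realisation R T -> R,
    ratfun (fun z : T * 'I_2 -> R => g (fun v k => z (v, k))) /\
    forall q, (forall h, h \in F -> len q h = len p h) -> g q = P`_k.
  by have [g ? ?] := cP k; exists g.
exists P => // q hq; rewrite rootE horner_coef; apply/eqP.
have rf : ratfun (fun z : T * 'I_2 -> R =>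
    \sum_(k < size P) g k (fun v k => z (v, k)) * len (fun v k => z (v, k)) e ^+ k).
  apply: ratfun_sum => k; apply: ratfunM; first exact: (hg k).1.
  by apply: ratfunX; apply: ratfun_len.
have := generic_ratfun gp rf _ (fun vk => q vk.1 vk.2).
rewrite /= => H; rewrite -[RHS]H.
  by apply: eq_bigr => k _; rewrite (hg k).2.
rewrite -[RHS](rootP rP) [RHS]horner_coef; apply: eq_bigr => k _.
by rewrite (hg k).2.
Qed.

(** Stress-freeness lets the length of [e] vary while the others stay fixed; a transferred relation
    would be a nonzero polynomial with too many roots. *)
Lemma sparse_indep p F : generic p -> sparse F -> indep (len p) F.
Proof.
move=> gp sF e eF se; have F2 : edge_set F by case: sF.
have [P nP rP] := relation_transfer gp se.
have [del del0 hdel] := local_flex e F2 (laman gp sF) ltr01.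
have := @max_poly_roots _ P [seq len p e + del / k.+1%:R | k <- iota 0 (size P)] nP.
rewrite size_map size_iota ltnn => C; suff : false by []; apply: C.
  apply/allP => _ /mapP[k _ ->].
  have [|q [_ h1 h2]] := hdel (del / k.+1%:R).
    have d0 := ltW del0.
    by rewrite ger0_norm ?divr_ge0 // ler_pdivrMr ?ltr0n // ler_peMr // ler1n.
  by rewrite -h2 //; apply: rP => h /setD1P[nhe hF]; apply: h1.
rewrite map_inj_uniq ?iota_uniq // => k l /addrI /(mulfI (lt0r_neq0 del0)) /invr_inj /eqP.
by rewrite eqr_nat => /eqP[].
Qed.

(** A spanning Laman subgraph. Being free of realisations, this notion is carried along by
    automorphisms; its algebraic form is given by [crigid_aspan] and [aspan_crigid]. A set with at
    most one vertex is rigid, by truncation. *)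
Definition crigid E X :=
  exists F, [/\ F \subset restr E X, sparse F & #|F| = (2 * #|X| - 3)%N].

Lemma restr_pairs E X : edge_set E -> restr E X \subset pairs X.
Proof. by move=> E2; apply/subsetP => h; rewrite !inE => /andP[/E2->->]. Qed.

(** [F] is independent, lies in the span of a star and is at least as large, so it spans whatever
    the star spans. *)
Lemma crigid_aspan p E X : generic p -> edge_set E -> crigid E X ->
  forall h, h \in pairs X -> aspan (len p) (restr E X) h.
Proof.
move=> gp E2 [F [sFE sF cF]] h hX.
have [x [y [xX yX nxy _]]] := pairsP hX.
apply: (aspan_sub sFE).
apply: (indep_span (sparse_indep gp sF) (G := star X x y)).
- move=> g /(subsetP sFE)/(subsetP (restr_pairs X E2)).
  by apply: star_span => //; apply: generic_d2_neq0.
- by rewrite cF; apply: card_star.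
- by apply: star_span => //; apply: generic_d2_neq0.
Qed.

Lemma aspan_crigid p E X : generic p -> edge_set E ->
  (forall h, h \in pairs X -> aspan (len p) (restr E X) h) -> crigid E X.
Proof.
move=> gp E2 sE; have [X2|X1] := leqP 2 #|X|; last first.
  exists set0; split; first exact: sub0set; last by rewrite cards0; lia.
  split=> [h|W]; first by rewrite inE.
  by apply: leq_trans (leq0n _); rewrite leqn0 cards_eq0 -subset0 restr_sub.
have [F [sFE iF sF]] := basis_exists (len p) (restr E X).
have spF : sparse F.
  apply: (indep_sparse gp) iF => h /(subsetP sFE); rewrite inE => /andP[/E2//].
exists F; split=> //; apply/eqP; rewrite eqn_leq; apply/andP; split; last first.
  by apply: (aspan_pairs_card gp X2) => h /sE hX; apply: aspan_trans hX _.
have [_ /(_ X)] := spF; suff -> : restr F X = F by [].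
apply/setP => h; rewrite inE; case: (boolP (h \in F)) => //= /(subsetP sFE).
by rewrite inE => /andP[].
Qed.

Lemma crigid_acl p E X x y : generic p -> edge_set E -> crigid E X ->
  x \in X -> y \in X -> acl (vals (len p) (restr E X)) (d2 p x y).
Proof.
move=> gp E2 rX xX yX; have [->|nxy] := eqVneq x y; first by rewrite d2xx; exact: acl0.
by rewrite -len2; apply: (crigid_aspan gp E2 rX); apply: pair_in.
Qed.

Lemma acl_crigid p E X : generic p -> edge_set E ->
  (forall x y, x \in X -> y \in X -> acl (vals (len p) (restr E X)) (d2 p x y)) ->
  crigid E X.
Proof.
move=> gp E2 h; apply: (aspan_crigid gp E2) => g /pairsP[x [y [xX yX _ ->]]].
by rewrite /aspan len2; apply: h.
Qed.

Lemma restr_vals_sub p E X Y r : X \subset Y ->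
  acl (vals (len p) (restr E X)) r -> acl (vals (len p) (restr E Y)) r.
Proof.
move=> sXY; apply: acl_sub => s [h hX es]; exists h => //; move: hX.
rewrite !inE => /andP[-> hX] /=; exact: subset_trans hX sXY.
Qed.

End Rigid.

Section RigidSets.
Variables (R : realType) (T : finType) (E : {set {set T}}).
Hypothesis E2 : edge_set E.
Implicit Types (x y a b w : T) (X Y : {set T}).

Lemma generic_realisation : exists p : realisation R T, generic p.
Proof.
have [x gx] := generic_exists R (T * 'I_2)%type; exists (fun v k => x (v, k)).
rewrite /generic; suff <- : x = (fun vk => x (vk.1, vk.2)) by [].
by apply: funext => -[].
Qed.

(** Distances across the union come from [acl_five] with two common vertices as base, in an
    auxiliary generic realisation. *)
Lemma crigidU X Y : crigid E X -> crigid E Y -> (2 <= #|X :&: Y|)%N ->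
  crigid E (X :|: Y).
Proof.
have [p gp] := generic_realisation.
move=> rX rY /card_gt1P[i [j [/setIP[iX iY] /setIP[jX jY] nij]]].
apply: (acl_crigid gp E2); set S := vals _ _.
have SX x y : x \in X -> y \in X -> acl S (d2 p x y).
  by move=> xX yX; apply: restr_vals_sub (subsetUl X Y) _; apply: (crigid_acl gp E2).
have SY x y : x \in Y -> y \in Y -> acl S (d2 p x y).
  by move=> xX yX; apply: restr_vals_sub (subsetUr X Y) _; apply: (crigid_acl gp E2).
move=> x y /setUP[xX|xY] /setUP[yX|yY]; do ?[exact: SX|exact: SY];
  apply: (acl_five (i := i) (j := j)); do ?[exact: SX|exact: SY]; exact: generic_d2_neq0.
Qed.

Lemma crigidU1 X w a b : crigid E X -> a \in X -> b \in X -> a != b ->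
  [set w; a] \in E -> [set w; b] \in E -> crigid E (w |: X).
Proof.
have [p gp] := generic_realisation.
move=> rX aX bX nab waE wbE; apply: (acl_crigid gp E2); set S := vals _ _.
have SX x y : x \in X -> y \in X -> acl S (d2 p x y).
  by move=> xX yX; apply: restr_vals_sub (subsetUr _ X) _; apply: (crigid_acl gp E2).
have Sw y : y \in X -> [set w; y] \in E -> acl S (d2 p y w).
  move=> yX wyE; rewrite d2C -len2; apply: acl_in; exists [set w; y] => //.
  by rewrite inE wyE subUset !sub1set setU11 setU1r.
have Sx x : x \in X -> acl S (d2 p w x).
  move=> xX; apply: (acl_five (i := a) (j := b)); do ?[exact: SX|exact: Sw].
  exact: generic_d2_neq0.
move=> x y /setU1P[->|xX] /setU1P[->|yX]; rewrite ?d2xx; do ?[exact: acl0|exact: Sx|exact: SX].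
by rewrite d2C; apply: Sx.
Qed.

Lemma crigid_pair x y : [set x; y] \in E -> crigid E [set x; y].
Proof.
have [p gp] := generic_realisation => xyE; apply: (acl_crigid gp E2).
have h : acl (vals (len p) (restr E [set x; y])) (d2 p x y).
  by rewrite -len2; apply: acl_in; exists [set x; y]; rewrite // inE xyE /=.
by move=> a b /set2P[]-> /set2P[]->; rewrite ?d2xx; do ?[exact: acl0|exact: h|by rewrite d2C].
Qed.

End RigidSets.


(** * Global rigidity of vertex-redundantly rigid graphs *)

Section Tanigawa.
Variables (R : realType) (T : finType).
Implicit Types (q : realisation R T) (x y v a b c : T) (X W : {set T})
  (E F : {set {set T}}) (S : R -> Prop).

Definition dot q a x y : R :=
  (q x 0 - q a 0) * (q y 0 - q a 0) + (q x 1 - q a 1) * (q y 1 - q a 1).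

Lemma dotE q a x y : 2 * dot q a x y = d2 q x a + d2 q y a - d2 q x y.
Proof. by rewrite /dot /d2; ring. Qed.

Definition gramdet q a b c := d2 q b a * d2 q c a - dot q a b c ^+ 2.

Lemma gramdetE q a b c : gramdet q a b c = cross q a b c ^+ 2.
Proof. by rewrite /gramdet /dot /d2 /cross; ring. Qed.

(** The inverse Gram matrix of the vectors from [a] to [b] and [c], cleared of its determinant:
    inner products with two vectors determine all the others. *)
Lemma gram_dot q a b c x y : gramdet q a b c * dot q a x y =
  d2 q c a * (dot q a x b * dot q a y b)
  - dot q a b c * (dot q a x b * dot q a y c + dot q a x c * dot q a y b)
  + d2 q b a * (dot q a x c * dot q a y c).
Proof. by rewrite /gramdet /dot /d2; ring. Qed.

Lemma anchors p q a b c x y : cross p a b c != 0 ->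
  (forall s t, s \in [set a; b; c] -> t \in [set a; b; c] -> d2 q s t = d2 p s t) ->
  (forall s, s \in [set a; b; c] -> d2 q x s = d2 p x s) ->
  (forall s, s \in [set a; b; c] -> d2 q y s = d2 p y s) -> d2 q x y = d2 p x y.
Proof.
move=> nc habc hx hy.
have [aS bS cS] : [/\ a \in [set a; b; c], b \in [set a; b; c] & c \in [set a; b; c]].
  by rewrite !inE !eqxx ?orbT.
have dt s t : d2 q s a = d2 p s a -> d2 q t a = d2 p t a -> d2 q s t = d2 p s t ->
    dot q a s t = dot p a s t.
  move=> h1 h2 h3; have := dotE q a s t; rewrite h1 h2 h3 -dotE.
  by move/mulfI; apply; rewrite pnatr_eq0.
have [ba ca bc] : [/\ d2 q b a = d2 p b a, d2 q c a = d2 p c a & d2 q b c = d2 p b c].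
  by split; apply: habc.
have sg := dt b c ba ca bc.
have gq : gramdet q a b c = gramdet p a b c by rewrite /gramdet sg ba ca.
have ng : gramdet p a b c != 0 by rewrite gramdetE expf_neq0.
have e : dot q a x y = dot p a x y.
  have ds s : s \in [set a; b; c] -> dot q a x s = dot p a x s /\ dot q a y s = dot p a y s.
    by move=> sS; split; apply: dt; [exact: hx|exact: habc|exact: hx|exact: hy|exact: habc|exact: hy].
  have [[xb yb] [xc yc]] := (ds b bS, ds c cS).
  by apply: (mulfI ng); rewrite -{1}gq !gram_dot sg ba ca xb xc yb yc.
have := dotE q a x y; rewrite e dotE hx // hy //; lra.
Qed.

Lemma acl_quadratic S (c0 c1 c2 y : R) : acl S c0 -> acl S c1 -> acl S c2 ->
  c0 + c1 * y + c2 * y ^+ 2 = 0 -> ~ acl S y -> [/\ c0 = 0, c1 = 0 & c2 = 0].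
Proof.
move=> h0 h1 h2 e ny.
have [P0|nP] := eqVneq (Poly [:: c0; c1; c2]) 0.
  have h i : [:: c0; c1; c2]`_i = 0 by rewrite -coef_Poly P0 coef0.
  by split; [exact: (h 0%N)|exact: (h 1%N)|exact: (h 2%N)].
case: ny; apply: (acl_root nP) => [i|].
  by rewrite coef_Poly; case: i => [|[|[|i]]] //=; rewrite ?nth_nil; exact: acl0.
rewrite rootE horner_Poly /= mul0r add0r; apply/eqP; rewrite -[RHS]e; ring.
Qed.

(** * A vertex that is generic over the others *)

Section OffVertex.
Variables (p : realisation R T) (v : T).
Hypothesis gp : generic p.

Definition off : R -> Prop := fun z => exists x k, x != v /\ z = p x k.

Lemma off_d2 x y : x != v -> y != v -> acl off (d2 p x y).
Proof.
have h z k : z != v -> acl off (p z k) by move=> zv; apply: acl_in; exists z, k.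
by move=> xv yv; apply: aclD; apply: aclX; apply: aclB; apply: h.
Qed.

Lemma off_free0 : ~ acl off (p v 0).
Proof.
move=> h; apply: (generic_coords_indep gp (i := (v, 0))); rewrite ?inE //.
apply: acl_sub h => _ [x [k [xv ->]]]; exists (x, k) => //.
by rewrite !inE andbT; apply: contra xv => /eqP[->].
Qed.

Lemma off_free1 : ~ acl (adjoin off (p v 0)) (p v 1).
Proof.
move=> h; apply: (generic_coords_indep gp (i := (v, 1))); rewrite ?inE //.
apply: acl_sub h => _ [->|[x [k [xv ->]]]].
  by exists (v, 0) => //; rewrite !inE andbT xpair_eqE eqxx.
exists (x, k) => //; by rewrite !inE andbT; apply: contra xv => /eqP[->].
Qed.

Lemma off_not_one (z : R) : acl (adjoin off z) (p v 0) -> acl (adjoin off z) (p v 1) -> False.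
Proof.
move=> h0 h1; have hz := acl_exchange h0 off_free0.
apply: off_free1; apply: acl_trans h1 _ => y [->//|zo].
by apply: acl_in; right.
Qed.

(** The two coordinates of [p v] are independent over the other points, so any two numbers over
    which both become algebraic are independent too. *)
Lemma off_free2 (al be : R) : (forall k, acl (adjoin (adjoin off al) be) (p v k)) ->
  ~ acl off al /\ ~ acl (adjoin off al) be.
Proof.
move=> h; split=> ha.
  by apply: (@off_not_one be); apply: acl_trans (h _) _ => z [->|[->|zo]];
    do ?[by apply: acl_in; left|by apply: acl_sub ha => t; right|by apply: acl_in; right].
by apply: (@off_not_one al); apply: acl_trans (h _) _ => z [->|[->|zo]];
   do ?[exact: ha|by apply: acl_in; left|by apply: acl_in; right].
Qed.

Lemma off_dots_free a b c : v != a -> v != b -> v != c -> cross p a b c != 0 ->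
  ~ acl off (dot p a v b) /\ ~ acl (adjoin off (dot p a v b)) (dot p a v c).
Proof.
move=> va vb vc nc; apply: off_free2; set S := adjoin _ _.
have Sp x k : x != v -> acl S (p x k).
  by move=> xv; apply: acl_in; right; right; exists x, k.
have [Sa Sb Sc] : [/\ forall k, acl S (p a k), forall k, acl S (p b k) & forall k, acl S (p c k)].
  by split=> k; apply: Sp; rewrite eq_sym.
have Sal : acl S (dot p a v b) by apply: acl_in; right; left.
have Sbe : acl S (dot p a v c) by apply: acl_in; left.
have Sx : acl S (cross p a b c)^-1.
  by apply: aclV; apply: aclB; apply: aclM; apply: aclB.
have e0 : p v 0 = p a 0 + (dot p a v b * (p c 1 - p a 1) - dot p a v c * (p b 1 - p a 1)) * (cross p a b c)^-1.
  by apply: (mulIf nc); rewrite mulrDl mulfVK // /dot /cross; ring.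
have e1 : p v 1 = p a 1 + (dot p a v c * (p b 0 - p a 0) - dot p a v b * (p c 0 - p a 0)) * (cross p a b c)^-1.
  by apply: (mulIf nc); rewrite mulrDl mulfVK // /dot /cross; ring.
move=> k; have : (k == 0) || (k == 1) by case: k => [[|[|//]]].
by case/orP=> /eqP->; rewrite ?e0 ?e1; (apply: aclD; first by []);
  (apply: aclM; last by []); apply: aclB; apply: aclM => //; apply: aclB.
Qed.

Lemma off_d2_free a b : v != a -> v != b -> a != b ->
  ~ acl off (d2 p a v) /\ ~ acl (adjoin off (d2 p a v)) (d2 p b v).
Proof.
move=> va vb nab; apply: off_free2; set S := adjoin _ _ => k.
have Sp x l : x != v -> acl S (p x l).
  by move=> xv; apply: acl_in; right; right; exists x, l.
apply: (@acl_coord _ _ S p a b) => //; do ?[by move=> l; apply: Sp; rewrite eq_sym].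
- exact: generic_d2_neq0.
- by apply: aclD; apply: aclX; apply: aclB; apply: Sp; rewrite eq_sym.
- by apply: acl_in; right; left.
- by apply: acl_in; left.
Qed.

(* [p v] is generic over the field generated by the other points, and the
   lengths of [q] on the rigid set [W] are algebraic over that field; hence the
   two quadratic expressions of the distance from [v] agree coefficientwise *)
Lemma neighbours_congruent E W q a b c : edge_set E -> crigid E W -> v \notin W ->
  (forall h, h \in restr E W -> len q h = len p h) ->
  a \in W -> b \in W -> c \in W -> a != b -> a != c -> b != c ->
  d2 q v a = d2 p v a -> d2 q v b = d2 p v b -> d2 q v c = d2 p v c ->
  d2 q a b = d2 p a b.
Proof.
move=> E2 rW vW hq aW bW cW nab nac nbc qa qb qc.
have nv x : x \in W -> x != v by move=> xW; apply: contraNneq vW => <-.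
have offq x y : x \in W -> y \in W -> acl off (d2 q x y).
  move=> xW yW; have [->|nxy] := eqVneq x y; first by rewrite d2xx; exact: acl0.
  case: rW => F [sFE sF cF].
  have lenF h : h \in F -> len q h = len p h by move/(subsetP sFE)/hq.
  have valF (G : {set {set T}}) (z : R) : G \subset F -> vals (len q) G z <-> vals (len p) G z.
    move/subsetP=> sG; split=> -[h hG ->]; exists h; rewrite ?lenF //; exact: sG.
  have iF : indep (len q) F.
    move=> h hF sp; apply: (sparse_indep gp sF hF); rewrite /aspan -lenF //.
    by apply: acl_sub sp => z; rewrite valF ?subsetDl.
  have W2 : (2 <= #|W|)%N.
    by apply/card_gt1P; exists x, y.
  have [h0 h0F] : exists h, h \in F by apply/card_gt0P; rewrite cF; lia.
  have hW : h0 \in pairs W by apply: (subsetP (restr_pairs W E2)); apply: (subsetP sFE).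
  (* [q] need not be generic: the base points are the ends of an edge of [F], which keeps its
     nonzero length in [q]. *)
  have [i [j [iW jW nij eh0]]] := pairsP hW.
  have nq : d2 q i j != 0.
    by rewrite -len2 -eh0 lenF // eh0 len2 generic_d2_neq0.
  have := indep_span iF (G := star W i j) _ _ (i := [set x; y]).
  rewrite /aspan len2 cF card_star // => H.
  have {}H : acl (vals (len q) F) (d2 q x y).
    apply: H => //; last first.
      by rewrite -[d2 _ _ _]len2; apply: star_span => //; apply: pair_in.
    move=> h hF; apply: star_span => //.
    by apply: (subsetP (restr_pairs W E2)); apply: (subsetP sFE).
  apply: acl_trans H _ => z /valF -/(_ (subxx _)) [h hF ->].
  have /pairsP[s [t [sW tW _ ->]]] : h \in pairs W.
    by apply: (subsetP (restr_pairs W E2)); apply: (subsetP sFE).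
  by rewrite len2; apply: off_d2; apply: nv.
have nc := generic_cross_neq0 gp nab nac nbc.
have [va vb vc] : [/\ v != a, v != b & v != c] by rewrite ![v == _]eq_sym !nv.
have [al be] := off_dots_free va vb vc nc.
have offp x y : x \in W -> y \in W -> acl off (d2 p x y).
  by move=> xW yW; apply: off_d2; apply: nv.
have half (x : R) : acl off (2 * x) -> acl off x.
  by move=> h; apply: acl_half.
have dp x y z : x \in W -> y \in W -> z \in W -> acl off (dot p x y z).
  by move=> *; apply: half; rewrite dotE; apply: aclB; [apply: aclD|]; apply: offp.
have dq x y z : x \in W -> y \in W -> z \in W -> acl off (dot q x y z).
  by move=> *; apply: half; rewrite dotE; apply: aclB; [apply: aclD|]; apply: offq.
(* The inner products at [v] in [q] differ from those in [p] only by numbers algebraic over the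
   other points. *)
pose k := (d2 p b a - d2 q b a) / 2; pose l := (d2 p c a - d2 q c a) / 2.
have ok : acl off k by apply: half; rewrite mulrC divfK ?pnatr_eq0 //; apply: aclB; [exact: offp|exact: offq].
have ol : acl off l by apply: half; rewrite mulrC divfK ?pnatr_eq0 //; apply: aclB; [exact: offp|exact: offq].
have eb : dot q a v b = dot p a v b - k.
  by have := dotE q a v b; have := dotE p a v b; rewrite qa qb /k; lra.
have ec : dot q a v c = dot p a v c - l.
  by have := dotE q a v c; have := dotE p a v c; rewrite qa qc /l; lra.
have dvv s : dot s a v v = d2 s v a by rewrite /dot /d2; ring.
have gP := gram_dot p a b c v v; have gQ := gram_dot q a b c v v.
rewrite !dvv qa eb ec in gQ; rewrite !dvv in gP.
set Al := dot p a v b in al be eb gP gQ; set Be := dot p a v c in be ec gP gQ.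
set D := gramdet p a b c in gP; set D' := gramdet q a b c in gQ.
set Gc := d2 p c a in gP; set Gb := d2 p b a in gP; set Sg := dot p a b c in gP.
set Gc' := d2 q c a in gQ; set Gb' := d2 q b a in gQ; set Sg' := dot q a b c in gQ.
have [oGc oGb oSg] : [/\ acl off Gc, acl off Gb & acl off Sg] by split; [exact: offp|exact: offp|exact: dp].
have [oGc' oGb' oSg'] : [/\ acl off Gc', acl off Gb' & acl off Sg'] by split; [exact: offq|exact: offq|exact: dq].
have oD : acl off D by rewrite /D /gramdet; apply: aclB; [apply: aclM|apply: aclX].
have oD' : acl off D' by rewrite /D' /gramdet; apply: aclB; [apply: aclM|apply: aclX].
(* Coefficients, in the independent numbers [Al] and [Be], of the difference of the two expressions
   of [d2 p v a], cleared of both determinants. *)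
pose cA := D' * Gc - D * Gc'; pose cB := 2 * (D * Sg' - D' * Sg); pose cC := D' * Gb - D * Gb'.
pose dA := 2 * D * Gc' * k - 2 * D * Sg' * l.
pose dB := 2 * D * Gb' * l - 2 * D * Sg' * k.
pose d0 := D * (2 * Sg' * k * l - Gc' * k ^+ 2 - Gb' * l ^+ 2).
have EQ : (d0 + dA * Al + cA * Al ^+ 2) + (dB + cB * Al) * Be + cC * Be ^+ 2 = 0.
  have : D' * (D * d2 p v a) = D * (D' * d2 p v a) by ring.
  rewrite gP gQ /d0 /dA /dB /cA /cB /cC => E0; apply/eqP; rewrite -subr_eq0.
  move/eqP: E0; rewrite -subr_eq0 => /eqP E0; apply/eqP; rewrite -[RHS]E0; ring.
have o2 : acl off 2 by apply: acl_nat.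
have [ocA ocB ocC] : [/\ acl off cA, acl off cB & acl off cC].
  by split; rewrite /cA /cB /cC; do ?[apply: aclM => //]; apply: aclB; apply: aclM.
have odA : acl off dA.
  by apply: aclB; apply: aclM => //; apply: aclM => //; apply: aclM.
have odB : acl off dB.
  by apply: aclB; apply: aclM => //; apply: aclM => //; apply: aclM.
have od0 : acl off d0.
  apply: aclM => //; apply: aclB; [apply: aclB|]; try by apply: aclM => //; apply: aclX.
  by apply: aclM => //; apply: aclM => //; apply: aclM.
have up z : acl off z -> acl (adjoin off Al) z by apply: acl_sub => t; right.
have oAl : acl (adjoin off Al) Al by apply: acl_in; left.
have [e0 e1 e2] : [/\ d0 + dA * Al + cA * Al ^+ 2 = 0, dB + cB * Al = 0 & cC = 0].
  apply: (acl_quadratic _ _ _ EQ be); last exact: up.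
    apply: aclD; [apply: aclD|]; do ?[exact: up]; apply: aclM; do ?[exact: up]; last exact: aclX.
    exact: oAl.
  by apply: aclD; [exact: up|apply: aclM => //; exact: up].
have [_ _ eA] := acl_quadratic od0 odA ocA e0 al.
have [] := @acl_quadratic off dB cB 0 Al _ _ _ _ al; rewrite ?mul0r ?addr0 //; first exact: acl0.
move=> _ eB _.
have nD : D != 0 by rewrite /D gramdetE expf_neq0.
move/eqP: eA; rewrite subr_eq0 => /eqP eA; move/eqP: e2; rewrite subr_eq0 => /eqP eC.
have {}eB : D' * Sg = D * Sg' by move: eB; rewrite /cB; lra.
have DD : D' * D * (D - D') = 0.
  have -> : D' * D * (D - D') = D * (D * D' - D' * D) + D * D' * D - D' * D' * D by ring.
  have -> : D * D' * D = (D * Gb') * (D * Gc') - (D * Sg') ^+ 2.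
    by rewrite /D' /gramdet -/Gb' -/Gc' -/Sg'; ring.
  have eD : D = Gb * Gc - Sg ^+ 2 by [].
  by rewrite -eA -eC -eB [X in _ - _ * X = _]eD; ring.
move/eqP: DD; rewrite !mulf_eq0 (negPf nD) orbF [D - D' == 0]subr_eq0 => /orP[/eqP D0|/eqP eD].
  (* If [D' = 0], the points [a] and [b] coincide in [q], and [Al] would be algebraic over the other
     points. *)
  have Gb0 : Gb' = 0 by apply: (mulfI nD); rewrite -eC D0 !mul0r mulr0.
  case: al; suff -> : Al = k by [].
  have := eb; suff -> : dot q a v b = 0 by lra.
  move/eqP: Gb0; rewrite /Gb' /d2 paddr_eq0 ?sqr_ge0 // !sqrf_eq0 => /andP[/eqP h0 /eqP h1].
  by rewrite /dot h0 h1 !mulr0 addr0.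
by rewrite d2C -/Gb' d2C -/Gb; apply: (mulfI nD); rewrite -eC -eD.
Qed.

(** If [al] or [be] were really involved, exchange would make it algebraic over what it is
    independent of. *)
Lemma acl_remove2 S (x al be : R) : (forall z, S z -> acl off z) -> acl off x ->
  ~ acl off al -> ~ acl (adjoin off al) be ->
  acl (adjoin (adjoin S al) be) x -> acl S x.
Proof.
move=> hS hx nal nbe h.
have h1 : acl (adjoin S al) x.
  apply: contrapT => n1; apply: nbe; apply: acl_trans (acl_exchange h n1) _.
  move=> z [->|[->|Sz]]; first by apply: acl_sub hx => t; right.
    by apply: acl_in; left.
  by apply: acl_sub (hS _ Sz) => t; right.
apply: contrapT => n2; apply: nal; apply: acl_trans (acl_exchange h1 n2) _.
by move=> z [->//|/hS].
Qed.

End OffVertex.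

Definition nbrs E W v := [set y in W | [set v; y] \in E].

Lemma crigid_degree E X v : crigid E X -> v \in X -> (3 <= #|X|)%N ->
  edge_set E -> (2 <= #|nbrs E X v|)%N.
Proof.
move=> [F [sFE sF cF]] vX X3 E2.
have FX : restr F X = F.
  apply/setP => h; rewrite inE; case: (boolP (h \in F)) => //= /(subsetP sFE).
  by rewrite inE => /andP[].
have [F2 cnt] := sF; have := cnt (X :\ v); have cX := cardsD1 v X; rewrite vX in cX.
have := restr_incU F vX; rewrite FX => eF.
have c1 : (#|F| <= #|restr F (X :\ v)| + #|[set h in inc F v | h \subset X]|)%N.
  by rewrite {1}eF; have [] := leq_card_setU (restr F (X :\ v)) [set h in inc F v | h \subset X].
have : (#|[set h in inc F v | h \subset X]| <= #|nbrs E X v|)%N.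
  apply: leq_trans (leq_imset_card (fun y => [set v; y]) _).
  apply: subset_leq_card; apply/subsetP => h; rewrite !inE => /andP[/andP[hF vh] hX].
  have /eqP/cards2P[s [t [_ eh]]] := F2 _ hF.
  have hE : h \in E by move/(subsetP sFE): hF; rewrite inE => /andP[].
  move: vh hX hE; rewrite eh subUset !sub1set !inE => /orP[]/eqP e /andP[sX tX] hE.
    by apply/imsetP; exists t; rewrite ?inE ?tX e.
  by apply/imsetP; exists s; rewrite ?inE ?sX e setUC.
move: cF c1; move: #|F| #|restr F (X :\ v)| #|[set h in inc F v | h \subset X]| => f r i; lia.
Qed.

(** With the neighbours of [v] joined in [E'], all lengths at [v] are algebraic over those to [a]
    and [b] and over lengths of [E']. These two are independent over the remaining points, so
    distances between such points do not depend on them. *)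
Lemma crigid_delete (p : realisation R T) E E' X v : generic p ->
  edge_set E -> edge_set E' -> E \subset E' ->
  (forall a b, a \in nbrs E X v -> b \in nbrs E X v -> a != b -> [set a; b] \in E') ->
  crigid E X -> v \in X -> (2 <= #|nbrs E X v|)%N -> crigid E' (X :\ v).
Proof.
move=> gp E2 E2' sEE hE' rX vX /card_gt1P[a [b [aN bN nab]]].
have nvN y : y \in nbrs E X v -> y \in X /\ v != y.
  rewrite inE => /andP[yX /E2 h2]; split=> //.
  by apply/eqP => e; rewrite e setUid cards1 in h2.
have [[aX va] [bX vb]] := (nvN a aN, nvN b bN).
apply: (acl_crigid gp E2') => x y /setD1P[xv xX] /setD1P[yv yX].
set S := vals _ _.
have [fa fb] := off_d2_free gp va vb nab.
have hS z : S z -> acl (off p v) z.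
  case=> h; rewrite inE => /andP[gE' hX ->].
  have /eqP/cards2P[s [t [_ eh]]] := E2' _ gE'.
  move: hX; rewrite eh len2 subUset !sub1set !inE => /andP[/andP[sv _] /andP[tv _]].
  exact: off_d2.
apply: (acl_remove2 hS (off_d2 p xv yv) fa fb).
apply: acl_trans (crigid_acl gp E2 rX xX yX) _ => _ [h hh ->].
move: hh; rewrite inE => /andP[hE hX].
set S2 := adjoin _ _.
have SS2 z : acl S z -> acl S2 z by apply: acl_sub => t; right; right.
have /eqP/cards2P[s [t [nst eh]]] := E2 _ hE.
have Sst s' t' : s' != v -> t' != v -> s' \in X -> t' \in X -> [set s'; t'] \in E' -> acl S (d2 p s' t').
  move=> sv tv sX tX h1; rewrite -len2; apply: acl_in; exists [set s'; t'] => //.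
  by rewrite inE h1 subUset !sub1set !inE sv tv sX tX.
have N2 y' : y' \in nbrs E X v -> acl S2 (d2 p y' v).
  move=> yN; have [->|ya] := eqVneq y' a; first by apply: acl_in; right; left.
  have [->|yb] := eqVneq y' b; first by apply: acl_in; left.
  have [yX' vy] := nvN _ yN; have ev s' : v != s' -> s' != v by rewrite eq_sym.
  have S2N s' t' : s' \in nbrs E X v -> t' \in nbrs E X v -> s' != t' -> acl S2 (d2 p s' t').
    move=> sN tN nst'; have [[sX vs] [tX vt]] := (nvN _ sN, nvN _ tN).
    by apply: SS2; apply: Sst; do ?[exact: ev]; last exact: hE'.
  apply: (acl_five (i := a) (j := b)).
  - exact: generic_d2_neq0.
  - exact: S2N.
  - by apply: S2N; rewrite 1?eq_sym.
  - by apply: S2N; rewrite 1?eq_sym.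
  - by apply: acl_in; right; left.
  - by apply: acl_in; left.
move: hX hE; rewrite eh len2 subUset !sub1set => /andP[sX tX] hE.
have [es|sv] := eqVneq s v.
  by rewrite es d2C; apply: N2; rewrite inE tX -es.
have [et|tv] := eqVneq t v.
  by rewrite et; apply: N2; rewrite inE sX setUC -et.
by apply: SS2; apply: Sst => //; apply: (subsetP sEE).
Qed.

(** The induction trades [v] for a clique on its neighbours: [neighbours_congruent] fixes the new
    lengths in [q], and [crigid_delete], applied to [W :\ u], preserves the hypothesis. Any two
    vertices survive the removal of a third one. *)
Theorem vertex_redundant_rigid (p : realisation R T) E W q : generic p -> edge_set E ->
  (4 <= #|W|)%N -> (forall u, u \in W -> crigid E (W :\ u)) ->
  (forall h, h \in restr E W -> len q h = len p h) ->
  forall x y, x \in W -> y \in W -> d2 q x y = d2 p x y.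
Proof.
move=> gp; have [n] := ubnP #|W|; elim: n W E => // n ih W E Wn E2 W4 rW hq x y xW yW.
have [->|nxy] := eqVneq x y; first by rewrite !d2xx.
have [W5|W4'] := leqP 5 #|W|; last first.
  (* On four vertices every triple must be a triangle, so all pairs are edges. *)
  suff xyE : [set x; y] \in E.
    by rewrite -!len2; apply: hq; rewrite inE xyE subUset !sub1set xW yW.
  have cW : #|W| = 4%N by lia.
  have [u uW] : exists u, u \in W :\ x :\ y.
    apply/card_gt0P; have := cardsD1 x W; have := cardsD1 y (W :\ x).
    by rewrite !inE eq_sym nxy xW yW; lia.
  move: uW; rewrite !inE => /and3P[uy ux uW].
  have cWu : #|W :\ u| = 3 by have := cardsD1 u W; rewrite uW cW; lia.
  have [F [sFE [F2 sF] cF]] := rW u uW; rewrite cWu in cF.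
  have sub : F \subset pairs (W :\ u) by apply: subset_trans sFE (restr_pairs _ E2).
  have cP : #|pairs (W :\ u)| = 3%N.
    have := cards_draws (W :\ u) 2; rewrite cWu => cd; rewrite -[RHS]cd.
    by apply: eq_card => h; rewrite !inE andbC.
  have /eqP eF : F == pairs (W :\ u) by rewrite eqEcard sub cP cF.
  have : [set x; y] \in F by rewrite eF; apply: pair_in; rewrite // !inE 1?eq_sym ?ux ?uy.
  by move/(subsetP sFE); rewrite inE => /andP[].
have nvN v y' : y' \in nbrs E W v -> y' \in W /\ v != y'.
  rewrite inE => /andP[yX /E2 h2]; split=> //.
  by apply/eqP => e; rewrite e setUid cards1 in h2.
(* [v] keeps two neighbours even after one of its neighbours is removed. *)
have N3 v : v \in W -> (3 <= #|nbrs E W v|)%N.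
  move=> vW; have cD u : u \in W -> (4 <= #|W :\ u|)%N.
    by move=> uW; have := cardsD1 u W; rewrite uW; lia.
  have deg u : u \in W -> u != v -> (2 <= #|nbrs E (W :\ u) v|)%N.
    move=> uW uv; apply: crigid_degree => //; [exact: rW|by rewrite !inE eq_sym uv|].
    by apply: ltnW; apply: cD.
  have sN u : nbrs E (W :\ u) v \subset nbrs E W v :\ u.
    by apply/subsetP => z; rewrite !inE -andbA.
  have [u uN] : exists u, u \in nbrs E W v.
    have [w wW] : exists w, w \in W :\ v.
      by apply/card_gt0P; apply: leq_trans (cD v vW).
    have /setD1P[wv wW'] := wW.
    have /card_gt0P[z zN] : (0 < #|nbrs E (W :\ w) v|)%N by apply: ltnW; apply: deg.
    by exists z; have /setD1P[] := subsetP (sN w) z zN.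
  have [uW vu] := nvN _ _ uN; rewrite (cardsD1 u) uN ltnS.
  by apply: leq_trans (subset_leq_card (sN u)); apply: deg; rewrite // eq_sym.
have congN v a b : v \in W -> a \in nbrs E W v -> b \in nbrs E W v -> d2 q a b = d2 p a b.
  move=> vW aN bN; have [->|nab] := eqVneq a b; first by rewrite !d2xx.
  have [c] : exists c, c \in nbrs E W v :\ a :\ b.
    apply/card_gt0P; have := N3 v vW; rewrite (cardsD1 a) aN (cardsD1 b) !inE.
    by rewrite eq_sym nab; move: bN; rewrite inE => ->.
  case/setD1P=> cb /setD1P[ca cN].
  have inWv y' : y' \in nbrs E W v -> y' \in W :\ v.
    by move/nvN => [yW' vy']; rewrite !inE eq_sym vy'.
  have lv y' : y' \in nbrs E W v -> d2 q v y' = d2 p v y'.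
    move=> yN; rewrite -!len2; apply: hq; have [yW' _] := nvN _ _ yN.
    by rewrite inE subUset !sub1set vW yW' /= andbT; move: yN; rewrite inE => /andP[].
  apply: (neighbours_congruent gp E2 (rW v vW) _ _ (inWv _ aN) (inWv _ bN) (inWv _ cN)) => //;
    do ?[exact: lv]; do ?[by rewrite eq_sym]; first by rewrite !inE eqxx.
  move=> h; rewrite inE => /andP[hE hW]; apply: hq; rewrite inE hE.
  by apply: subset_trans hW (subsetDl _ _).
have key v : v \in W -> forall s t, s \in W :\ v -> t \in W :\ v -> d2 q s t = d2 p s t.
  move=> vW; pose E' := E :|: pairs (nbrs E W v).
  have E2' : edge_set E' by move=> h; rewrite !inE => /orP[/E2//|/andP[/eqP]].
  have cv := cardsD1 v W; rewrite vW in cv.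
  apply: (ih (W :\ v) E') => //; [lia|lia| |].
    move=> u /setD1P[uv uW]; have -> : W :\ v :\ u = W :\ u :\ v by rewrite !setDDl setUC.
    apply: (@crigid_delete p E E' (W :\ u) v) => //; first exact: subsetUl.
    - move=> a b; rewrite 3!inE => /andP[/andP[_ aW] aE]; rewrite 3!inE => /andP[/andP[_ bW] bE] nab.
      by apply/setUP; right; apply: pair_in; rewrite // inE ?aW ?bW.
    - exact: rW.
    - by rewrite !inE eq_sym uv.
    apply: crigid_degree => //; [exact: rW|by rewrite !inE eq_sym uv|].
    by have := cardsD1 u W; rewrite uW; lia.
  move=> h; rewrite inE => /andP[/setUP[hE|hN] hW].
    by apply: hq; rewrite inE hE; apply: subset_trans hW (subsetDl _ _).
  by have [a [b [aN bN _ ->]]] := pairsP hN; rewrite !len2; apply: (congN v).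
have [v vW] : exists v, v \in W :\ x :\ y.
  apply/card_gt0P; have := cardsD1 x W; have := cardsD1 y (W :\ x).
  by rewrite !inE eq_sym nxy xW yW; lia.
move: vW; rewrite !inE => /and3P[vy vx vW].
by apply: (key v vW); rewrite !inE eq_sym ?vy ?vx ?xW ?yW.
Qed.

End Tanigawa.


(** * Rigid subsets of symmetric graphs *)

Section Edges.
Variables (T : finType) (e : rel T).
Hypothesis se : simple_graph e.

Definition edges : {set {set T}} :=
  [set [set xy.1; xy.2] | xy in [set xy : T * T | e xy.1 xy.2]].

Lemma edgesP h : reflect (exists x y, e x y /\ h = [set x; y]) (h \in edges).
Proof.
apply: (iffP imsetP) => [[[x y]]|[x [y [exy ->]]]].
  by rewrite inE /= => exy ->; exists x, y.
by exists (x, y); rewrite ?inE.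
Qed.

Lemma edge_neq x y : e x y -> x != y.
Proof. by move=> exy; apply/eqP => exy'; rewrite exy' se.1 in exy. Qed.

Lemma in_edges x y : ([set x; y] \in edges) = e x y.
Proof.
apply/edgesP/idP => [[a [b [eab /setP E]]]|exy]; last by exists x, y.
have := E x; have := E y; have := E a; have := E b.
rewrite !inE !eqxx ?orbT /= => /orP b1 /orP a1 /esym/orP y1 /esym/orP x1.
have nab := edge_neq eab.
case: x1 => /eqP x1; case: y1 => /eqP y1; subst; rewrite ?se.1 //.
- by case: b1 => /eqP b1; rewrite b1 eqxx in nab.
- by rewrite se.2.
- by case: a1 => /eqP a1; rewrite a1 eqxx in nab.
Qed.

Lemma edges_edge_set : edge_set edges.
Proof. by move=> h /edgesP[x [y [/edge_neq nxy ->]]]; rewrite cards2 nxy. Qed.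

Lemma card_inc_edges v : #|inc edges v| = degree e v.
Proof.
rewrite /degree -(card_in_imset (f := fun y => [set v; y])); last first.
  move=> y z; rewrite !inE => /edge_neq vy /edge_neq vz /setP /(_ y).
  by rewrite !inE eqxx orbT [y == v]eq_sym (negPf vy) => /esym/eqP.
apply: eq_card => h; rewrite inE; apply/andP/imsetP.
  case=> /edgesP[x [y [exy ->]]]; rewrite !inE => /orP[]/eqP->.
    by exists y; rewrite ?inE.
  by exists x; rewrite ?inE 1?se.2 // setUC.
by case=> y; rewrite inE => evy ->; rewrite in_edges evy set21.
Qed.

End Edges.

(** * Images of edge sets under permutations *)

Section Images.
Variable T : finType.
Implicit Types (g : {perm T}) (X Y : {set T}) (F E : {set {set T}}).

Definition imF g F : {set {set T}} := [set g @: (h : {set T}) | h in F].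

Lemma imset_perm_inj g : injective (fun X : {set T} => g @: X).
Proof. exact/imset_inj/perm_inj. Qed.

Lemma card_imF g F : #|imF g F| = #|F|.
Proof. by rewrite card_imset //; apply: imset_perm_inj. Qed.

Lemma imset_permKV g X : g @: ((g^-1)%g @: X) = X.
Proof.
by rewrite -imset_comp -[RHS]imset_id; apply: eq_imset => x /=; rewrite permKV.
Qed.

Lemma card_imset_perm g X : #|g @: X| = #|X|.
Proof. by rewrite card_imset //; apply: perm_inj. Qed.

Lemma restr_imF g F W : restr (imF g F) W = imF g (restr F ((g^-1)%g @: W)).
Proof.
apply/setP => h; rewrite inE; apply/andP/imsetP => [[/imsetP[h0 h0F ->] s]|[h0]].
  exists h0 => //; rewrite inE h0F; apply/subsetP => x xh.
  by rewrite -(permK g x) imset_f // (subsetP s) ?imset_f.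
rewrite inE => /andP[h0F s] ->; split; first exact: imset_f.
by rewrite -[W](imset_permKV g); apply: imsetS.
Qed.

Lemma sparse_imF g F : sparse F -> sparse (imF g F).
Proof.
move=> [F2 sF]; split=> [h /imsetP[h0 /F2 h2 ->]|W]; first by rewrite card_imset_perm.
by rewrite restr_imF card_imF; apply: leq_trans (sF _) _; rewrite card_imset_perm.
Qed.

Lemma crigid_imset g E X : imF g E = E -> crigid E X -> crigid E (g @: X).
Proof.
move=> gE [F [sFE sF cF]]; exists (imF g F); split.
- apply/subsetP => h /imsetP[h0 /(subsetP sFE)]; rewrite inE => /andP[h0E h0X] ->.
  by rewrite inE -gE !imset_f // imsetS.
- exact: sparse_imF.
- by rewrite card_imF card_imset_perm.
Qed.

End Images.

(** * Circuits of the sparsity matroid *)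

Section Circuit.
Variable T : finType.
Implicit Types (W : {set T}) (F C : {set {set T}}).

(* a minimal violation of sparsity, minus an edge, is tight *)
Lemma not_sparse_tight F v : edge_set F -> inc F v = set0 -> ~ sparse F ->
  exists C W c, [/\ C \subset restr F W, ~ sparse C, c \in C,
    sparse (C :\ c) & #|C :\ c| = (2 * #|W| - 3)%N /\ v \notin W].
Proof.
move=> F2 iv nF; pose P C := (C \subset F) && ~~ `[< sparse C >].
have P0 : P F by rewrite /P subxx; apply/asboolP.
have [C /minsetP [/andP[sCF /asboolP nC] minC] _] := minset_exists P0.
have C2 : edge_set C by move=> h /(subsetP sCF)/F2.
have [W hW] : exists W, (2 * #|W| - 3 < #|restr C W|)%N.
  apply: contrapT => h; apply: nC; split=> // W; rewrite leqNgt; apply/negP => hW.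
  by apply: h; exists W.
have {}hW : (2 * #|W :\ v| - 3 < #|restr C (W :\ v)|)%N.
  have -> : restr C (W :\ v) = restr C W.
    apply/setP => h; rewrite !inE subsetD1; case: (boolP (h \in C)) => //= hC.
    rewrite andb_idr // => _; apply/negP => vh.
    by have : h \in inc F v; [rewrite inE (subsetP sCF)|rewrite iv inE].
  apply: leq_ltn_trans hW; apply: leq_sub2r; rewrite leq_mul2l.
  by apply: subset_leq_card; apply: subsetDl.
move: (W :\ v) (setD11 v W) hW => {}W vW hW.
have CW : restr C W = C.
  apply: minC; last exact: restr_sub.
  rewrite /P (subset_trans (restr_sub _ _) sCF); apply/asboolP => -[_ /(_ W)].
  have -> : restr (restr C W) W = restr C W.
    by apply/setP => h; rewrite !inE -andbA andbb.
  by rewrite leqNgt hW.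
have [c cC] : exists c, c \in C by apply/card_gt0P; rewrite -CW; apply: leq_ltn_trans hW.
have sCc : sparse (C :\ c).
  apply: contrapT => n.
  have : C :\ c = C.
    apply: minC; last exact: subsetDl.
    by rewrite /P (subset_trans (subsetDl _ _) sCF); apply/asboolP.
  by move/setP => /(_ c); rewrite !inE eqxx cC.
exists C, W, c; split=> //; last split; last by rewrite vW.
  by rewrite -{1}CW; apply: restrS.
have [_ /(_ W)] := sCc.
have -> : restr (C :\ c) W = C :\ c.
  apply/setP => h; rewrite !inE; case: (h != c) => //=.
  by move/setP: CW => /(_ h); rewrite inE.
move=> le; apply/eqP; rewrite eqn_leq le /=.
by move: hW; rewrite CW (cardsD1 c C) cC add1n ltnS.
Qed.

End Circuit.

(** * The orbit of a maximal rigid proper subset *)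

Section Core.
Variables (R : realType) (T : finType) (e : rel T).
Hypotheses (se : simple_graph e) (ce : connected_graph e).
(** [O] holds the vertices whose removal is in question, [H] cliques that cover the edges. Three
    cases are served: [H] the edges, with [O] all vertices or one side of a bipartite graph; and [H]
    the cliques spanned by neighbourhoods, with [O] all vertices. *)
Variables (G : {group {perm T}}) (O : {set T}) (H : {set {set T}}).
Hypothesis Ge : forall g, g \in G -> is_automorphism e g.
Hypothesis GO : forall g x, g \in G -> (g x \in O) = (x \in O).
Hypothesis trO : forall x y, x \in O -> y \in O -> exists2 g, g \in G & g x = y.
Hypothesis GH : forall h h', h \in H -> h' \in H -> exists2 g, g \in G & g @: h = h'.
Hypothesis Hclique : forall h x y, h \in H -> x \in h -> y \in h -> x != y -> e x y.
Hypothesis Hcover : forall x y, e x y -> exists h, [/\ h \in H, x \in h & y \in h].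
Hypothesis HO : forall h, h \in H -> h \subset O \/ #|h| = 2%N.
Hypothesis deg3 : forall x, (3 <= degree e x)%N.
Hypothesis outO : forall x y, x \notin O -> e x y -> y \in O.
Hypothesis O3 : (3 <= #|O|)%N.
Hypothesis nrig : forall v, v \in O -> ~ crigid (edges e) (setT :\ v).

Let E := edges e.
Let E2 : edge_set E := edges_edge_set se.

Let GE g : g \in G -> imF g E = E.
Proof.
move=> gG; apply/eqP; rewrite eqEcard card_imF leqnn andbT; apply/subsetP => h.
case/imsetP=> h0 /edgesP[x [y [exy ->]]] ->; rewrite imsetU1 imset_set1 in_edges //.
by rewrite (Ge gG).
Qed.

(** If [v] alone were missing, a maximal rigid set containing [Y] and avoiding [v] would absorb
    every other vertex, since a vertex outside [O] has two neighbours in [O] other than [v]. This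
    contradicts [nrig]. *)
Let missing Y : crigid E Y -> ~~ (O \subset Y) -> (2 <= #|O :\: Y|)%N.
Proof.
move=> rY nO; rewrite ltnNge; apply/negP => le1.
have [v vOY] : exists v, v \in O :\: Y.
  by apply/set0Pn; rewrite setD_eq0.
have OY : O :\: Y = [set v].
  apply/esym/eqP; rewrite eqEcard sub1set vOY cards1 //.
have /setDP[vO vY] := vOY.
pose P (Z : {set T}) := [&& Y \subset Z, v \notin Z & `[< crigid E Z >]].
have P0 : P Y by rewrite /P subxx vY; apply/asboolP.
have [Z /maxsetP[/and3P[YZ vZ /asboolP rZ] mZ] _] := maxset_exists P0.
apply: (nrig vO); suff -> : setT :\ v = Z by [].
apply/esym/eqP; rewrite eqEsubset; apply/andP; split.
  by apply/subsetP => x xZ; rewrite !inE andbT; apply: contraNneq vZ => <-.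
apply/subsetP => w; rewrite !inE andbT => wv; apply: contraT => wZ.
have inZ x : x \in O -> x != v -> x \in Z.
  move=> xO xv; apply: (subsetP YZ); apply: contraT => xY.
  by have : x \in O :\: Y; [rewrite inE xY|rewrite OY inE (negPf xv)].
have wO : w \notin O by apply: contra wZ => /inZ; apply.
have [a [b [[ea av] [eb bv] nab]]] : exists a b, [/\ e w a /\ a != v, e w b /\ b != v & a != b].
  have /card_gt1P[a [b [aN bN nab]]] : (1 < #|[set y | e w y] :\ v|)%N.
    move: (cardsD1 v [set y | e w y]) (leq_b1 (v \in [set y | e w y])) (deg3 w).
    by rewrite /degree; move: (nat_of_bool _); clear; lia.
  by move: aN bN; rewrite !inE => /andP[? ?] /andP[? ?]; exists a, b.
have aZ : a \in Z by apply: inZ => //; apply: outO ea.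
have bZ : b \in Z by apply: inZ => //; apply: outO eb.
have : w |: Z = Z.
  apply: mZ; last exact: subsetUr.
  rewrite /P (subset_trans YZ (subsetUr _ _)) !inE negb_or eq_sym wv vZ; apply/asboolP.
  by apply: (crigidU1 R E2 rZ aZ bZ nab); rewrite in_edges.
by move/setP => /(_ w); rewrite setU11 (negPf wZ).
Qed.

Let good Y := crigid E Y /\ ~~ (O \subset Y).

Let exists_max : exists2 X, good X & forall Y, good Y -> (#|Y| <= #|X|)%N.
Proof.
pose P (X : {set T}) := `[< good X >].
have P0 : P set0.
  apply/asboolP; split.
    exists set0; split; rewrite ?sub0set ?cards0 //; split=> [h|W]; first by rewrite inE.
    by apply: leq_trans (leq0n _); rewrite leqn0 cards_eq0 -subset0 restr_sub.
  by rewrite subset0 -card_gt0; apply: leq_trans O3.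
exists [arg max_(X > set0 | P X) #|X|].
  by case: arg_maxnP => // X /asboolP.
by case: arg_maxnP => // X PX mX Y gY; apply: mX; apply/asboolP.
Qed.

Lemma core : exists (XX : {set {set T}}) (s : nat), exists2 X0, X0 \in XX &
  [/\ (2 <= s)%N,
      forall Y, Y \in XX -> [/\ #|Y| = s, crigid E Y & ~~ (O \subset Y)],
      forall Y Y', Y \in XX -> Y' \in XX -> Y != Y' -> (#|Y :&: Y'| <= 1)%N,
      (forall h, h \in H -> exists2 Y, Y \in XX & h \subset Y)
    & [/\ forall g Y, g \in G -> Y \in XX -> g @: Y \in XX,
          forall Y, Y \in XX -> exists2 g, g \in G & Y = g @: X0
        & forall v, v \in O -> (#|XX| * (2 * s - 3) + 6 <= 2 * #|T| + degree e v)%N]].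
Proof.
have [X [rX nX] maxX] := exists_max.
pose XX : {set {set T}} := [set g @: X | g : {perm T} in G].
have XXP Y : Y \in XX -> [/\ #|Y| = #|X|, crigid E Y & ~~ (O \subset Y)].
  case/imsetP=> g gG ->; split; first exact: card_imset_perm.
    exact: crigid_imset (GE gG) rX.
  apply: contra nX => /subsetP s; apply/subsetP => x xO.
  by have /imsetP[y yX /perm_inj->] := s _ (etrans (GO x gG) xO).
have XX1 : X \in XX.
  by apply/imsetP; exists 1%g => //; rewrite -[LHS]imset_id; apply: eq_imset => x; rewrite perm1.
have XXG g Y : g \in G -> Y \in XX -> g @: Y \in XX.
  move=> gG /imsetP[f fG ->]; apply/imsetP; exists (f * g)%g; first exact: groupM.
  by rewrite -imset_comp; apply: eq_imset => x /=; rewrite permM.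
have bigger Y Y' : Y \in XX -> good Y' -> Y \subset Y' -> Y' = Y.
  move=> /XXP[cY _ _] gY' s; apply/esym/eqP; rewrite eqEcard s cY; exact: maxX.
(* Adding [w] keeps [Y] rigid; as [Y] misses two vertices of [O], the larger set still misses one,
   against maximality. *)
have absorb Y w a b : Y \in XX -> w \notin Y -> a \in Y -> b \in Y -> a != b ->
    e w a -> e w b -> False.
  move=> YX wY aY bY nab wa wb; have [cY rY nY] := XXP _ YX.
  have rwY : crigid E (w |: Y) by apply: (crigidU1 R E2 rY aY bY nab); rewrite in_edges.
  have : w |: Y = Y.
    apply: bigger => //; last exact: subsetUr.
    split=> //; apply/negP => s; have := missing rY nY; rewrite ltnNge => /negP; apply.
    rewrite -(cards1 w); apply: subset_leq_card; apply/subsetP => x /setDP[xO xY].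
    by have := subsetP s x xO; rewrite !inE (negPf xY) orbF.
  by move/setP => /(_ w); rewrite setU11 (negPf wY).
(* The union is rigid, so by maximality it contains [O]. A vertex outside it would have three
   neighbours, all in [O], and hence two in [Y] or two in [Y']. *)
have unionT Y Y' : Y \in XX -> Y' \in XX -> Y != Y' -> (2 <= #|Y :&: Y'|)%N ->
    Y :|: Y' = setT.
  move=> YX Y'X nYY I2; have [cY rY nY] := XXP _ YX; have [cY' rY' nY'] := XXP _ Y'X.
  have rU := crigidU R E2 rY rY' I2.
  have OU : O \subset Y :|: Y'.
    apply: contraT => nU; case/negP: nYY; apply/eqP.
    have eU : Y :|: Y' = Y by apply: bigger => //; apply: subsetUl.
    have eU' : Y :|: Y' = Y' by apply: bigger => //; apply: subsetUr.
    by rewrite -eU.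
  apply/setP => w; rewrite [RHS]inE; apply: contraT => wU.
  have wO : w \notin O by apply: contra wU; apply/subsetP.
  have wY : w \notin Y by apply: contra wU => wY; rewrite inE wY.
  have wY' : w \notin Y' by apply: contra wU => wY'; rewrite inE wY' orbT.
  have N1 Z : Z \in XX -> w \notin Z -> (#|[set y | e w y] :&: Z| <= 1)%N.
    move=> ZX wZ; rewrite leqNgt; apply/negP => /card_gt1P[a [b []]].
    by rewrite !inE => /andP[wa aZ] /andP[wb bZ] nab; apply: (absorb Z w a b).
  have sN : [set y | e w y] \subset ([set y | e w y] :&: Y) :|: ([set y | e w y] :&: Y').
    rewrite -setIUr; apply/subsetP => y yN; rewrite inE yN; apply: (subsetP OU).
    by rewrite inE in yN; apply: outO yN.
  have c0 := subset_leq_card sN.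
  have [c1 _] := leq_card_setU ([set y | e w y] :&: Y) ([set y | e w y] :&: Y').
  by move: c0 c1 (N1 _ YX wY) (N1 _ Y'X wY') (deg3 w); rewrite /degree; clear; lia.
have [x0 x0O] : exists x, x \in O by apply/card_gt0P; apply: leq_trans O3.
have s2 : (2 <= #|X|)%N.
  have /card_gt0P[y] : (0 < #|[set y | e x0 y]|)%N by apply: leq_trans (deg3 x0).
  rewrite inE => exy; apply: (@leq_trans #|[set x0; y]|).
    by rewrite cards2 (edge_neq se exy).
  apply: maxX; split; first by apply: (crigid_pair R E2); rewrite in_edges.
  apply/negP => /subset_leq_card; rewrite cards2 (edge_neq se exy) => h.
  by have := leq_trans O3 h.
have small Y Y' : Y \in XX -> Y' \in XX -> Y != Y' -> (#|Y :&: Y'| <= 1)%N.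
  move=> YX Y'X nYY; rewrite leqNgt; apply/negP => I2.
  (* One bad pair makes the members so large that any two different ones meet in two vertices and
     cover [T]. *)
  have nU : (#|T| + 2 <= 2 * #|X|)%N.
    have := cardsUI Y Y'; rewrite (unionT _ _ YX Y'X nYY I2) cardsT.
    by have [-> _ _] := XXP _ YX; have [-> _ _] := XXP _ Y'X; move: I2; clear; lia.
  have uT Z Z' : Z \in XX -> Z' \in XX -> Z != Z' -> Z :|: Z' = setT.
    move=> ZX Z'X nZZ; apply: unionT => //.
    have := cardsUI Z Z'; have := subset_leq_card (subsetT (Z :|: Z')); rewrite cardsT.
    by have [-> _ _] := XXP _ ZX; have [-> _ _] := XXP _ Z'X; move: nU; clear; lia.
  have [z /setDP[zO zX]] : exists z, z \in O :\: X.
    by apply/card_gt0P; apply: leq_trans (missing rX nX).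
  have [z' ez zX'] : exists2 z', e z z' & z' \notin X.
    apply: contrapT => h.
    have /card_gt1P[a [b []]] : (1 < #|[set y | e z y]|)%N by apply: leq_trans (deg3 z).
    rewrite !inE => ea eb nab.
    by apply: (absorb X z a b) => //; apply: contraT => n; case: h; [exists a|exists b].
  (* If the clique [h] of an edge outside [X] avoids [X], the complement of [X] is closed under
     adjacency. Otherwise [h] lies in [O] and contains some [x] of [X]; a translate of [X] omitting
     [x] then contains its neighbours [z] and [z']. *)
  have [h [hH zh zh']] := Hcover ez.
  have [hX|] := boolP (h \subset ~: X).
    have closedZ a b : a \notin X -> e a b -> b \notin X.
      move=> aX eab; have [h' [h'H ah' bh']] := Hcover eab.
      have [g gG eh'] := GH hH h'H.
      have s : h' \subset ~: (g @: X).
        rewrite -eh'; apply/subsetP => _ /imsetP[t th ->]; rewrite inE.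
        apply/negP => /imsetP[t' t'X /perm_inj tt].
        by have := subsetP hX t th; rewrite inE tt t'X.
      have eX : g @: X = X.
        apply/eqP; apply: contraT => n.
        have /setP/(_ a) := uT _ _ (XXG _ _ gG XX1) XX1 n; rewrite !inE (negPf aX) orbF.
        by have := subsetP s a ah'; rewrite inE => /negPf->.
      by have := subsetP s b bh'; rewrite eX inE.
    have cZ : forall y, connect e z y -> y \notin X.
      move=> y /connectP[pth]; elim: pth z {zO ez h hH zh zh' hX} zX => [|b pth ih] z0 z0X /=.
        by move=> _ ->.
      by case/andP=> ezb pp ey; apply: ih pp ey; apply: closedZ ezb.
    have /card_gt0P[y yX] : (0 < #|X|)%N by apply: ltnW.
    by have := cZ y (ce z y); rewrite yX.
  case/subsetPn=> x xh; rewrite inE negbK => xX.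
  have hO : h \subset O.
    case: (HO hH) => // h2.
    have : (#|[set x; z; z']| <= #|h|)%N.
      by apply: subset_leq_card; rewrite !subUset !sub1set xh zh zh'.
    rewrite h2 -setUA cardsU1 cards2 (edge_neq se ez) !inE negb_or.
    have -> : x != z by apply: contraNneq zX => <-.
    by have -> : x != z' by apply: contraNneq zX' => <-.
  have [g gG gz] := trO zO (subsetP hO x xh).
  have xgX : x \notin g @: X.
    by apply/negP => /imsetP[t tX]; rewrite -gz => /perm_inj zt; rewrite zt tX in zX.
  have nXg : g @: X != X by apply: contraNneq xgX => ->.
  have uX := uT _ _ (XXG _ _ gG XX1) XX1 nXg.
  have inY t : t \notin X -> t \in g @: X.
    by move=> tX; move/setP: uX => /(_ t); rewrite !inE (negPf tX) orbF.
  apply: (absorb (g @: X) x z z' (XXG _ _ gG XX1) xgX (inY _ zX) (inY _ zX') (edge_neq se ez)).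
    by apply: Hclique hH xh zh _; apply: contraNneq zX => <-.
  by apply: Hclique hH xh zh' _; apply: contraNneq zX' => <-.
have Hsub h Y a b : h \in H -> Y \in XX -> a \in h -> b \in h -> a != b -> a \in Y -> b \in Y ->
    h \subset Y.
  move=> hH YX ah bh nab aY bY; apply/subsetP => c ch; apply: contraT => cY.
  exfalso; apply: (absorb Y c a b) => //; apply: Hclique hH ch _ _ => //.
    by apply: contraNneq cY => ->.
  by apply: contraNneq cY => ->.
have [a0 [b0 [a0X b0X e0]]] : exists a b, [/\ a \in X, b \in X & e a b].
  have [F [sFE _ cF]] := rX.
  have /card_gt0P[h hF] : (0 < #|F|)%N by rewrite cF; move: s2; clear; lia.
  have := subsetP sFE h hF; rewrite inE => /andP[/edgesP[a [b [eab ->]]]].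
  by rewrite subUset !sub1set => /andP[aX bX]; exists a, b.
have coverH h : h \in H -> exists2 Y, Y \in XX & h \subset Y.
  move=> hH; have [h0 [h0H ah bh]] := Hcover e0.
  have sX : h0 \subset X by apply: (Hsub h0 X a0 b0) => //; exact: edge_neq e0.
  have [g gG <-] := GH h0H hH; exists (g @: X); [exact: XXG|exact: imsetS].
have coverE a b : e a b -> exists Y, [/\ Y \in XX, a \in Y & b \in Y].
  move=> eab; have [h [hH ah bh]] := Hcover eab; have [Y YX s] := coverH h hH.
  by exists Y; split=> //; apply: (subsetP s).
have uniqE Y Y' a b : Y \in XX -> Y' \in XX -> a != b -> a \in Y -> b \in Y -> a \in Y' -> b \in Y' ->
    Y = Y'.
  move=> YX Y'X nab aY bY aY' bY'; apply/eqP; apply: contraT => n.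
  have := small _ _ YX Y'X n; rewrite leqNgt => /negP[]; apply/card_gt1P.
  by exists a, b; rewrite !inE aY bY aY' bY'.
(* Otherwise [O] lies in [Z :|: Y] and, through an edge of [Z] with an end outside [Y], in
   [Z :|: Y'] for another member [Y']; the part of [O] outside [Z] is then in [Y :&: Y'], against
   [missing]. *)
have inone Z Y a b : good Z -> Y \in XX -> a != b -> a \in Z -> b \in Z -> a \in Y -> b \in Y ->
    Z \subset Y.
  move=> [rZ nZ] YX nab aZ bZ aY bY.
  have dich Y' c d : Y' \in XX -> c != d -> c \in Z -> d \in Z -> c \in Y' -> d \in Y' ->
      Z \subset Y' \/ O \subset Z :|: Y'.
    move=> Y'X ncd cZ dZ cY dY; have [_ rY _] := XXP _ Y'X.
    have rU : crigid E (Z :|: Y').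
      by apply: (crigidU R E2) => //; apply/card_gt1P; exists c, d; rewrite !inE cZ dZ cY dY.
    have [|nU] := boolP (O \subset Z :|: Y'); first by right.
    by left; rewrite -(bigger Y' (Z :|: Y')) ?subsetUl ?subsetUr.
  have [//|OZY] := dich Y a b YX nab aZ bZ aY bY.
  apply: contraT => /subsetPn[y yZ yY].
  have [y' y'Z eyy] : exists2 y', y' \in Z & e y y'.
    have Z3 : (3 <= #|Z|)%N.
      apply: (@leq_trans #|[set y; a; b]|); last first.
        by apply: subset_leq_card; rewrite !subUset !sub1set yZ aZ bZ.
      rewrite -setUA cardsU1 cards2 nab !inE negb_or.
      have -> : y != a by apply: contraNneq yY => ->.
      by have -> : y != b by apply: contraNneq yY => ->.
    have /card_gt0P[y'] : (0 < #|nbrs E Z y|)%N.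
      by apply: ltnW; apply: crigid_degree.
    by rewrite inE in_edges // => /andP[? ?]; exists y'.
  have [Y' [Y'X yY' y'Y']] := coverE _ _ eyy.
  have nYY : Y != Y' by apply: contraNneq yY => ->.
  have [sZ|OZY'] := dich Y' y y' Y'X (edge_neq se eyy) yZ y'Z yY' y'Y'.
    case/negP: nYY; apply/eqP; apply: (uniqE _ _ a b) => //; exact: (subsetP sZ).
  have := missing rZ nZ; rewrite ltnNge => /negP[].
  apply: leq_trans (small _ _ YX Y'X nYY); apply: subset_leq_card.
  apply/subsetP => x /setDP[xO xZ]; rewrite inE.
  by have := subsetP OZY x xO; have := subsetP OZY' x xO; rewrite !inE (negPf xZ) /= => -> ->.
exists XX, #|X|, X => //; split=> //; split=> //.
  by move=> Y /imsetP[g gG ->]; exists g.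
move=> v vO; rewrite leqNgt; apply/negP => big.
have /choice[FF hFF] (Y : {set T}) : exists F : {set {set T}}, Y \in XX ->
    [/\ F \subset restr E Y, sparse F & #|F| = (2 * #|X| - 3)%N].
  have [YX|] := boolP (Y \in XX); last by exists set0.
  by have [<- [F hF] _] := XXP _ YX; exists F.
(* One Laman subgraph from each member; they are disjoint, since different members share no edge. *)
pose U : {set {set T}} := \bigcup_(Y in XX) FF Y.
have UE : U \subset E.
  apply/bigcupsP => Y YX; have [s _ _] := hFF Y YX; exact: subset_trans s (restr_sub _ _).
pose F := U :\: inc E v.
have cU : (#|XX| * (2 * #|X| - 3) <= #|U|)%N.
  have -> : (#|XX| * (2 * #|X| - 3) = \sum_(Y in XX) \sum_(h in U | h \in FF Y) 1)%N.
    rewrite -sum_nat_const; apply: eq_bigr => Y YX; have [_ _ <-] := hFF Y YX; rewrite -sum1_card.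
    apply: eq_bigl => h; rewrite andb_idl // => hF; apply/bigcupP; by exists Y.
  rewrite (exchange_big_dep (mem U)) /=; last by move=> Y h _ /andP[].
  rewrite -[leqRHS]sum1_card; apply: leq_sum => h hU; rewrite sum1dep_card; apply: leq_trans (_ : #|XX :&: [set Y | h \in FF Y]| <= 1)%N.
    by apply: subset_leq_card; apply/subsetP => Y; rewrite !inE => /and3P[-> _ ->].
  apply/card_le1P => Y; rewrite !inE => /andP[YX hY] Y'; rewrite !inE.
  apply/andP/eqP => [[Y'X hY']|->//].
  have [sY _ _] := hFF Y YX; have [sY' _ _] := hFF Y' Y'X.
  have := subsetP sY h hY; have := subsetP sY' h hY'; rewrite !inE.
  case/andP=> /edgesP[a [b [eab ->]]]; rewrite !subUset !sub1set => /andP[aY bY] /andP[_ /andP[aY' bY']].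
  by apply: (uniqE _ _ a b) => //; apply: edge_neq eab.
have cF : (2 * #|T| - 5 <= #|F|)%N.
  have : (#|U| <= #|F| + #|inc E v|)%N.
    rewrite -(cardsID (inc E v) U) addnC leq_add2l.
    by apply: subset_leq_card; apply: subsetIr.
  rewrite card_inc_edges //.
  by move: cU big; move: (_ * _)%N; clear; lia.
have F2 : edge_set F by move=> h /setDP[/(subsetP UE)/E2].
have iF : inc F v = set0.
  apply/setP => h; rewrite !inE; apply/negP => /andP[/andP[n hU] vh].
  by move: n; rewrite (subsetP UE) // vh.
have T3 : (3 <= #|T|)%N by apply: leq_trans O3 (max_card _).
(* A circuit in [F] avoids [v], so its support is a good set having an edge in some [Y]. By [inone]
   it lies in [Y], whose chosen subgraph is sparse. *)
have [sF|/(not_sparse_tight F2 iF)[C [W [c [sCF nC cC sCc [cW vW]]]]]] := pselect (sparse F).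
  apply: (nrig vO); exists F; split=> //.
    apply/subsetP => h hF; rewrite inE (subsetP UE) /=; last by case/setDP: hF.
    rewrite subsetD1 subsetT /=; apply/negP => vh.
    by have : h \in inc F v; [rewrite inE hF|rewrite iF inE].
  have cT : #|[set: T] :\ v| = #|T|.-1.
    by rewrite [in RHS]/= -cardsT (cardsD1 v [set: T]) inE.
  have [_ /(_ (setT :\ v))] := sF; rewrite cT.
  have -> : restr F (setT :\ v) = F.
    apply/setP => h; rewrite inE andb_idr // => hF; rewrite subsetD1 subsetT /=; apply/negP => vh.
    by have : h \in inc F v; [rewrite inE hF|rewrite iF inE].
  by move: cF T3; clear; lia.
apply: nC; have gW : good W.
  split; last by apply/negP => /subsetP /(_ v vO); apply/negP.
  exists (C :\ c); split=> //; apply/subsetP => h /setD1P[_ /(subsetP sCF)].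
  by rewrite !inE => /andP[/andP[_ /(subsetP UE)-> ->]].
have inU h : h \in C -> exists Y, [/\ Y \in XX, h \in FF Y, h \in E, h \subset Y & h \subset W].
  move=> hC; have := subsetP sCF h hC; rewrite !inE => /andP[/andP[_ hU] hW].
  have /bigcupP[Y YX hY] := hU; have [sY _ _] := hFF Y YX.
  by have := subsetP sY h hY; rewrite inE => /andP[hE hY']; exists Y.
have [Y [YX cY /edgesP[a [b [eab ec]]] cY' cW']] := inU c cC.
have nab := edge_neq se eab.
have [aY bY] : a \in Y /\ b \in Y by move: cY'; rewrite ec subUset !sub1set => /andP.
have [aW bW] : a \in W /\ b \in W by move: cW'; rewrite ec subUset !sub1set => /andP.
have sWY := inone W Y a b gW YX nab aW bW aY bY.
have [_ sY _] := hFF Y YX; apply: sparse_sub sY; apply/subsetP => h hC.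
have [Y1 [Y1X hY1 /edgesP[a1 [b1 [e1 eh]]] hY1' hW]] := inU h hC.
suff -> : Y = Y1 by [].
move: hY1' hW; rewrite eh !subUset !sub1set => /andP[a1Y b1Y] /andP[a1W b1W].
by apply: (uniqE _ _ a1 b1) => //; [exact: edge_neq e1|exact: (subsetP sWY)|exact: (subsetP sWY)].
Qed.

End Core.


(** * Double counting of incidences *)

Section Incidence.
Variables (T : finType) (XX : {set {set T}}).
Implicit Types (x y : T) (S Y : {set T}).

Definition mult x := #|[set Y in XX | x \in Y]|.

Lemma sum_mult S : (\sum_(x in S) mult x = \sum_(Y in XX) #|Y :&: S|)%N.
Proof.
rewrite /mult; under eq_bigr => x _ do rewrite -sum1_card.
under [RHS]eq_bigr => Y _ do rewrite -sum1_card.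
rewrite (exchange_big_dep (mem XX)) /=; last by move=> x Y _; rewrite inE => /andP[].
by apply: eq_bigr => Y YX; apply: eq_bigl => x; rewrite !inE YX andbC.
Qed.

Lemma sum_mult_const S m c : (forall x, x \in S -> mult x = m) ->
  (forall Y, Y \in XX -> #|Y :&: S| = c) -> (#|S| * m = #|XX| * c)%N.
Proof.
move=> hm hc; have := sum_mult S.
rewrite (eq_bigr (fun=> m)) // sum_nat_const => ->.
by rewrite (eq_bigr (fun=> c)) // sum_nat_const.
Qed.

Lemma mult_perm (g : {perm T}) x : (forall Y, Y \in XX -> g @: Y \in XX) ->
  (mult x <= mult (g x))%N.
Proof.
move=> gX; rewrite /mult -(card_imset _ (@imset_perm_inj T g)); apply: subset_leq_card.
apply/subsetP => Z /imsetP[Y YZ ->]; move: YZ; rewrite !inE => /andP[YX xY].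
by rewrite gX //= imset_f.
Qed.

Lemma mult_le x : (mult x <= #|XX|)%N.
Proof. by apply: subset_leq_card; apply/subsetP => Y; rewrite inE => /andP[]. Qed.

Lemma cover_le x S c : (forall y, y \in S -> exists Y, [/\ Y \in XX, x \in Y & y \in Y]) ->
  (forall Y, Y \in XX -> x \in Y -> #|S :&: Y| <= c)%N -> (#|S| <= mult x * c)%N.
Proof.
move=> cov le; rewrite -sum1_card.
apply: (@leq_trans (\sum_(y in S) \sum_(Y in [set Y in XX | x \in Y] | y \in Y) 1)%N).
  apply: leq_sum => y yS; have [Y [YX xY yY]] := cov y yS.
  by rewrite sum1dep_card; apply/card_gt0P; exists Y; rewrite !inE YX xY yY.
rewrite (exchange_big_dep (mem [set Y in XX | x \in Y])) /=; last by move=> y Y _ /andP[].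
rewrite /mult -sum_nat_const; apply: leq_sum => Y; rewrite inE => /andP[YX xY].
rewrite sum1dep_card; apply: leq_trans (le Y YX xY); apply: subset_leq_card.
by apply/subsetP => y; rewrite !inE => /and3P[-> _ ->].
Qed.

End Incidence.

Lemma degree_perm (T : finType) (e : rel T) (g : {perm T}) x :
  is_automorphism e g -> degree e (g x) = degree e x.
Proof.
move=> ge; rewrite /degree -(card_imset_perm g [set y | e x y]).
apply: eq_card => y; rewrite inE; apply/idP/imsetP => [exy|[z]].
  by exists ((g^-1)%g y); rewrite ?permKV // inE -ge permKV.
by rewrite inE => exz ->; rewrite ge.
Qed.

Lemma connected_closed (T : finType) (e : rel T) (S : {set T}) x :
  connected_graph e -> x \in S -> (forall a b, a \in S -> e a b -> b \in S) -> S = setT.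
Proof.
move=> ce xS cl; apply/setP => y; rewrite inE.
have /connectP[pth] := ce x y.
elim: pth x xS => [|b pth ih] x xS /=; first by move=> _ ->.
by case/andP=> exb pp ey; apply: (ih b) => //; apply: cl exb.
Qed.

Lemma imset_setTD1 (T : finType) (g : {perm T}) v : g @: (setT :\ v) = setT :\ g v.
Proof.
apply/setP => y; rewrite !inE andbT; apply/imsetP/idP => [[z]|ny].
  by rewrite !inE andbT => zv ->; rewrite (inj_eq perm_inj).
exists ((g^-1)%g y); rewrite ?permKV // !inE andbT.
by apply: contra ny => /eqP <-; rewrite permKV.
Qed.

Lemma edges_imF (T : finType) (e : rel T) (g : {perm T}) : simple_graph e ->
  is_automorphism e g -> imF g (edges e) = edges e.
Proof.
move=> se ge; apply/eqP; rewrite eqEcard card_imF leqnn andbT; apply/subsetP => h.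
case/imsetP=> h0 /edgesP[x [y [exy ->]]] ->; rewrite imsetU1 imset_set1 in_edges //.
by rewrite ge.
Qed.

(** [N] members of size [s] cover [n] vertices [t] times each; [k] is the degree. For [s = 2] there
    are at least [n * k / 2] members. For larger [s], either [t >= 3] and [3 * N <= n * t], or
    [t = 2] and [k <= 2 * (s - 1)]. *)
Lemma vt_arith (t k N n s : nat) : (2 <= s)%N -> (N * (2 * s - 3) + 6 <= 2 * n + k)%N ->
  (n * t = N * s)%N -> (k <= t * s.-1)%N -> (2 <= t)%N -> (t <= N)%N -> (k < n)%N ->
  (3 <= s)%N || (4 <= k)%N -> False.
Proof.
case: s => [|[|[|s]]] // _ cnt Ns kt t2 tN kn.
  rewrite muln1 /= in kt cnt; move=> k4; rewrite /= in k4.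
  have h : (n * k <= n * t)%N by rewrite leq_mul2l kt orbT.
  have h2 : (k.+1 * (k - 4) <= n * (k - 4))%N by rewrite leq_mul2r kn orbT.
  nia.
move=> _; rewrite /= in kt.
have e1 : (N * (2 * s.+3 - 3) = 2 * (N * s) + 3 * N)%N by nia.
have e2 : (N * s.+3 = N * s + 3 * N)%N by nia.
rewrite e1 in cnt; rewrite e2 in Ns.
have [t3|t3] := leqP 3 t; last first.
  have et : t = 2%N by lia.
  subst t; have : (2 * s <= N * s)%N by rewrite leq_mul2r tN orbT.
  by lia.
have : (n * 3 <= n * t)%N by rewrite leq_mul2l t3 orbT.
by lia.
Qed.

(** * Removal of a vertex from a vertex-transitive graph *)

Section VertexTransitive.
Variables (R : realType) (T : finType) (e : rel T).
Hypotheses (se : simple_graph e) (ce : connected_graph e).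
Variables (G : {group {perm T}}) (H : {set {set T}}).
Hypothesis Ge : forall g, g \in G -> is_automorphism e g.
Hypothesis tr : forall x y, exists2 g, g \in G & g x = y.
Hypothesis GH : forall h h', h \in H -> h' \in H -> exists2 g, g \in G & g @: h = h'.
Hypothesis Hclique : forall h x y, h \in H -> x \in h -> y \in h -> x != y -> e x y.
Hypothesis Hcover : forall x y, e x y -> exists h, [/\ h \in H, x \in h & y \in h].
Hypothesis deg3 : forall x, (3 <= degree e x)%N.
(** Excludes cubic graphs with [H] made of edges, where a removal can destroy rigidity, as in the
    complete bipartite graph on 3 + 3 vertices. *)
Hypothesis deg4 : (exists2 h, h \in H & (3 <= #|h|)%N) \/ forall x, (4 <= degree e x)%N.

Theorem vertex_transitive_rigid v : crigid (edges e) (setT :\ v).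
Proof.
apply: contrapT => nv.
have nrig u : u \in [set: T] -> ~ crigid (edges e) (setT :\ u).
  move=> _ ru; apply: nv; have [g gG <-] := tr u v.
  by rewrite -imset_setTD1; apply: crigid_imset ru; apply: edges_imF => //; exact: Ge.
have T3 : (3 <= #|[set: T]|)%N.
  by rewrite cardsT; apply: leq_trans (deg3 v) _; apply: max_card.
have [||||XX [s [X0 X0X [s2 XXP small coverH [XXG _ cnt]]]]] :=
  @core R T e se ce G setT H Ge _ _ GH Hclique Hcover _ deg3 _ T3 nrig.
- by move=> g x _; rewrite !inE.
- by move=> x y _ _; apply: tr.
- by move=> h _; left; apply: subsetT.
- by move=> x y; rewrite inE.
have {}cnt := cnt v (in_setT v).
have coverE a b : e a b -> exists Y, [/\ Y \in XX, a \in Y & b \in Y].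
  move=> eab; have [h [hH ah bh]] := Hcover eab; have [Y YX s'] := coverH h hH.
  by exists Y; split=> //; apply: (subsetP s').
have multE x : mult XX x = mult XX v.
  apply/eqP; rewrite eqn_leq; have [g gG gx] := tr x v; have [f fG fv] := tr v x.
  have := @mult_perm _ XX g x (fun Y => XXG g Y gG); rewrite gx => ->.
  by have := @mult_perm _ XX f v (fun Y => XXG f Y fG); rewrite fv => ->.
have Ns : (#|T| * mult XX v = #|XX| * s)%N.
  rewrite -cardsT; apply: sum_mult_const => [x _|Y YX]; first exact: multE.
  by rewrite setIT; have [] := XXP Y YX.
have kt : (degree e v <= mult XX v * s.-1)%N.
  apply: cover_le => [y|Y YX vY]; first by rewrite inE; apply: coverE.
  have [<- _ _] := XXP Y YX; rewrite (cardsD1 v Y) vY add1n /=.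
  apply: subset_leq_card; apply/subsetP => y; rewrite !inE => /andP[evy yY].
  by rewrite yY andbT eq_sym (edge_neq se evy).
(* If the members were disjoint, [X0] would be closed under adjacency. *)
have t2 : (2 <= mult XX v)%N.
  rewrite ltnNge; apply/negP => t1; have [c0 _ /negP nX] := XXP _ X0X; apply: nX.
  have /card_gt0P[x xX] : (0 < #|X0|)%N by rewrite c0; apply: ltnW.
  rewrite (connected_closed ce xX) // => a b aX eab.
  have [Y [YX aY bY]] := coverE _ _ eab.
  suff <- : Y = X0 by [].
  move: t1; rewrite -(multE a) => /card_le1P /(_ Y); rewrite inE YX aY => /(_ isT X0).
  by rewrite !inE X0X aX => /esym/eqP.
have tN := mult_le XX v.
have kn : (degree e v < #|T|)%N.
  rewrite /degree -cardsT; apply: proper_card; apply/properP; split; first exact: subsetT.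
  by exists v; rewrite ?inE // se.1.
have d4 : (3 <= s)%N || (4 <= degree e v)%N.
  case: deg4 => [[h hH h3]|h4]; last by rewrite h4 orbT.
  have [Y YX hY] := coverH h hH; have [<- _ _] := XXP Y YX.
  by rewrite (leq_trans h3 (subset_leq_card hY)).
exact: (vt_arith s2 cnt Ns kt t2 tN kn d4).
Qed.

End VertexTransitive.

(** The members have [al] and [be] vertices on the two sides and cover them [tA] and [tB] times.
    Either both multiplicities are at least 2, or one is 1 and [p] is at most [al] or [be]. *)
Lemma bip_arith3 (a b p q N al be tA tB : nat) : (3 <= al)%N -> (3 <= be)%N ->
  (p <= q)%N -> (2 <= N)%N -> (tA <= N)%N -> (1 <= tA)%N -> (1 <= tB)%N ->
  (a * tA = N * al)%N -> (b * tB = N * be)%N -> (p <= tA * be)%N ->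
  (tA = 1%N -> tB = 1%N -> False) -> (tB = 1%N -> q <= al)%N ->
  (N * (2 * (al + be) - 3) + 6 <= 2 * (a + b) + p)%N -> False.
Proof.
move=> al3 be3 pq N2 tAN tA1 tB1 ea eb pt nt tq cnt.
have e1 : (N * (2 * (al + be) - 3) + 3 * N = 2 * (N * al) + 2 * (N * be))%N by nia.
have hA : (3 * N <= N * al)%N by rewrite mulnC leq_mul2l al3 orbT.
have hB : (3 * N <= N * be)%N by rewrite mulnC leq_mul2l be3 orbT.
have [tA2|tA2] := leqP 2 tA.
  have a2 : (a * 2 <= a * tA)%N by rewrite leq_mul2l tA2 orbT.
  have [tB2|tB2] := leqP 2 tB.
    have b2 : (b * 2 <= b * tB)%N by rewrite leq_mul2l tB2 orbT.
    have : (tA * be <= N * be)%N by rewrite leq_mul2r tAN orbT.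
    by lia.
  have eB : tB = 1%N by lia.
  have h := tq eB; subst tB.
  have : (2 * (al - 3) <= N * (al - 3))%N by rewrite leq_mul2r N2 orbT.
  have e3 : (N * (al - 3) + 3 * N = N * al)%N by nia.
  by lia.
have eA : tA = 1%N by lia.
have tB2 : (2 <= tB)%N by case: (leqP 2 tB) => // h; case: nt => //; lia.
have b2 : (b * 2 <= b * tB)%N by rewrite leq_mul2l tB2 orbT.
subst tA; rewrite mul1n in pt.
have : (2 * (be - 3) <= N * (be - 3))%N by rewrite leq_mul2r N2 orbT.
have e3 : (N * (be - 3) + 3 * N = N * be)%N by nia.
by lia.
Qed.

(** The case of members that are single edges. For [p = 3] the contradiction comes from
    [2 * (a + b) <= Ec + 2], for larger [p] from [b <= a] and [p <= a]. *)
Lemma bip_arith2 (a b p q N Ec : nat) : (Ec <= N)%N -> (Ec = a * p)%N -> (Ec = b * q)%N ->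
  (3 <= p)%N -> (p <= q)%N -> (q <= a)%N -> (2 * (a + b) <= Ec + 2)%N ->
  (N + 6 <= 2 * (a + b) + p)%N -> False.
Proof.
move=> EN ea eb p3 pq qa E2 cnt.
have [p4|p4] := leqP 4 p; last by lia.
have ba : (b <= a)%N.
  have : (b * p <= b * q)%N by rewrite leq_mul2l pq orbT.
  by rewrite -eb ea => h; rewrite -(@leq_pmul2r p) //; apply: leq_trans p4.
have h : (p * (p - 4) <= a * (p - 4))%N by rewrite leq_mul2r (leq_trans pq qa) orbT.
nia.
Qed.

(** * Removal of a vertex of the lower-degree side *)

Section Bipartite.
Variables (R : realType) (T : finType) (e : rel T).
Hypotheses (se : simple_graph e) (ce : connected_graph e).
Variables (G : {group {perm T}}) (A : {set T}) (p q : nat).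
Hypothesis Ge : forall g, g \in G -> is_automorphism e g.
Hypothesis GA : forall g x, g \in G -> (g x \in A) = (x \in A).
Hypothesis trA : forall x y, x \in A -> y \in A -> exists2 g, g \in G & g x = y.
Hypothesis trB : forall x y, x \notin A -> y \notin A -> exists2 g, g \in G & g x = y.
Hypothesis bip : forall x y, e x y -> (x \in A) = (y \notin A).
Hypothesis trE : forall x y u v, e x y -> e u v -> x \in A -> u \in A ->
  exists2 g, g \in G & g x = u /\ g y = v.
Hypothesis degA : forall x, x \in A -> degree e x = p.
Hypothesis degB : forall x, x \notin A -> degree e x = q.
Hypotheses (p3 : (3 <= p)%N) (pq : (p <= q)%N).

Lemma edge_orient h : h \in edges e -> exists x y, [/\ e x y, x \in A, y \notin A & h = [set x; y]].
Proof.
case/edgesP=> x [y [exy ->]]; have := bip exy; have [xA yA|xA yA] := boolP (x \in A).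
  by exists x, y.
exists y, x; split=> //; [by rewrite se.2| |by rewrite setUC].
by rewrite -[_ \in _]negbK -yA.
Qed.

Lemma card_edges_A : #|edges e| = (#|A| * p)%N.
Proof.
rewrite -sum_nat_const.
transitivity (\sum_(x in A) #|inc (edges e) x|)%N; last first.
  by apply: eq_bigr => x xA; rewrite card_inc_edges ?degA.
rewrite -sum1_card; under [RHS]eq_bigr => x _ do rewrite -sum1_card.
rewrite (exchange_big_dep (mem (edges e))) /=; last by move=> x h _; rewrite inE => /andP[].
apply: eq_bigr => h hE; rewrite sum1dep_card.
have [x [y [exy xA yA eh]]] := edge_orient hE.
rewrite -(cards1 x); apply: eq_card => z; rewrite !inE hE eh !inE.
have [->|zx] := eqVneq z x; first by rewrite xA.
by have [->|] := eqVneq z y; rewrite ?andbF // (negPf yA).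
Qed.

Lemma card_edges_B : #|edges e| = (#|~: A| * q)%N.
Proof.
rewrite -sum_nat_const.
transitivity (\sum_(x in ~: A) #|inc (edges e) x|)%N; last first.
  by apply: eq_bigr => x; rewrite inE => xA; rewrite card_inc_edges ?degB.
rewrite -sum1_card; under [RHS]eq_bigr => x _ do rewrite -sum1_card.
rewrite (exchange_big_dep (mem (edges e))) /=; last by move=> x h _; rewrite inE => /andP[].
apply: eq_bigr => h hE; rewrite sum1dep_card.
have [x [y [exy xA yA eh]]] := edge_orient hE.
rewrite -(cards1 y); apply: eq_card => z; rewrite !inE hE eh !inE.
have [->|zx] := eqVneq z y; first by rewrite yA orbT.
by have [->|] := eqVneq z x; rewrite ?andbF ?xA.
Qed.

Lemma bip_tight_parts Y : crigid (edges e) Y -> (3 <= #|Y|)%N ->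
  (3 <= #|Y :&: A|)%N /\ (3 <= #|Y :&: ~: A|)%N.
Proof.
move=> [F [sFE _ cF]] Y3.
have le : (#|F| <= #|Y :&: A| * #|Y :&: ~: A|)%N.
  rewrite -cardsX; apply: leq_trans (leq_imset_card (fun xy => [set xy.1; xy.2]) _).
  apply: subset_leq_card; apply/subsetP => h /(subsetP sFE); rewrite inE => /andP[hE hY].
  have [x [y [exy xA yA eh]]] := edge_orient hE.
  move: hY; rewrite eh subUset !sub1set => /andP[xY yY].
  by apply/imsetP; exists (x, y); rewrite // !inE xY yY xA yA.
have := cardsID A Y; rewrite setDE => cY; rewrite -cY in Y3 cF; rewrite cF in le.
move: #|Y :&: A| #|Y :&: ~: A| Y3 le => a b; clear; move=> Y3 le.
suff aux (c d : nat) : (3 <= c + d)%N -> (2 * (c + d) - 3 <= c * d)%N -> (3 <= d)%N.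
  split; last exact: (aux a b).
  by have := aux b a; rewrite [(b + a)%N]addnC [(b * a)%N]mulnC; apply.
by case: d => [|[|[|d]]] //; lia.
Qed.

Theorem bipartite_rigid v : (2 * #|T| <= #|edges e| + 2)%N -> v \in A ->
  crigid (edges e) (setT :\ v).
Proof.
move=> E2 vA; apply: contrapT => nv.
have nrig u : u \in A -> ~ crigid (edges e) (setT :\ u).
  move=> uA ru; apply: nv; have [g gG <-] := trA uA vA.
  by rewrite -imset_setTD1; apply: crigid_imset ru; apply: edges_imF => //; exact: Ge.
have [y0 ey0] : exists y, e v y.
  have /card_gt0P[y] : (0 < #|[set y | e v y]|)%N.
    by rewrite -/(degree e v) degA //; apply: leq_trans p3.
  by rewrite inE; exists y.
have y0A : y0 \notin A by have := bip ey0; rewrite vA => <-.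
have degge x : (3 <= degree e x)%N.
  have [xA|xA] := boolP (x \in A); first by rewrite degA.
  by rewrite degB //; apply: leq_trans pq.
have nbrA y : y \notin A -> forall x, e y x -> x \in A.
  by move=> yA x /bip; rewrite (negPf yA) => /esym/negbFE.
have qA : (q <= #|A|)%N.
  rewrite -(degB y0A); apply: subset_leq_card; apply/subsetP => x; rewrite inE.
  exact: nbrA.
have A3 : (3 <= #|A|)%N by apply: leq_trans qA; apply: leq_trans pq.
have [|||||XX [s [X0 X0X [s2 XXP small coverE' [XXG XXorb cnt]]]]] :=
  @core R T e se ce G A (edges e) Ge GA trA _ _ _ _ degge _ A3 nrig.
- move=> h h' /edge_orient[x [y [exy xA yA ->]]] /edge_orient[x' [y' [exy' xA' yA' ->]]].
  have [g gG [gx gy]] := trE exy exy' xA xA'; exists g => //.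
  by rewrite imsetU1 imset_set1 gx gy.
- move=> h x y /edgesP[a [b [eab ->]]] /set2P[]-> /set2P[]->; rewrite ?eqxx // => _.
  by rewrite se.2.
- by move=> x y exy; exists [set x; y]; rewrite in_edges // exy set21 set22.
- by move=> h hE; right; exact: (edges_edge_set se hE).
- by move=> x y xA exy; apply: nbrA exy.
have {}cnt := cnt v vA; rewrite degA // in cnt.
have coverE a b : e a b -> exists Y, [/\ Y \in XX, a \in Y & b \in Y].
  move=> eab; have [|Y YX] := coverE' [set a; b]; first by rewrite in_edges.
  by rewrite subUset !sub1set => /andP[aY bY]; exists Y.
have multE x y : (x \in A) = (y \in A) -> mult XX x = mult XX y.
  have le x' y' : (x' \in A) = (y' \in A) -> (mult XX x' <= mult XX y')%N.
    move=> exy; have [g gG <-] : exists2 g, g \in G & g x' = y'.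
      have [xA|xA] := boolP (x' \in A); first by apply: trA; rewrite -?exy.
      by apply: trB; rewrite -?exy.
    by apply: mult_perm => Y; apply: XXG.
  by move=> exy; apply/eqP; rewrite eqn_leq !le.
have cT : (#|A| + #|~: A| = #|T|)%N by rewrite cardsC.
have [s3|] := leqP 3 s; last first.
  move=> s3; have {s3 s2} es : s = 2%N by lia.
  subst s; rewrite muln1 in cnt.
  have EN : (#|edges e| <= #|XX|)%N.
    apply: subset_leq_card; apply/subsetP => h hE; have [Y YX hY] := coverE' h hE.
    have [cY _ _] := XXP Y YX; suff -> : h = Y by [].
    by apply/eqP; rewrite eqEcard hY cY (edges_edge_set se hE).
  rewrite -cT in E2 cnt.
  exact: (bip_arith2 EN card_edges_A card_edges_B p3 pq qA E2 cnt).
have [c0 r0 n0] := XXP _ X0X.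
have partA Y : Y \in XX -> #|Y :&: A| = #|X0 :&: A|.
  case/XXorb=> g gG ->; rewrite -(card_imset_perm g (X0 :&: A)).
  apply: eq_card => y; rewrite inE; apply/andP/imsetP => [[/imsetP[x xX ->] gxA]|[x /setIP[xX xA] ->]].
    by exists x; rewrite // inE xX -(GA _ gG).
  by rewrite imset_f // GA.
have partB Y : Y \in XX -> #|Y :&: ~: A| = #|X0 :&: ~: A|.
  move=> YX; have := cardsID A Y; have := cardsID A X0; rewrite !setDE partA //.
  by have [-> _ _] := XXP Y YX; rewrite c0 => h1 h2; move: h1; rewrite -h2 => /addnI.
have [al3 be3] : (3 <= #|X0 :&: A|)%N /\ (3 <= #|X0 :&: ~: A|)%N.
  by apply: bip_tight_parts => //; rewrite c0.
have eA : (#|A| * mult XX v = #|XX| * #|X0 :&: A|)%N.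
  by apply: sum_mult_const => // x xA; apply: multE; rewrite xA vA.
have eB : (#|~: A| * mult XX y0 = #|XX| * #|X0 :&: ~: A|)%N.
  by apply: sum_mult_const => // x; rewrite inE => xA; apply: multE; rewrite (negPf xA) (negPf y0A).
have pt : (p <= mult XX v * #|X0 :&: ~: A|)%N.
  rewrite -(degA vA); apply: cover_le => [y|Y YX vY]; first by rewrite inE; apply: coverE.
  rewrite -(partB Y YX); apply: subset_leq_card; apply/subsetP => y; rewrite !inE => /andP[evy ->] /=.
  by have := bip evy; rewrite vA => <-.
have pos x : (1 <= mult XX x)%N.
  have /card_gt0P[y] : (0 < #|[set y | e x y]|)%N by apply: leq_trans (degge x).
  rewrite inE => exy; have [Y [YX xY _]] := coverE _ _ exy.
  by apply/card_gt0P; exists Y; rewrite inE YX.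
have uniq1 x Y Y' : mult XX x = 1%N -> Y \in XX -> Y' \in XX -> x \in Y -> x \in Y' -> Y = Y'.
  move=> t1 YX Y'X xY xY'; have /card_le1P/(_ Y) : (mult XX x <= 1)%N by rewrite t1.
  by rewrite inE YX xY => /(_ isT Y'); rewrite !inE Y'X xY' => /esym/eqP.
have nt : mult XX v = 1%N -> mult XX y0 = 1%N -> False.
  move=> tA1 tB1; have m1 x : mult XX x = 1%N.
    have [xA|xA] := boolP (x \in A); first by rewrite -tA1; apply: multE; rewrite xA vA.
    by rewrite -tB1; apply: multE; rewrite (negPf xA) (negPf y0A).
  have /card_gt0P[x xX] : (0 < #|X0|)%N by rewrite c0; apply: leq_trans s3.
  case/negP: n0; rewrite (connected_closed ce xX) ?subsetT // => a b aX eab.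
  by have [Y [YX aY bY]] := coverE _ _ eab; rewrite (uniq1 a X0 Y).
have tq : (mult XX y0 = 1%N -> q <= #|X0 :&: A|)%N.
  move=> t1; have /card_gt0P[Y] : (0 < mult XX y0)%N by [].
  rewrite inE => /andP[YX yY]; rewrite -(partA Y YX) -(degB y0A).
  apply: subset_leq_card; apply/subsetP => x; rewrite !inE => ey.
  rewrite (nbrA _ y0A _ ey) andbT; have [Y' [Y'X yY' xY']] := coverE _ _ ey.
  by rewrite (uniq1 y0 Y Y').
have N2 : (2 <= #|XX|)%N.
  have := pos v; have := pos y0; have := mult_le XX v; have := mult_le XX y0.
  move: (mult XX v) (mult XX y0) #|XX| nt; clear; move=> tA tB N nt *.
  case: (leqP 2 N) => // h; case: nt; lia.
have es : (s = #|X0 :&: A| + #|X0 :&: ~: A|)%N by rewrite -c0 -(cardsID A X0) setDE.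
rewrite es -cT in cnt.
exact: (bip_arith3 al3 be3 pq N2 (mult_le XX v) (pos v) (pos y0) eA eB pt nt tq cnt).
Qed.

End Bipartite.


(** * Sufficiency *)

Section AutGroup.
Variables (T : finType) (e : rel T).

Definition aut_set : {set {perm T}} :=
  [set g : {perm T} | [forall x, forall y, e (g x) (g y) == e x y]].

Lemma aut_setP (g : {perm T}) : reflect (is_automorphism e g) (g \in aut_set).
Proof.
rewrite inE; apply: (iffP forallP) => [h x y|h x]; first by have /forallP/(_ y)/eqP := h x.
by apply/forallP => y; rewrite h.
Qed.

Lemma aut_group_set : group_set aut_set.
Proof.
apply/group_setP; split; first by apply/aut_setP => x y; rewrite !perm1.
by move=> f g /aut_setP hf /aut_setP hg; apply/aut_setP => x y; rewrite !permM hg hf.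
Qed.

Definition aut_group : {group {perm T}} := Group aut_group_set.

End AutGroup.

(** * Rigid sets of a subtype of the vertices *)

Section Transport.
Variables (T : finType) (P : pred T).
Local Notation TB := {x : T | P x}.

Definition valF (F : {set {set TB}}) : {set {set T}} := [set val @: (h : {set TB}) | h in F].

Lemma imset_val_inj : injective (fun h : {set TB} => [set val x | x in h]).
Proof. exact/imset_inj/val_inj. Qed.

Lemma crigid_val (E : {set {set TB}}) (X : {set TB}) :
  crigid E X -> crigid (valF E) (val @: X).
Proof.
move=> [F [sFE [F2 sF] cF]]; exists (valF F); split.
- apply/subsetP => h /imsetP[h0 /(subsetP sFE)]; rewrite inE => /andP[h0E h0X] ->.
  by rewrite inE imset_f // imsetS.
- split=> [h /imsetP[h0 /F2 h2 ->]|W]; first by rewrite card_imset //; exact: val_inj.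
  pose W' := [set x : TB | val x \in W].
  have -> : restr (valF F) W = valF (restr F W').
    apply/setP => h; rewrite inE; apply/andP/imsetP => [[/imsetP[h0 h0F ->] s]|[h0]].
      exists h0 => //; rewrite inE h0F; apply/subsetP => x xh.
      by rewrite inE (subsetP s) // imset_f.
    rewrite inE => /andP[h0F s] ->; split; first exact: imset_f.
    by apply/subsetP => z /imsetP[x /(subsetP s) xW ->]; move: xW; rewrite inE.
  rewrite card_imset; last exact: imset_val_inj.
  apply: leq_trans (sF W') _; apply: leq_sub2r; rewrite leq_mul2l /=.
  rewrite -(card_imset (mem W') val_inj); apply: subset_leq_card.
  by apply/subsetP => z /imsetP[x xW ->]; move: xW; rewrite inE.
- by rewrite (card_imset _ imset_val_inj) cF card_imset //; exact: val_inj.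
Qed.

End Transport.

Section Sufficiency.
Variables (R : realType) (T : finType) (e : rel T).
Hypotheses (se : simple_graph e) (ce : connected_graph e) (et : edge_transitive e).
Hypothesis deg3 : forall x, (3 <= degree e x)%N.
Hypothesis cntE : (2 * #|T| <= #|edges e| + 2)%N.

Let G := aut_group e.
Let Ge g : g \in G -> is_automorphism e g. Proof. by move/aut_setP. Qed.

Let nbr x : exists y, e x y.
Proof.
have /card_gt0P[y] : (0 < degree e x)%N by apply: leq_trans (deg3 x).
by rewrite inE; exists y.
Qed.

Let equiv_len (p q : realisation R T) : equivalent e p q ->
  forall h, h \in restr (edges e) setT -> len q h = len p h.
Proof.
move=> eq h; rewrite inE => /andP[/edgesP[x [y [exy ->]]] _]; rewrite !len2.
by apply/esym/dist_eq; apply: eq.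
Qed.

Lemma complete_small : (#|T| <= 4)%N -> complete_graph e.
Proof.
move=> T4 x y nxy; apply: contraT => nexy.
have : [set y | e x y] \subset setT :\ x :\ y.
  apply/subsetP => z; rewrite !inE andbT => exz; apply/andP; split.
    by apply: contraTneq exz => ->.
  by rewrite eq_sym (edge_neq se exz).
move/subset_leq_card; have := deg3 x; rewrite /degree.
have c1 : #|T| = (#|[set: T] :\ x|).+1 by rewrite -cardsT (cardsD1 x) inE.
have c2 : #|[set: T] :\ x| = (#|[set: T] :\ x :\ y|).+1.
  by rewrite (cardsD1 y ([set: T] :\ x)) !inE eq_sym nxy.
by move: T4 c1 c2; clear; lia.
Qed.

Lemma vt_globally_rigid : (forall x y, exists2 g, g \in G & g x = y) ->
  ~ complete_graph e -> globally_rigid R e.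
Proof.
move=> tr nc; have [p gp] := generic_realisation R T.
have [T5|/complete_small//] := ltnP 4 #|T|.
have [v0 _] : exists v, v \in [set: T] by apply/card_gt0P; rewrite cardsT; apply: leq_trans T5.
have dE x : degree e x = degree e v0.
  by have [g gG <-] := tr v0 x; apply: degree_perm; apply: Ge.
(* A cubic graph has [3 * #|T| / 2] edges, too few for [cntE] on more than four vertices. *)
have deg4 x : (4 <= degree e x)%N.
  rewrite dE; have es := sum_inc (edges_edge_set se).
  rewrite (eq_bigr (fun=> degree e v0)) in es; last by move=> x' _; rewrite card_inc_edges.
  rewrite sum_nat_const (eq_card (_ : _ =i T)) // in es; rewrite ltnNge; apply/negP => k3.
  have ek : degree e v0 = 3%N by apply/eqP; rewrite eqn_leq k3 deg3.
  rewrite ek in es; have E3 : (#|T| * 3 = 2 * #|edges e|)%N := es.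
  by move: E3 cntE T5; clear; lia.
exists p; split=> // q /equiv_len eq x y; apply/esym/dist_eq.
apply: (@vertex_redundant_rigid R T p (edges e) setT q gp (edges_edge_set se)) => //; rewrite ?inE //.
  by rewrite cardsT ltnW.
move=> u _; apply: (@vertex_transitive_rigid R T e se ce G (edges e) Ge tr) => //; last by right.
- move=> h h' /edgesP[a [b [eab ->]]] /edgesP[c [d [ecd ->]]].
  have [g [ga gab]] := et eab ecd; exists g; first exact/aut_setP.
  by rewrite imsetU1 imset_set1; case: gab => -[-> ->] //; rewrite setUC.
- move=> h a b /edgesP[c [d [ecd ->]]] /set2P[]-> /set2P[]->; rewrite ?eqxx // => _.
  by rewrite se.2.
- by move=> a b eab; exists [set a; b]; rewrite in_edges // eab set21 set22.
Qed.

(** * The bipartite case and the half graph outside [A] *)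

Section Bip.
Variables (A : {set T}) (p q : nat).
Hypothesis GA : forall g x, g \in G -> (g x \in A) = (x \in A).
Hypothesis trA : forall x y, x \in A -> y \in A -> exists2 g, g \in G & g x = y.
Hypothesis trB : forall x y, x \notin A -> y \notin A -> exists2 g, g \in G & g x = y.
Hypothesis bip : forall x y, e x y -> (x \in A) = (y \notin A).
Hypothesis degA : forall x, x \in A -> degree e x = p.
Hypothesis degB : forall x, x \notin A -> degree e x = q.
Hypotheses (p3 : (3 <= p)%N) (pq : (p <= q)%N).

Let TB := {x : T | x \notin A}.

(** Its edges are the pairs whose distance [neighbours_congruent] fixes, the vertices of [A] being
    removable. *)
Definition half_rel : rel TB := fun x y =>
  (val x != val y) && [exists v, e v (val x) && e v (val y)].

Definition block (v : T) : {set TB} := [set x : TB | e v (val x)].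

Lemma half_relP x y : reflect (x != y /\ exists v, [/\ v \in A, e v (val x) & e v (val y)])
  (half_rel x y).
Proof.
apply: (iffP andP) => [[nxy /existsP[v /andP[vx vy]]]|[nxy [v [vA vx vy]]]].
  split=> //; exists v; split=> //; rewrite (bip vx); exact: (valP x).
by split=> //; apply/existsP; exists v; rewrite vx.
Qed.

Lemma half_simple : simple_graph half_rel.
Proof.
split=> [x|x y]; first by rewrite /half_rel eqxx.
rewrite /half_rel eq_sym; congr (_ && _); apply: eq_existsb => v; exact: andbC.
Qed.

Lemma block_card v : v \in A -> #|block v| = p.
Proof.
move=> vA; rewrite -(degA vA) /degree -(card_imset _ val_inj); apply: eq_card => y.
apply/imsetP/idP => [[x]|]; first by rewrite !inE => h ->.
rewrite inE => evy; have yA : y \notin A by rewrite -(bip evy).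
by exists (exist _ y yA) => //; rewrite inE.
Qed.

Lemma half_connected : connected_graph half_rel.
Proof.
move=> x y; pose S := [set z | connect half_rel x z].
pose S' : {set T} := [set val z | z in S] :|: [set v in A | [exists z in S, e v (val z)]].
have valS (z : TB) : (val z \in S') = (z \in S).
  rewrite in_setU mem_imset; last exact: val_inj.
  by rewrite [X in _ || X]inE (negPf (valP z)) orbF.
have xS : val x \in S' by rewrite valS inE connect0.
have : S' = setT.
  apply: (connected_closed ce xS) => a b /setUP[/imsetP[z zS ->]|] eab.
    apply/setUP; right; rewrite inE; apply/andP; split.
      by rewrite (bip (_ : e b (val z))) ?(valP z) // se.2.
    by apply/existsP; exists z; rewrite zS se.2.
  move: eab; rewrite inE => /andP[aA /existsP[z /andP[zS eaz]]] eab.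
  have bA : b \notin A by rewrite -(bip eab).
  rewrite -[b]/(val (exist (fun x => x \notin A) b bA : TB)) valS.
  have [<-//|nzb] := eqVneq z (exist _ b bA).
  rewrite inE in zS; rewrite inE; apply: connect_trans zS (connect1 _).
  by apply/half_relP; split=> //; exists a.
by move/setP => /(_ (val y)); rewrite valS !inE.
Qed.

Let inB g (x : TB) : g \in G -> g (val x) \notin A.
Proof. by move=> gG; rewrite GA // (valP x). Qed.

Lemma half_perm g : g \in G -> exists2 g' : {perm TB},
  g' \in aut_group half_rel & forall x, val (g' x) = g (val x).
Proof.
move=> gG; pose f (x : TB) : TB := exist _ (g (val x)) (inB x gG).
have fI : injective f by move=> x y /(congr1 val) /perm_inj /val_inj.
exists (perm fI) => [|x]; last by rewrite permE.
apply/aut_setP => x y; rewrite !permE.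
have ge := Ge gG.
rewrite /half_rel /= (inj_eq perm_inj); congr (_ && _).
apply/existsP/existsP => -[v /andP[vx vy]].
  by exists ((g^-1)%g v); rewrite -(ge _ (val x)) -(ge _ (val y)) permKV vx.
by exists (g v); rewrite !ge vx.
Qed.

Lemma half_rigid : ~ complete_graph half_rel -> forall u, crigid (edges half_rel) (setT :\ u).
Proof.
move=> nc.
have tr (x y : TB) : exists2 g, g \in aut_group half_rel & g x = y.
  have [g gG gxy] := trB (valP x) (valP y); have [g' g'G hg'] := half_perm gG.
  by exists g' => //; apply: val_inj; rewrite hg'.
have blockP x y : half_rel x y -> exists2 v, v \in A & (x \in block v) && (y \in block v).
  by case/half_relP=> _ [v [vA vx vy]]; exists v => //; rewrite !inE vx.
have clique v x y : v \in A -> x \in block v -> y \in block v -> x != y -> half_rel x y.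
  by rewrite !inE => vA vx vy nxy; apply/half_relP; split=> //; exists v.
have dE x y : degree half_rel x = degree half_rel y.
  by have [g /aut_setP gG <-] := tr x y; rewrite degree_perm.
have nbrB (x : TB) : exists2 v, v \in A & x \in block v.
  have [v evx] := nbr (val x); rewrite se.2 in evx; exists v; last by rewrite inE.
  by rewrite (bip evx); exact: (valP x).
have sub_nb v x : v \in A -> x \in block v -> block v :\ x \subset [set y | half_rel x y].
  move=> vA xv; apply/subsetP => y /setD1P[yx yv]; rewrite inE.
  by apply: (clique v) => //; rewrite eq_sym.
have cD v x : v \in A -> x \in block v -> (#|block v :\ x|.+1 = p)%N.
  by move=> vA xv; rewrite -(block_card vA) (cardsD1 x (block v)) xv.
(* Degree 2 leaves room for one block only: it is closed under adjacency, hence everything, and the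
   half graph is complete. *)
have d3 x : (3 <= degree half_rel x)%N.
  rewrite ltnNge; apply/negP => d2; apply: nc; have [v vA xv] := nbrB x.
  have bT : block v = setT.
    apply: (connected_closed half_connected xv) => a b av ab.
    have /eqP eN : block v :\ a == [set y | half_rel a y].
      rewrite eqEcard sub_nb //= -/(degree half_rel a) (dE a x).
      by rewrite -ltnS (cD v a vA av); exact: leq_ltn_trans d2 p3.
    by have : b \in block v :\ a by [rewrite eN inE]; case/setD1P.
  by move=> a b nab; apply: (clique v) => //; rewrite bT inE.
apply: (@vertex_transitive_rigid R TB half_rel half_simple half_connected
   (aut_group half_rel) [set block v | v in A]) => //.
- by move=> g /aut_setP.
- move=> h h' /imsetP[v vA ->] /imsetP[w wA ->].
  have [g gG gvw] := trA vA wA; have [g' g'G hg'] := half_perm gG; exists g' => //.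
  have ge := Ge gG.
  apply/setP => y; rewrite inE; apply/imsetP/idP => [[x]|ewy].
    by rewrite inE => evx ->; rewrite hg' -gvw ge.
  exists ((g'^-1)%g y); rewrite ?permKV // inE -ge -hg' permKV gvw //.
- by move=> h x y /imsetP[v vA ->]; apply: clique.
- move=> x y /blockP[v vA /andP[xv yv]]; exists (block v); split=> //; exact: imset_f.
- left; have [x] : exists x : TB, true.
    apply: contrapT => h; apply: nc => x; by case: h; exists x.
  have [v vA xv] := nbrB x; exists (block v); first exact: imset_f.
  by rewrite block_card.
Qed.

(** Distances spread from the half graph to all pairs outside [A], then to mixed pairs, then to
    pairs inside [A]; the last two passages use that distances to three non-collinear points locate
    a point. *)
Lemma bip_globally_rigid : globally_rigid R e.
Proof.
have [r gr] := generic_realisation R T; exists r; split=> // q' eqv.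
have eq := equiv_len eqv.
have eqE x y : e x y -> d2 q' x y = d2 r x y.
  by move=> exy; apply/esym/dist_eq; apply: eqv.
have trE x y u v : e x y -> e u v -> x \in A -> u \in A -> exists2 g, g \in G & g x = u /\ g y = v.
  move=> exy euv xA uA; have [g [ga gxy]] := et exy euv.
  have gG : g \in G by apply/aut_setP.
  exists g => //; case: gxy => // -[gx gy].
  by have := GA x gG; rewrite gx xA => vA; move: (bip euv); rewrite uA vA.
have rigA v : v \in A -> crigid (edges e) (setT :\ v).
  exact: (@bipartite_rigid R T e se ce G A p q Ge GA trA trB bip trE degA degB p3 pq v cntE).
have pick v : v \in A -> exists a b c, [/\ e v a, e v b, e v c & [/\ a != b, a != c & b != c]].
  move=> vA; have := deg3 v => /card_gt2P[a [b [c [[av bv cv] [ab bc ca]]]]].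
  rewrite !inE in av bv cv; exists a, b, c; split=> //; split=> //; by rewrite eq_sym.
have congN v a b : v \in A -> e v a -> e v b -> d2 q' a b = d2 r a b.
  move=> vA va vb; have [->|nab] := eqVneq a b; first by rewrite !d2xx.
  have [c vc [ca cb]] : exists2 c, e v c & c != a /\ c != b.
    have [x [y [z [vx vy vz [xy xz yz]]]]] := pick v vA.
    have [xa|xa] := eqVneq x a; last first.
      have [xb|xb] := eqVneq x b; last by exists x.
      have [ya|ya] := eqVneq y a; last by exists y => //; split=> //; rewrite -xb eq_sym.
      by exists z => //; rewrite -ya -xb ![z == _]eq_sym yz xz.
    have [yb|yb] := eqVneq y b; last by exists y => //; split=> //; rewrite -xa eq_sym.
    by exists z => //; rewrite -xa -yb ![z == _]eq_sym yz xz.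
  have inW y : e v y -> y \in setT :\ v by move/(edge_neq se); rewrite !inE andbT eq_sym.
  apply: (@neighbours_congruent R T r v gr (edges e) (setT :\ v) q' a b c) => //;
    do ?[exact: inW|exact: eqE|exact: rigA]; do ?[by rewrite eq_sym].
  - exact: edges_edge_set.
  - by rewrite !inE eqxx.
  - by move=> h; rewrite inE => /andP[hE _]; apply: eq; rewrite inE hE subsetT.
have congB x y : x \notin A -> y \notin A -> d2 q' x y = d2 r x y.
  move=> xA yA; have [->|nxy] := eqVneq x y; first by rewrite !d2xx.
  have half (s t : TB) : half_rel s t -> d2 q' (val s) (val t) = d2 r (val s) (val t).
    by case/half_relP=> _ [v [vA vs vt]]; apply: congN vs vt.
  pose x' : TB := exist _ x xA; pose y' : TB := exist _ y yA.
  have [hc|nc] := pselect (complete_graph half_rel).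
    by apply: (half x' y'); apply: hc.
  have imD (u : TB) : val @: (setT :\ u) = ~: A :\ val u.
    apply/setP => z; rewrite !inE; apply/imsetP/andP => [[t]|[zu zA]].
      rewrite !inE andbT => tu ->; split; last exact: (valP t).
      by rewrite (inj_eq val_inj).
    by exists (exist _ z zA) => //; rewrite !inE andbT -(inj_eq val_inj).
  have hs := edges_edge_set half_simple.
  have E2 : edge_set (valF (edges half_rel)).
    by move=> h /imsetP[h0 /hs h2 ->]; rewrite card_imset //; exact: val_inj.
  apply: (@vertex_redundant_rigid R T r (valF (edges half_rel)) (~: A) q' gr E2); rewrite ?inE //.
  (* With at most three vertices outside [A], one block would contain them all and the half graph
     would be complete. *)
  - have [v evx] := nbr x; rewrite se.2 in evx.
    have vA : v \in A by rewrite (bip evx).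
    have cB : #|~: A| = #|[set: TB]|.
      rewrite -(card_imset _ val_inj); apply: eq_card => z; rewrite inE.
      apply/idP/imsetP => [zA|[t _ ->]]; last exact: (valP t).
      by exists (exist _ z zA).
    rewrite cB ltnNge; apply/negP => B3; apply: nc.
    have bT : block v = setT.
      apply/eqP; rewrite eqEcard subsetT block_card //; exact: leq_trans B3 p3.
    move=> s t nst; apply/half_relP; split=> //; exists v.
    have := in_setT s; have := in_setT t; rewrite -bT !inE //.
  - move=> u; rewrite inE => uA.
    rewrite -[u]/(val (exist (fun x => x \notin A) u uA : TB)) -imD.
    by apply: crigid_val; apply: half_rigid.
  - move=> h; rewrite inE => /andP[/imsetP[h0 /edgesP[s [t [st ->]]] ->] _].
    by rewrite imsetU1 imset_set1 !len2; apply: half.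
have congAB v y : v \in A -> y \notin A -> d2 q' v y = d2 r v y.
  move=> vA yA; have [a [b [c [va vb vc [ab ac bc]]]]] := pick v vA.
  have [aA bA cA] : [/\ a \notin A, b \notin A & c \notin A].
    by rewrite -(bip va) -(bip vb) -(bip vc).
  apply: (anchors (generic_cross_neq0 gr ab ac bc)).
  - by move=> s t; rewrite !inE => /orP[/orP[]|]/eqP-> /orP[/orP[]|]/eqP->; apply: congB.
  - by move=> s; rewrite !inE => /orP[/orP[]|]/eqP->; apply: eqE.
  - by move=> s; rewrite !inE => /orP[/orP[]|]/eqP->; apply: congB.
have congAA v w : v \in A -> w \in A -> d2 q' v w = d2 r v w.
  move=> vA wA; have [a [b [c [va vb vc [ab ac bc]]]]] := pick v vA.
  have [aA bA cA] : [/\ a \notin A, b \notin A & c \notin A].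
    by rewrite -(bip va) -(bip vb) -(bip vc).
  apply: (anchors (generic_cross_neq0 gr ab ac bc)).
  - by move=> s t; rewrite !inE => /orP[/orP[]|]/eqP-> /orP[/orP[]|]/eqP->; apply: congB.
  - by move=> s; rewrite !inE => /orP[/orP[]|]/eqP->; apply: eqE.
  - by move=> s; rewrite !inE => /orP[/orP[]|]/eqP->; apply: congAB.
move=> x y; apply/esym/dist_eq.
have [xA|xA] := boolP (x \in A); have [yA|yA] := boolP (y \in A).
- exact: congAA.
- exact: congAB.
- by rewrite d2C [RHS]d2C; apply: congAB.
- exact: congB.
Qed.

End Bip.

(** Every vertex lies on an edge, so the two ends of one edge represent all orbits. [A] is the orbit
    of the end with the smaller degree. *)
Lemma edge_transitive_orbits : (forall x y, exists2 g, g \in G & g x = y) \/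
  exists A : {set T}, exists p q : nat,
  [/\ forall g x, g \in G -> (g x \in A) = (x \in A),
      forall x y, x \in A -> y \in A -> exists2 g, g \in G & g x = y,
      forall x y, x \notin A -> y \notin A -> exists2 g, g \in G & g x = y,
      forall x y, e x y -> (x \in A) = (y \notin A)
    & [/\ forall x, x \in A -> degree e x = p, forall x, x \notin A -> degree e x = q &
         (p <= q)%N]].
Proof.
have [[x0 _]|h] := pselect (exists x : T, true); last by left=> x; case: h; exists x.
have [y0 e0] := nbr x0.
pose orb x : {set T} := [set y | [exists g in G, g x == y]].
have orbP x y : reflect (exists2 g, g \in G & g x = y) (y \in orb x).
  rewrite inE; apply: (iffP existsP) => [[g /andP[gG /eqP gxy]]|[g gG gxy]]; first by exists g.
  by exists g; rewrite gG gxy eqxx.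
have orb_sym x y : y \in orb x -> x \in orb y.
  by move/orbP=> [g gG <-]; apply/orbP; exists (g^-1)%g; rewrite ?permK // groupV.
have orb_tr x y z : y \in orb x -> z \in orb y -> z \in orb x.
  by move=> /orbP[f fG <-] /orbP[g gG <-]; apply/orbP; exists (f * g)%g; rewrite ?permM // groupM.
have cases u v : e u v -> (u \in orb x0 /\ v \in orb y0) \/ (u \in orb y0 /\ v \in orb x0).
  move=> euv; have [g [/aut_setP gG [[gx gy]|[gx gy]]]] := et e0 euv.
    by left; split; apply/orbP; exists g.
  by right; split; apply/orbP; exists g.
have [h|h] := boolP (y0 \in orb x0).
  left=> x y; apply/orbP; have all z : z \in orb x0.
    have [w /cases[[]|[h1 _]]] := nbr z => //; exact: orb_tr h h1.
  exact: orb_tr (orb_sym _ _ (all x)) (all y).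
right.
have cover z : z \in orb x0 \/ z \in orb y0.
  by have [w /cases[[]|[]]] := nbr z; [left|right].
have disj z : z \in orb x0 -> z \in orb y0 -> False.
  by move=> h1 h2; case/negP: h; exact: orb_tr h1 (orb_sym _ _ h2).
have main x y : e x y -> (degree e x <= degree e y)%N -> (forall z, z \in orb x \/ z \in orb y) ->
    (forall z, z \in orb x -> z \in orb y -> False) ->
    (forall u v, e u v -> (u \in orb x /\ v \in orb y) \/ (u \in orb y /\ v \in orb x)) ->
  exists A : {set T}, exists p q : nat,
  [/\ forall g x, g \in G -> (g x \in A) = (x \in A),
      forall x y, x \in A -> y \in A -> exists2 g, g \in G & g x = y,
      forall x y, x \notin A -> y \notin A -> exists2 g, g \in G & g x = y,
      forall x y, e x y -> (x \in A) = (y \notin A)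
    & [/\ forall x, x \in A -> degree e x = p, forall x, x \notin A -> degree e x = q &
         (p <= q)%N]].
  move=> exy dxy cov dis cs; exists (orb x), (degree e x), (degree e y); split.
  - move=> g z gG; apply/idP/idP => hz.
      by apply: orb_tr hz _; apply: orb_sym; apply/orbP; exists g.
    by apply: orb_tr hz _; apply/orbP; exists g.
  - by move=> u v ux vx; apply/orbP; exact: orb_tr (orb_sym _ _ ux) vx.
  - move=> u v; case: (cov u) => [->//|uy] _; case: (cov v) => [->//|vy] _.
    by apply/orbP; exact: orb_tr (orb_sym _ _ uy) vy.
  - move=> u v /cs[[ux vy]|[uy vx]].
      by rewrite ux; apply/esym/negP => /dis/(_ vy).
    by rewrite vx /=; apply/negP => /dis/(_ uy).
  - split=> // z; first by case/orbP=> g /Ge ga <-; rewrite degree_perm.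
    by case: (cov z) => [->//|] /orbP[g /Ge ga <-] _; rewrite degree_perm.
have [d|/ltnW d] := leqP (degree e x0) (degree e y0); first exact: main cases.
apply: main d _ _ _; first by rewrite se.2.
- by move=> z; case: (cover z); [right|left].
- by move=> z h1 h2; exact: disj h2 h1.
- by move=> u v /cases[]; [right|left].
Qed.

Theorem sufficiency : ~ complete_graph e -> globally_rigid R e.
Proof.
move=> nc; case: edge_transitive_orbits => [tr|[A [p [q [GA trA trB bip [dA dB pq]]]]]].
  exact: vt_globally_rigid.
have [x0 _] : exists x : T, true by apply: contrapT => h; apply: nc => x; case: h; exists x.
have p3 : (3 <= p)%N.
  have [y exy] := nbr x0; have := bip _ _ exy; have [xA|xA] := boolP (x0 \in A).
    by rewrite -(dA _ xA).
  by move/esym/negbFE => yA; rewrite -(dA _ yA).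
exact: (bip_globally_rigid GA trA trB bip dA dB p3 pq).
Qed.

End Sufficiency.


(** * Necessity: rigidity and minimum degree *)

Section Perturb.
Variables (R : realType) (T : finType).
Implicit Types (p q : realisation R T).

Lemma d2_continuous p (eps : R) : 0 < eps -> exists2 eta : R, 0 < eta &
  forall q, (forall x k, `|q x k - p x k| <= eta) -> forall x y, `|d2 q x y - d2 p x y| < eps.
Proof.
move=> eps0; pose M := \sum_x \sum_y \sum_k `|p x k - p y k|.
have M0 : 0 <= M by apply: sumr_ge0 => x _; apply: sumr_ge0 => y _; apply: sumr_ge0.
have leM x y k : `|p x k - p y k| <= M.
  rewrite /M (bigD1 x) //= (bigD1 y) //= (bigD1 k) //= -!addrA lerDl.
  by do ?[apply: addr_ge0]; do ?[apply: sumr_ge0 => *]; do ?[apply: sumr_ge0 => *];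
     do ?[apply: sumr_ge0 => *].
(* One unit above the constant [8 * M + 8] of the estimate, to make it strict. *)
have C0 : 0 < 8 * M + 9 by lra.
pose eta := Num.min 1 (eps / (8 * M + 9)).
have eta0 : 0 < eta by rewrite lt_min ltr01 divr_gt0.
have eta1 : eta <= 1 by rewrite ge_min lexx.
have etaC : (8 * M + 9) * eta <= eps.
  by rewrite mulrC -ler_pdivlMr // ge_min lexx orbT.
exists eta => // q hq x y.
have bnd k : `|(q x k - q y k) ^+ 2 - (p x k - p y k) ^+ 2| <= (4 * M + 4) * eta.
  set b := (q x k - p x k) - (q y k - p y k).
  have hb : `|b| <= 2 * eta.
    by apply: le_trans (ler_normB _ _) _; have := hq x k; have := hq y k; lra.
  have -> : (q x k - q y k) ^+ 2 - (p x k - p y k) ^+ 2 = b * (2 * (p x k - p y k) + b).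
    by rewrite /b; ring.
  rewrite normrM; apply: (@le_trans _ _ (2 * eta * (2 * M + 2))); last by lra.
  apply: ler_pM => //; apply: le_trans (ler_normD _ _) _.
  rewrite normrM (@ger0_norm _ 2) //; have := leM x y k; lra.
apply: (@le_lt_trans _ _ ((8 * M + 8) * eta)); last by lra.
have -> : d2 q x y - d2 p x y = ((q x 0 - q y 0) ^+ 2 - (p x 0 - p y 0) ^+ 2) +
   ((q x 1 - q y 1) ^+ 2 - (p x 1 - p y 1) ^+ 2) by rewrite /d2; ring.
apply: le_trans (ler_normD _ _) _; have := bnd 0; have := bnd 1; lra.
Qed.

Lemma isolated_value (s : seq R) (x : R) : exists2 eps : R, 0 < eps &
  forall r, r \in s -> `|r - x| < eps -> r = x.
Proof.
elim: s => [|y s [eps eps0 ih]]; first by exists 1.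
have [->|nyx] := eqVneq y x.
  by exists eps => // r; rewrite inE => /predU1P[->|/ih].
exists (Num.min eps `|y - x|); first by rewrite lt_min eps0 normr_gt0 subr_eq0.
move=> r; rewrite inE lt_min => /predU1P[->|/ih h] /andP[h1 h2]; last exact: h.
by rewrite ltxx in h2.
Qed.

Lemma common_bound (I : eqType) (s : seq I) (f : I -> R) : (forall i, 0 < f i) ->
  exists2 eps : R, 0 < eps & forall i, i \in s -> eps <= f i.
Proof.
move=> f0; elim: s => [|i s [eps eps0 ih]]; first by exists 1.
exists (Num.min eps (f i)); first by rewrite lt_min eps0 f0.
by move=> j; rewrite inE ge_min => /predU1P[->|/ih->]; rewrite ?lexx ?orbT.
Qed.

End Perturb.

Section Necessity.
Variables (R : realType) (T : finType) (e : rel T).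
Hypotheses (se : simple_graph e).

(** A pair [h] not spanned by a basis [F] of the edges can change its length while [F] keeps its
    own. The other edges are algebraic over [F], so they have finitely many possible lengths, and
    under a small flex they keep theirs by continuity. *)
Lemma globally_rigid_crigid : globally_rigid R e -> crigid (edges e) setT.
Proof.
move=> [p [gp grp]]; apply: contrapT => nr.
have E2 := edges_edge_set se.
have [F [sFE iF sF]] := basis_exists (len p) (edges e).
have [h [hT nh]] : exists h, h \in pairs setT /\ ~ aspan (len p) F h.
  apply: contrapT => k; apply: nr; apply: (aspan_crigid gp E2) => h hT.
  have -> : restr (edges e) setT = edges e by apply/setP => g; rewrite inE subsetT andbT.
  apply: aspan_sub sFE _; apply: contrapT => nh; apply: k; by exists h.
have iFh := indepU1 iF nh.
have Fh2 : edge_set (h |: F).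
  move=> g /setU1P[->|/(subsetP sFE)/E2//]; by move: hT; rewrite inE => /andP[/eqP].
have sFh : stressfree (h |: F) p by apply: laman => //; apply: indep_sparse iFh.
have /choice[eps heps] (g : {set T}) : exists eps : R, 0 < eps /\ (g \in edges e ->
    forall q, (forall k, k \in F -> len q k = len p k) -> `|len q g - len p g| < eps -> len q g = len p g).
  have [gE|_] := boolP (g \in edges e); last by exists 1.
  have [P nP rP] := relation_transfer gp (sF g gE).
  have [s hs] := poly_roots_finite nP; have [eps eps0 he] := isolated_value s (len p g).
  by exists eps; split=> // _ q hq; apply: he; apply: hs; apply: rP.
have [del del0 hdel] := common_bound (enum (edges e)) (fun g => (heps g).1).
have [eta eta0 heta] := d2_continuous p del0.
have [t t0 ht] := local_flex h Fh2 sFh eta0.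
have [|q [near sameF hq]] := ht t; first by rewrite ger0_norm // ltW.
have nF k : k \in F -> k != h by move=> kF; apply: contra_notN nh => /eqP <-; apply: aspan_in.
have qF k : k \in F -> len q k = len p k by move=> kF; apply: sameF; rewrite ?setU1r // nF.
have eqv : equivalent e p q.
  move=> x y exy; apply/dist_eq; rewrite -!len2.
  have xyE : [set x; y] \in edges e by rewrite in_edges.
  apply/esym; apply: ((heps [set x; y]).2 xyE) => //; rewrite !len2.
  apply: lt_le_trans (heta q near x y) _; apply: hdel; by rewrite mem_enum.
have [x [y [_ _ _ eh]]] := pairsP hT.
have := grp q eqv x y; move/dist_eq; rewrite -!len2 -eh hq ?setU11 // => k.
by move: t0; rewrite (_ : t = 0) ?ltxx //; lra.
Qed.

Lemma globally_rigid_card : globally_rigid R e -> (2 * #|T| <= #|edges e| + 3)%N.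
Proof.
move=> /globally_rigid_crigid[F [sFE _ cF]].
have := subset_leq_card sFE; have := subset_leq_card (restr_sub (edges e) setT).
by rewrite cF cardsT; move: #|restr _ _| #|edges e| #|T|; clear; lia.
Qed.

Hypothesis ce : connected_graph e.

Lemma reflection_not_rigid v a b c : v != a -> v != b -> a != b ->
  c != v -> c != a -> c != b ->
  (forall y, e v y -> y \in [set a; b]) -> ~ globally_rigid R e.
Proof.
move=> va vb ab cv ca cb hN [p [gp grp]].
set n0 := - (p b 1 - p a 1); set n1 := p b 0 - p a 0.
pose q : realisation R T := fun x k => if x == v then
  p v k - 2 * (cross p a b v / d2 p a b) * (if k == 0 then n0 else n1) else p x k.
have nd := generic_d2_neq0 gp ab.
have qE x k : x != v -> q x k = p x k by rewrite /q => /negPf->.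
have q0 : q v 0 = p v 0 - 2 * (cross p a b v / d2 p a b) * n0 by rewrite /q eqxx.
have q1 : q v 1 = p v 1 - 2 * (cross p a b v / d2 p a b) * n1 by rewrite /q eqxx.
(* Reflecting [v] in the line [ab] changes its squared distance to [z] by four times the product of
   the signed distances of [v] and [z] to the line. *)
have key z : z != v -> d2 q v z - d2 p v z = 4 * (cross p a b v * cross p a b z) / d2 p a b.
  move=> zv; apply: (mulIf nd); rewrite divfK //.
  rewrite /(d2 q) !(qE z) // q0 q1 /n0 /n1.
  set t := cross p a b v / d2 p a b.
  have et : cross p a b v = t * d2 p a b by rewrite /t divfK.
  rewrite [cross p a b v]et.
  have -> : cross p a b z = cross p a b v - ((p b 0 - p a 0) * (p v 1 - p z 1) - (p b 1 - p a 1) * (p v 0 - p z 0)).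
    by rewrite /cross; ring.
  rewrite et /d2; ring.
have eqv : equivalent e p q.
  have hv y : e v y -> d2 p v y = d2 q v y.
    move=> evy; have yv : y != v by rewrite eq_sym (edge_neq se evy).
    apply/esym/eqP; rewrite -subr_eq0 key //.
    have -> : cross p a b y = 0 by move: (hN y evy) => /set2P[]->; rewrite /cross; ring.
    by rewrite mulr0 mulr0 mul0r.
  move=> x y exy; apply/dist_eq.
  have [ex|xv] := eqVneq x v; first by rewrite ex; apply: hv; rewrite -ex.
  have [ey|yv] := eqVneq y v; first by rewrite ey d2C [RHS]d2C; apply: hv; rewrite -ey se.2.
  by rewrite /d2 !qE.
have /dist_eq h := grp q eqv v c; move/eqP: (key c cv); rewrite h subrr eq_sym.
rewrite !mulf_eq0 invr_eq0 (negPf nd) orbF pnatr_eq0 /=.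
rewrite (negPf (generic_cross_neq0 gp ab _ _)) ?[_ == v]eq_sym //.
by rewrite (negPf (generic_cross_neq0 gp ab _ _)) // eq_sym.
Qed.

Lemma pendant_not_rigid v a c : v != a -> c != v -> c != a ->
  (forall y, e v y -> y = a) -> ~ globally_rigid R e.
Proof.
move=> va cv ca hN [p [gp grp]].
(* Mirror image of [v] in the horizontal line through [a]; three vertices suffice for it. *)
pose q : realisation R T := fun x k => if (x == v) && (k == 1) then 2 * p a 1 - p v 1 else p x k.
have qE x k : x != v -> q x k = p x k by rewrite /q => /negPf->.
have q0 : q v 0 = p v 0 by rewrite /q andbF.
have q1 : q v 1 = 2 * p a 1 - p v 1 by rewrite /q eqxx.
have eqv : equivalent e p q.
  have hv y : e v y -> d2 p v y = d2 q v y.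
    by move/hN=> ->; rewrite /d2 !(qE a) 1?eq_sym // q0 q1; ring.
  move=> x y exy; apply/dist_eq.
  have [ex|xv] := eqVneq x v; first by rewrite ex; apply: hv; rewrite -ex.
  have [ey|yv] := eqVneq y v; first by rewrite ey d2C [RHS]d2C; apply: hv; rewrite -ey se.2.
  by rewrite /d2 !qE.
have /dist_eq h := grp q eqv v c.
have ndiff x y : x != y -> p x 1 - p y 1 != 0.
  move=> nxy; apply: (@generic_neq0 _ _ p gp (fun p => p x 1 - p y 1) (fun z _ => (z == x)%:R)).
    by apply: ratfunB; apply: ratfun_proj.
  by rewrite eqxx [y == x]eq_sym (negPf nxy) subr0 oner_eq0.
have : (p a 1 - p v 1) * (p a 1 - p c 1) != 0.
  by rewrite mulf_neq0 // ndiff // eq_sym.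
case/negP; apply/eqP; move: h; rewrite /d2 !(qE c) // q0 q1 => h; lra.
Qed.

Lemma globally_rigid_degree : globally_rigid R e -> ~ complete_graph e ->
  forall v, (3 <= degree e v)%N.
Proof.
move=> gr nc v; rewrite ltnNge; apply/negP => d2v.
have [T4|T3] := leqP 4 #|T|.
  (* Fewer than two neighbours are padded by arbitrary vertices. *)
  have [a [b [ab av bv hN]]] : exists a b, [/\ a != b, a \in [set~ v], b \in [set~ v] &
      [set y | e v y] \subset [set a; b]].
    have NV : [set y | e v y] \subset [set~ v].
      by apply/subsetP => y; rewrite !inE => /(edge_neq se); rewrite eq_sym.
    have cV : (3 <= #|[set~ v]|)%N by rewrite cardsC1; move: T4; clear; lia.
    have [N2|N1] := leqP 2 #|[set y | e v y]|.
      have /cards2P[a [b [ab eN]]] : #|[set y | e v y]| == 2%N by rewrite eqn_leq N2 andbT.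
      exists a, b; rewrite eN subxx; split=> //; apply: (subsetP NV); rewrite eN ?set21 ?set22 //.
    have [N0|[a aN]] := set_0Vmem [set y | e v y].
      have /card_gt1P[a [b [aV bV ab]]] : (1 < #|[set~ v]|)%N by apply: ltnW.
      by exists a, b; rewrite N0 sub0set.
    have /card_gt0P[b bV] : (0 < #|[set~ v] :\ a|)%N.
      by have := cardsD1 a [set~ v]; rewrite (subsetP NV) //; move: cV; clear; lia.
    case/setD1P: bV => ba bV; exists a, b; split=> //; first by rewrite eq_sym.
      exact: (subsetP NV).
    apply/subsetP => y yN; rewrite !inE; apply/orP; left.
    by move/card_le1P: N1 => /(_ a aN y); rewrite yN inE => /esym.
  rewrite !inE in av bv.
  have /card_gt0P[c] : (0 < #|~: [set v; a; b]|)%N.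
    have := cardsC [set v; a; b]; have : (#|[set v; a; b]| <= 3)%N.
      by rewrite -setUA !cardsU1 cards1; do 2!case: (_ \notin _).
    by move: T4; clear; lia.
  rewrite !inE !negb_or => /andP[/andP[cv ca] cb].
  apply: (@reflection_not_rigid v a b c) gr => //; do ?[by rewrite eq_sym].
  by move=> y evy; apply: (subsetP hN); rewrite inE.
have [x [y [nxy nexy]]] : exists x y, x != y /\ ~~ e x y.
  apply: contrapT => h; apply: nc => x y nxy; apply: contraT => nexy.
  by case: h; exists x, y.
have [z exz] : exists z, e x z.
  have /connectP[[|z s] /=] := ce x y; first by move=> _ eyx; rewrite eyx eqxx in nxy.
  by case/andP=> exz _ _; exists z.
have yz : y != z by apply: contraNneq nexy => ->.
apply: (@pendant_not_rigid x z y) gr; rewrite ?(edge_neq se exz) // 1?eq_sym //.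
move=> w exw; apply/eqP; apply: contraT => wz.
have : (#|[set x; y; z; w]| <= #|T|)%N by rewrite -cardsT subset_leq_card // subsetT.
rewrite -!setUA !cardsU1 cards1 !inE !negb_or nxy yz (edge_neq se exz) (edge_neq se exw).
rewrite [z == w]eq_sym wz.
have -> : y != w by apply: contraNneq nexy => ->.
by move: T3; clear; lia.
Qed.

End Necessity.


(** * The complete bipartite graph on 3 + 3 vertices *)

Section Tends.
Variables (R : realType) (X : Type) (near : R -> X -> Prop).
Hypothesis near_mono : forall d d' x, d <= d' -> near d x -> near d' x.

(** Limits along an abstract scale of neighbourhoods, used both on the real line and for pairs of a
    realisation and a perturbation. *)
Definition tends (f : X -> R) (l : R) := forall eps, 0 < eps ->
  exists2 d, 0 < d & forall x, near d x -> `|f x - l| < eps.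

Lemma tendsC c : tends (fun=> c) c.
Proof. by move=> eps e0; exists 1 => // x _; rewrite subrr normr0. Qed.

Lemma near_and (P Q : X -> Prop) : (exists2 d, 0 < d & forall x, near d x -> P x) ->
  (exists2 d, 0 < d & forall x, near d x -> Q x) ->
  exists2 d, 0 < d & forall x, near d x -> P x /\ Q x.
Proof.
move=> [d d0 hd] [d' d'0 hd']; exists (Num.min d d'); first by rewrite lt_min d0.
by move=> x nx; split; [apply: hd|apply: hd']; apply: near_mono nx; rewrite ge_min lexx ?orbT.
Qed.

Lemma tendsD f g l m : tends f l -> tends g m -> tends (fun x => f x + g x) (l + m).
Proof.
move=> hf hg eps e0; have e2 : 0 < eps / 2 by rewrite divr_gt0.
have [d d0 hd] := near_and (hf _ e2) (hg _ e2); exists d => // x /hd[h1 h2].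
have -> : f x + g x - (l + m) = (f x - l) + (g x - m) by ring.
by apply: le_lt_trans (ler_normD _ _) _; lra.
Qed.

Lemma tendsM f g l m : tends f l -> tends g m -> tends (fun x => f x * g x) (l * m).
Proof.
move=> hf hg eps e0; pose K := `|l| + `|m| + 1.
have K0 : 0 < K by rewrite /K; have := normr_ge0 l; have := normr_ge0 m; lra.
pose d1 := Num.min 1 (eps / (2 * K)).
have d10 : 0 < d1 by rewrite lt_min ltr01 divr_gt0 // mulr_gt0.
have d11 : d1 <= 1 by rewrite ge_min lexx.
have d1K : d1 * (2 * K) <= eps by rewrite -ler_pdivlMr ?mulr_gt0 // ge_min lexx orbT.
have [d d0 hd] := near_and (hf _ d10) (hg _ d10); exists d => // x /hd[h1 h2].
have -> : f x * g x - l * m = (f x - l) * (g x - m) + (f x - l) * m + l * (g x - m) by ring.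
apply: le_lt_trans (ler_normD _ _) _; rewrite normrM.
have h3 := ler_normD ((f x - l) * (g x - m)) ((f x - l) * m); rewrite !normrM in h3.
have a1 : `|f x - l| * `|g x - m| <= d1 * 1.
  by apply: ler_pM => //; [exact: ltW|apply: ltW; apply: lt_le_trans h2 d11].
have a2 : `|f x - l| * `|m| <= d1 * `|m| by rewrite ler_wpM2r // ltW.
have a3 : `|l| * `|g x - m| <= d1 * `|l| by rewrite mulrC ler_wpM2r // ltW.
have e4 : d1 * (2 * K) = 2 * (d1 * `|l| + d1 * `|m| + d1) by rewrite /K; ring.
have p1 : 0 <= d1 * `|l| by rewrite mulr_ge0 // ltW.
have p2 : 0 <= d1 * `|m| by rewrite mulr_ge0 // ltW.
lra.
Qed.

Lemma tendsN f l : tends f l -> tends (fun x => - f x) (- l).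
Proof. by move=> h eps /h[d d0 hd]; exists d => // x /hd; rewrite -opprD normrN. Qed.

Lemma tendsB f g l m : tends f l -> tends g m -> tends (fun x => f x - g x) (l - m).
Proof. by move=> hf hg; apply: tendsD => //; apply: tendsN. Qed.

(** The squared difference of two roots is at most the difference of the radicands, also for
    negative radicands, whose root is 0. *)
Lemma tends_sqrt f l : tends f l -> tends (fun x => Num.sqrt (f x)) (Num.sqrt l).
Proof.
move=> h eps e0; have e2 : 0 < eps ^+ 2 by rewrite exprn_gt0.
have [d d0 hd] := h _ e2; exists d => // x /hd hx.
rewrite -ltr_sqr ?nnegrE ?(ltW e0) // real_normK ?num_real //.
apply: le_lt_trans hx.
have [f0|f0] := lerP 0 (f x); have [l0|l0] := lerP 0 l.
- set a := Num.sqrt (f x); set b := Num.sqrt l.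
  have [a0 b0] : 0 <= a /\ 0 <= b by rewrite !sqrtr_ge0.
  have -> : f x = a ^+ 2 by rewrite sqr_sqrtr.
  have -> : l = b ^+ 2 by rewrite sqr_sqrtr.
  rewrite subr_sqr normrM -[leLHS]ger0_norm ?sqr_ge0 // expr2 normrM ler_wpM2l //.
  by rewrite (ger0_norm (addr_ge0 a0 b0)) ler_norml; lra.
- by rewrite (ler0_sqrtr (ltW l0)) subr0 sqr_sqrtr // ger0_norm; lra.
- by rewrite (ler0_sqrtr (ltW f0)) sub0r sqrrN sqr_sqrtr // ler0_norm; lra.
- rewrite (ler0_sqrtr (ltW l0)) (ler0_sqrtr (ltW f0)) subrr expr0n /=; exact: normr_ge0.
Qed.

Lemma tends_sign f l : tends f l -> l != 0 -> exists2 d, 0 < d & forall x, near d x -> 0 < f x * l.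
Proof.
move=> h l0; have [|d d0 hd] := h `|l|; first by rewrite normr_gt0.
exists d => // x /hd; rewrite ltr_distl => /andP[h1 h2].
have [lp|ln|l00] := ltrgt0P l; last by rewrite l00 eqxx in l0.
- by rewrite gtr0_norm // in h1 h2; rewrite mulr_gt0 //; lra.
- by rewrite ltr0_norm // in h1 h2; rewrite nmulr_lgt0 //; lra.
Qed.

End Tends.

Section RealSign.
Variable R : realType.

Definition near_real (t0 d t : R) := `|t - t0| <= d.

Lemma near_real_mono t0 d d' t : d <= d' -> near_real t0 d t -> near_real t0 d' t.
Proof. by move=> h1 h2; apply: le_trans h2 h1. Qed.

(** Intermediate value theorem: at the supremum of the points with the sign of [f a], continuity
    would carry the sign further unless it is [b]. *)
Lemma constant_sign (f : R -> R) (a b : R) : a <= b ->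
  (forall t, a <= t <= b -> tends (near_real t) f (f t)) ->
  (forall t, a <= t <= b -> f t != 0) -> 0 < f a * f b.
Proof.
move=> ab cf nf.
have sq t : a <= t <= b -> 0 < f t * f t by move=> /nf h; rewrite -expr2 exprn_even_gt0.
pose A : classical_sets.set R := fun t => a <= t <= b /\ 0 < f a * f t.
have aA : A a by split; [rewrite lexx|apply: sq; rewrite lexx].
have hA : classical_sets.has_sup A.
  by split; [exists a|exists b => t [/andP[]]].
have ubA : classical_sets.ubound A (sup A) by apply: ub_le_sup; case: hA.
pose c := sup A.
have cab : a <= c <= b.
  by rewrite ubA //=; apply: ge_sup; [case: hA|move=> t [/andP[]]].
have [d d0 hd] := tends_sign (cf c cab) (nf c cab).
have fc : 0 < f a * f c.
  have [t [tA tc]] : exists t, A t /\ c - d < t.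
    have [t tA tc] := sup_adherent d0 hA; by exists t.
  have /hd h : near_real c d t.
    have := ubA t tA; rewrite /near_real ler_norml -/c; lra.
  have [tab h2] := tA.
  have : 0 < (f a * f t) * (f t * f c) by rewrite mulr_gt0.
  have -> : f a * f t * (f t * f c) = (f t * f t) * (f a * f c) by ring.
  by rewrite pmulr_rgt0 // sq.
have [cb|bc] := ltP c b; last by have -> : b = c by apply/eqP; rewrite eq_le bc /=; case/andP: cab.
pose t := Num.min (c + d) b.
have tc : c < t by rewrite lt_min cb andbT; lra.
have /andP[ac _] := cab.
have tab : a <= t <= b by rewrite ge_min lexx orbT andbT (le_trans ac (ltW tc)).
have /hd h : near_real c d t.
  by rewrite /near_real ger0_norm ?subr_ge0 ?(ltW tc) // lerBlDr addrC ge_min lexx.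
have : t <= c.
  apply: ubA; split=> //.
  have : 0 < (f a * f c) * (f t * f c) by rewrite mulr_gt0.
  have -> : f a * f c * (f t * f c) = (f c * f c) * (f a * f t) by ring.
  by rewrite pmulr_rgt0 // sq.
by rewrite leNgt tc.
Qed.

End RealSign.

(** * Zeros on a closed curve made of arcs *)

Section Arcs.
Variable R : realType.
Implicit Types (ep : {ffun 'I_3 -> bool}) (i j k l : 'I_3).

Definition flip i ep : {ffun 'I_3 -> bool} := [ffun k => ep k (+) (k == i)].

Lemma third_index i j : exists l, (l != i) && (l != j).
Proof.
have : (0 < #|~: [set i; j]|)%N.
  have := cardsC [set i; j]; rewrite cards2 card_ord.
  by move: (#|~: _|) => m; case: (_ != _); clear; lia.
by case/card_gt0P=> l; rewrite !inE negb_or => h; exists l.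
Qed.

(* The four sign classes of [ep] up to a global change of sign are the arcs of
   a closed curve, glued by [flip i] at [lo] and by [flip j] at [hi]. *)
Lemma second_zero (f : {ffun 'I_3 -> bool} -> R -> R) (lo hi t0 t1 t2 : R) ep0 i j :
  lo <= t0 <= hi ->
  (forall ep t, lo <= t <= hi -> tends (near_real t) (f ep) (f ep t)) ->
  (forall ep, f (flip i ep) lo = f ep lo) -> (forall ep, f (flip j ep) hi = f ep hi) ->
  f ep0 t0 = 0 -> lo <= t1 <= hi -> lo <= t2 <= hi -> f ep0 t1 * f ep0 t2 < 0 ->
  exists t ep, [/\ lo <= t <= hi, f ep t = 0 &
    t != t0 \/ exists k l, ep k (+) ep l != ep0 k (+) ep0 l].
Proof.
move=> t0I cf gi gj f0 t1I t2I neg; apply: contrapT => no.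
have nz t ep : lo <= t <= hi -> t != t0 \/ (exists k l, ep k (+) ep l != ep0 k (+) ep0 l) ->
  f ep t != 0 by move=> tI h; apply/eqP => ft; apply: no; exists t, ep.
have /andP[lo0 hi0] := t0I; have lohi := le_trans lo0 hi0.
have full ep : (exists k l, ep k (+) ep l != ep0 k (+) ep0 l) -> 0 < f ep lo * f ep hi.
  move=> h; apply: constant_sign => // t tI; [exact: cf|by apply: nz => //; right].
have part a b : lo <= a -> a <= b -> b <= hi -> b < t0 \/ t0 < a -> 0 < f ep0 a * f ep0 b.
  move=> la ab bh h; apply: constant_sign => // t /andP[at' tb].
    by apply: cf; rewrite (le_trans la at') (le_trans tb bh).
  apply: nz; first by rewrite (le_trans la at') (le_trans tb bh).
  by left; case: h => h; [rewrite lt_eqF // (le_lt_trans tb h)|rewrite gt_eqF // (lt_le_trans h at')].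
have nlo : lo < t0 -> f ep0 lo != 0 by move=> h; apply: nz; rewrite ?lexx //; left; rewrite lt_eqF.
(* The other arcs, having no zero, carry the sign from one end of the arc of [ep0] to the other: one
   arc if [i = j], three otherwise. *)
have same : 0 < f ep0 lo * f ep0 hi.
  have [ij|ij] := eqVneq i j.
    rewrite -gi -gj -ij; apply: full; have [l /andP[li _]] := third_index i i.
    exists i, l; rewrite !ffunE eqxx (negPf li).
    by case: (ep0 i); case: (ep0 l).
  have [l /andP[li lj]] := third_index i j.
  have h1 : 0 < f (flip i ep0) lo * f (flip i ep0) hi.
    by apply: full; exists i, l; rewrite !ffunE eqxx (negPf li); case: (ep0 i); case: (ep0 l).
  have h2 : 0 < f (flip j (flip i ep0)) lo * f (flip j (flip i ep0)) hi.
    apply: full; exists i, l; rewrite !ffunE eqxx (negPf li) (negPf lj) (negPf ij).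
    by case: (ep0 i); case: (ep0 l).
  have h3 : 0 < f (flip j ep0) lo * f (flip j ep0) hi.
    by apply: full; exists j, l; rewrite !ffunE eqxx (negPf lj); case: (ep0 j); case: (ep0 l).
  have e1 : f (flip j (flip i ep0)) lo = f (flip j ep0) lo.
    rewrite -gi; congr (f _ lo); apply/ffunP => k; rewrite !ffunE.
    by case: (ep0 k); case: (k == i); case: (k == j).
  rewrite gi in h1; rewrite e1 gj in h2; rewrite gj in h3.
  move: h1 h2 h3; set u := f ep0 lo; set v := f (flip i ep0) hi; set w := f (flip j ep0) lo.
  set z := f ep0 hi => h1 h2 h3; have nv : v != 0 by apply: contraTneq h1 => ->; rewrite mulr0 ltxx.
  have nw : w != 0 by apply: contraTneq h3 => ->; rewrite mul0r ltxx.
  have : 0 < (u * v) * (w * v) * (w * z) by rewrite mulr_gt0 // mulr_gt0.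
  have -> : u * v * (w * v) * (w * z) = (u * z) * ((v * w) ^+ 2) by ring.
  by rewrite pmulr_lgt0 // exprn_even_gt0 //= mulf_neq0.
have nt t : lo <= t <= hi -> f ep0 t != 0 -> t < t0 \/ t0 < t.
  by move=> _ h; have [?|?|e] := ltgtP t t0; [left|right|rewrite e f0 eqxx in h].
(* Points beyond [t0] reach [lo] through [hi] and [same], so [f ep0] would have one sign away from
   [t0], against [neg]. *)
have toend t : lo <= t <= hi -> f ep0 t != 0 -> 0 < f ep0 t * f ep0 lo.
  move=> tI ft; have /andP[lt th] := tI; case: (nt t tI ft) => h.
    by rewrite mulrC; apply: part => //; left.
  have h1 : 0 < f ep0 t * f ep0 hi by apply: part => //; right.
  have nh : f ep0 hi != 0 by apply: contraTneq h1 => ->; rewrite mulr0 ltxx.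
  have : 0 < (f ep0 t * f ep0 hi) * (f ep0 lo * f ep0 hi) by rewrite mulr_gt0.
  have -> : f ep0 t * f ep0 hi * (f ep0 lo * f ep0 hi) = f ep0 t * f ep0 lo * (f ep0 hi ^+ 2) by ring.
  by rewrite pmulr_lgt0 // exprn_even_gt0.
have n1 : f ep0 t1 != 0 by apply: contraTneq neg => ->; rewrite mul0r ltxx.
have n2 : f ep0 t2 != 0 by apply: contraTneq neg => ->; rewrite mulr0 ltxx.
have : 0 < (f ep0 t1 * f ep0 lo) * (f ep0 t2 * f ep0 lo) by rewrite mulr_gt0 // toend.
have -> : f ep0 t1 * f ep0 lo * (f ep0 t2 * f ep0 lo) = (f ep0 t1 * f ep0 t2) * (f ep0 lo) ^+ 2 by ring.
by rewrite ltNge mulr_le0_ge0 ?sqr_ge0 // ltW.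
Qed.

End Arcs.

(** * The equation that remains for the third point *)

Section Residue.
Variable R : realType.
Implicit Types (r s c y : 'I_3 -> R) (t : R).

(** Law of cosines: for squared distances [r i], [s i] of a point to [b0], [b1] and [t] between
    these two, the inner product of the point and [b1], both seen from [b0]. [height2] is the square
    of the cross product. Both are polynomial in [t], unlike the coordinates. *)
Definition xproj r s t (i : 'I_3) : R := (t + r i - s i) / 2.
Definition height2 r s t (i : 'I_3) : R := r i * t - xproj r s t i ^+ 2.

Definition area2 r s t y : R :=
  (xproj r s t 1 - xproj r s t 0) * (y 2 - y 0) - (y 1 - y 0) * (xproj r s t 2 - xproj r s t 0).
Definition gap r c (i : 'I_3) : R := r i - r 0 - c i + c 0.
Definition cramer0 r c y : R := (gap r c 1 * (y 2 - y 0) - gap r c 2 * (y 1 - y 0)) / 2.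
Definition cramer1 r s c t : R :=
  (gap r c 2 * (xproj r s t 1 - xproj r s t 0) - gap r c 1 * (xproj r s t 2 - xproj r s t 0)) / 2.

(* Place [b0] at the origin, [b1] at [(sqrt t, 0)] and [a_i] at
   [(x_i, y_i) / sqrt t].  The differences of the three equations for [b2] are
   linear and solved by [sqrt t (cramer0, cramer1) / area2]; the remaining
   equation is [residue = 0]. *)
Definition residue r s c t y : R :=
  t * (cramer0 r c y ^+ 2 + cramer1 r s c t ^+ 2)
  - 2 * area2 r s t y * (cramer0 r c y * xproj r s t 0 + cramer1 r s c t * y 0)
  + area2 r s t y ^+ 2 * (r 0 - c 0).

Lemma tends_residue X (near : R -> X -> Prop) r s c (ft : X -> R) t (fy : X -> 'I_3 -> R) y :
  (forall d d' x, d <= d' -> near d x -> near d' x) ->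
  tends near ft t -> (forall i, tends near (fun x => fy x i) (y i)) ->
  tends near (fun x => residue r s c (ft x) (fy x)) (residue r s c t y).
Proof.
move=> mono ht hy.
have hx i : tends near (fun x => xproj r s (ft x) i) (xproj r s t i).
  apply: tendsM => //; last exact: tendsC.
  by apply: tendsB => //; [apply: tendsD => //|]; exact: tendsC.
have ha : tends near (fun x => area2 r s (ft x) (fy x)) (area2 r s t y).
  by apply: tendsB => //; apply: tendsM => //; apply: tendsB.
have h0 : tends near (fun x => cramer0 r c (fy x)) (cramer0 r c y).
  apply: tendsM => //; last exact: tendsC.
  by apply: tendsB => //; apply: tendsM => //; [exact: tendsC|apply: tendsB|exact: tendsC|apply: tendsB].
have h1 : tends near (fun x => cramer1 r s c (ft x)) (cramer1 r s c t).
  apply: tendsM => //; last exact: tendsC.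
  by apply: tendsB => //; apply: tendsM => //; [exact: tendsC|apply: tendsB|exact: tendsC|apply: tendsB].
rewrite /residue !expr2; apply: tendsD => //; last first.
  by apply: tendsM => //; [apply: tendsM|exact: tendsC].
apply: tendsB => //.
  by apply: tendsM => //; apply: tendsD => //; apply: tendsM.
apply: tendsM => //; first by apply: tendsM => //; exact: tendsC.
by apply: tendsD => //; apply: tendsM.
Qed.

(** [low] and [high] are the squared difference and the squared sum of the two distances: the
    triangle inequalities for [t]. *)
Definition low r s (i : 'I_3) : R := r i + s i - 2 * Num.sqrt (r i * s i).
Definition high r s (i : 'I_3) : R := r i + s i + 2 * Num.sqrt (r i * s i).

Lemma height2E r s t i : 0 <= r i -> 0 <= s i ->
  4 * height2 r s t i = (t - low r s i) * (high r s i - t).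
Proof.
move=> r0 s0; rewrite /low /high; set w := Num.sqrt _.
have w2 : w ^+ 2 = r i * s i by rewrite sqr_sqrtr // mulr_ge0.
have -> : (t - (r i + s i - 2 * w)) * (r i + s i + 2 * w - t) =
  4 * w ^+ 2 - (t - (r i + s i)) ^+ 2 by ring.
by rewrite w2 /height2 /xproj; field.
Qed.

(** It is the square of the difference of the two distances. This keeps [b0] and [b1] apart along
    the whole curve. *)
Lemma low_gt0 r s i : 0 < r i -> 0 < s i -> r i != s i -> 0 < low r s i.
Proof.
move=> r0 s0 rs; rewrite /low sqrtrM ?ltW //; set u := Num.sqrt (r i); set v := Num.sqrt (s i).
have eu : r i = u ^+ 2 by rewrite sqr_sqrtr // ltW.
have ev : s i = v ^+ 2 by rewrite sqr_sqrtr // ltW.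
have -> : r i + s i - 2 * (u * v) = (u - v) ^+ 2 by rewrite eu ev; ring.
rewrite exprn_even_gt0 //= subr_eq0; apply: contraNneq rs => uv; by rewrite eu ev uv.
Qed.

Lemma height2_ge0 r s t i : 0 <= r i -> 0 <= s i ->
  (0 <= height2 r s t i) = (low r s i <= t <= high r s i).
Proof.
move=> r0 s0; rewrite -(@pmulr_rge0 _ 4) // height2E //.
have w0 : 0 <= Num.sqrt (r i * s i) by rewrite sqrtr_ge0.
have lh : low r s i <= high r s i by rewrite /low /high; lra.
apply/idP/andP => [h|[h1 h2]]; last by rewrite mulr_ge0 // subr_ge0.
split; rewrite leNgt; apply/negP => k; move: h; apply/negP; rewrite -ltNge.
  by rewrite nmulr_rlt0 ?subr_lt0 // subr_gt0 (lt_le_trans k lh).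
by rewrite pmulr_rlt0 ?subr_lt0 // subr_gt0 (le_lt_trans lh k).
Qed.

(** The largest lower and the smallest upper bound. At either end some triangle is flat, which is
    where two choices of sign meet. *)
Lemma height2_interval r s : (forall i, 0 < r i) -> (forall i, 0 < s i) ->
  exists lo hi i j, [/\ height2 r s lo i = 0, height2 r s hi j = 0,
    exists k, lo = low r s k &
    forall t, (forall k, 0 <= height2 r s t k) <-> lo <= t <= hi].
Proof.
move=> r0 s0; exists (low r s [arg max_(i > 0) low r s i]%O), (high r s [arg min_(j < 0) high r s j]%O).
case: (@arg_maxP _ _ _ 0 xpredT (low r s)) => // i _ hi.
case: (@arg_minP _ _ _ 0 xpredT (high r s)) => // j _ hj.
have n4 : (4 : R) != 0 by rewrite pnatr_eq0.
have r0' k : 0 <= r k by apply: ltW.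
have s0' k : 0 <= s k by apply: ltW.
exists i, j; split.
- by apply: (mulfI n4); rewrite height2E // subrr mul0r mulr0.
- by apply: (mulfI n4); rewrite height2E // subrr mulr0 mulr0.
- by exists i.
move=> t; split=> [h|/andP[h1 h2] k].
  have := h i; have := h j; rewrite !height2_ge0 // => /andP[_ ->] /andP[-> _] //.
by rewrite height2_ge0 // (le_trans (hi k isT)) // (le_trans _ (hj k isT)).
Qed.

End Residue.


(** * Realisations of six points and the second realisation *)

Section K33.
Variables (R : realType) (T : finType) (a b : 'I_3 -> T).
Hypotheses (a_inj : injective a) (b_inj : injective b) (ab : forall i j, a i != b j).
Implicit Types (p q : realisation R T) (i j : 'I_3).

Lemma I3P (P : 'I_3 -> Prop) : P 0 -> P 1 -> P 2 -> forall i, P i.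
Proof.
move=> h0 h1 h2 [[|[|[|//]]] lt].
- by move: h0; congr P; apply: val_inj.
- by move: h1; congr P; apply: val_inj.
- by move: h2; congr P; apply: val_inj.
Qed.

Definition place (A B : 'I_3 -> R * R) : realisation R T := fun v k =>
  let pt := if [pick i | a i == v] is Some i then A i else
            if [pick j | b j == v] is Some j then B j else (0, 0) in
  if k == 0 then pt.1 else pt.2.

Lemma place_a A B i : (place A B (a i) 0, place A B (a i) 1) = A i.
Proof.
rewrite /place; case: pickP => [j /eqP/a_inj->|/(_ i)]; last by rewrite eqxx.
by rewrite eqxx -surjective_pairing.
Qed.

Lemma place_b A B j : (place A B (b j) 0, place A B (b j) 1) = B j.
Proof.
rewrite /place; case: pickP => [i /eqP h|_]; first by have := ab i j; rewrite h eqxx.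
case: pickP => [i /eqP/b_inj->|/(_ j)]; last by rewrite eqxx.
by rewrite eqxx -surjective_pairing.
Qed.

Lemma place_a0 A B i : place A B (a i) 0 = (A i).1.
Proof. by rewrite -(place_a A B). Qed.
Lemma place_a1 A B i : place A B (a i) 1 = (A i).2.
Proof. by rewrite -(place_a A B). Qed.
Lemma place_b0 A B i : place A B (b i) 0 = (B i).1.
Proof. by rewrite -(place_b A B). Qed.
Lemma place_b1 A B i : place A B (b i) 1 = (B i).2.
Proof. by rewrite -(place_b A B). Qed.
Definition placeE := (place_a0, place_a1, place_b0, place_b1).

Definition Da p j i : R := d2 p (a i) (b j).
Definition Tb p : R := d2 p (b 0) (b 1).
Definition Yc p i : R := cross p (b 0) (b 1) (a i).

Lemma xprojE p i : xproj (Da p 0) (Da p 1) (Tb p) i =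
  (p (b 1) 0 - p (b 0) 0) * (p (a i) 0 - p (b 0) 0) + (p (b 1) 1 - p (b 0) 1) * (p (a i) 1 - p (b 0) 1).
Proof. by rewrite /xproj /Da /Tb /d2; field. Qed.

Lemma height2_cross p i : height2 (Da p 0) (Da p 1) (Tb p) i = Yc p i ^+ 2.
Proof. by rewrite /height2 xprojE /Da /Tb /Yc /cross /d2; ring. Qed.

Lemma area2E p : area2 (Da p 0) (Da p 1) (Tb p) (Yc p) = Tb p * cross p (a 0) (a 1) (a 2).
Proof. by rewrite /area2 !xprojE /Tb /Yc /cross /d2; ring. Qed.

Lemma cramer0E p : cramer0 (Da p 0) (Da p 2) (Yc p) = cross p (a 0) (a 1) (a 2) *
  ((p (b 1) 0 - p (b 0) 0) * (p (b 2) 0 - p (b 0) 0) + (p (b 1) 1 - p (b 0) 1) * (p (b 2) 1 - p (b 0) 1)).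
Proof. by rewrite /cramer0 /gap /Da /Yc /cross /d2; field. Qed.

Lemma cramer1E p : cramer1 (Da p 0) (Da p 1) (Da p 2) (Tb p) =
  cross p (a 0) (a 1) (a 2) * cross p (b 0) (b 1) (b 2).
Proof. by rewrite /cramer1 !xprojE /gap /Da /cross /d2; field. Qed.

(** How far the last equation fails if one length is off by [tau]. The bracket tends to a product of
    two areas, nonzero at generic points, so small [tau] of opposite signs give residues of opposite
    signs. *)
Lemma residue_perturbed p (c : 'I_3 -> R) (tau : R) : c 0 = Da p 2 0 -> c 1 = Da p 2 1 -> Da p 2 2 = c 2 + tau ->
  residue (Da p 0) (Da p 1) c (Tb p) (Yc p) =
  Tb p ^+ 2 * tau * (cross p (a 0) (a 1) (a 2) * cross p (a 0) (a 1) (b 2) + tau / 4 * d2 p (a 0) (a 1)).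
Proof.
move=> c0 c1 c2; set D := cross p (a 0) (a 1) (a 2).
pose X i := xproj (Da p 0) (Da p 1) (Tb p) i; pose Y := Yc p.
pose zX := (p (b 1) 0 - p (b 0) 0) * (p (b 2) 0 - p (b 0) 0) + (p (b 1) 1 - p (b 0) 1) * (p (b 2) 1 - p (b 0) 1).
pose zY := cross p (b 0) (b 1) (b 2).
have g1 : gap (Da p 0) c 1 = gap (Da p 0) (Da p 2) 1 by rewrite /gap c0 c1.
have g2 : gap (Da p 0) c 2 = gap (Da p 0) (Da p 2) 2 + tau by rewrite /gap c0 c2; ring.
have e0 : cramer0 (Da p 0) c Y = D * zX - tau * (Y 1 - Y 0) / 2.
  by rewrite -cramer0E /cramer0 g1 g2 -/Y; field.
have e1 : cramer1 (Da p 0) (Da p 1) c (Tb p) = D * zY + tau * (X 1 - X 0) / 2.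
  by rewrite -cramer1E /cramer1 g1 g2 -!/(X _); field.
have e2 : zX ^+ 2 + zY ^+ 2 = Tb p * d2 p (b 0) (b 2) by rewrite /zX /zY /Tb /cross /d2; ring.
have e3 : 2 * (zX * X 0 + zY * Y 0) = Tb p * (Da p 0 0 + d2 p (b 0) (b 2) - c 0).
  by rewrite c0 /X xprojE /zX /zY /Y /Yc /Tb /cross /Da /d2; ring.
have e4 : (X 1 - X 0) * (zY - Y 0) - (Y 1 - Y 0) * (zX - X 0) = Tb p * cross p (a 0) (a 1) (b 2).
  by rewrite /X !xprojE /zX /zY /Y /Yc /Tb /cross /d2; ring.
have e5 : (X 1 - X 0) ^+ 2 + (Y 1 - Y 0) ^+ 2 = Tb p * d2 p (a 0) (a 1).
  by rewrite /X !xprojE /Y /Yc /Tb /cross /d2; ring.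
rewrite /residue e0 e1 area2E -/D -!/(X _) -/Y.
transitivity (Tb p * (D ^+ 2 * (zX ^+ 2 + zY ^+ 2)
   + D * tau * ((X 1 - X 0) * (zY - Y 0) - (Y 1 - Y 0) * (zX - X 0))
   + tau ^+ 2 / 4 * ((X 1 - X 0) ^+ 2 + (Y 1 - Y 0) ^+ 2)
   - D ^+ 2 * (2 * (zX * X 0 + zY * Y 0))) + Tb p ^+ 2 * D ^+ 2 * (Da p 0 0 - c 0)); first by field.
by rewrite e2 e3 e4 e5; field.
Qed.

Definition frame r s c t y : realisation R T :=
  let w := Num.sqrt t in
  place (fun i => (xproj r s t i / w, y i / w))
    (fun j => if j == 0 then (0, 0) else if j == 1 then (w, 0) else
       (w * (cramer0 r c y / area2 r s t y), w * (cramer1 r s c t / area2 r s t y))).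

Section Frame.
Variables (r s c y : 'I_3 -> R) (t : R).
Hypotheses (t0 : 0 < t) (hy : forall i, y i ^+ 2 = height2 r s t i).
Local Notation q := (frame r s c t y).
Local Notation w := (Num.sqrt t).

Let w0 : w != 0. Proof. by rewrite gt_eqF // sqrtr_gt0. Qed.
Let w2 : w ^+ 2 = t. Proof. by rewrite sqr_sqrtr // ltW. Qed.
Let t00 : t != 0. Proof. by rewrite gt_eqF. Qed.
Let xy i : xproj r s t i ^+ 2 + y i ^+ 2 = r i * t.
Proof. by rewrite hy /height2; ring. Qed.

Lemma frame_b01 : d2 q (b 0) (b 1) = t.
Proof. by rewrite -[RHS]w2 /d2 /frame !placeE /=; ring. Qed.

Lemma frame_ab0 i : d2 q (a i) (b 0) = r i.
Proof.
have -> : d2 q (a i) (b 0) = (xproj r s t i ^+ 2 + y i ^+ 2) / w ^+ 2.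
  by rewrite /d2 /frame !placeE /=; field.
by rewrite xy w2 mulfK.
Qed.

Lemma frame_ab1 i : d2 q (a i) (b 1) = s i.
Proof.
have -> : d2 q (a i) (b 1) = (xproj r s t i ^+ 2 + y i ^+ 2) / w ^+ 2 - 2 * xproj r s t i + w ^+ 2.
  by rewrite /d2 /frame !placeE /=; field.
by rewrite xy w2 mulfK // /xproj; field.
Qed.

Lemma frame_aa i j : d2 q (a i) (a j) = r i + r j - 2 * (xproj r s t i * xproj r s t j + y i * y j) / t.
Proof.
have -> : d2 q (a i) (a j) = ((xproj r s t i ^+ 2 + y i ^+ 2) + (xproj r s t j ^+ 2 + y j ^+ 2)
   - 2 * (xproj r s t i * xproj r s t j + y i * y j)) / w ^+ 2.
  by rewrite /d2 /frame !placeE /=; field.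
by rewrite !xy w2; field.
Qed.

Lemma frame_ab2 i : area2 r s t y != 0 -> residue r s c t y = 0 -> d2 q (a i) (b 2) = c i.
Proof.
move=> nA res; set A := area2 r s t y in nA *.
set z0 := cramer0 r c y; set z1 := cramer1 r s c t.
have base k : d2 q (a k) (b 2) = r k - 2 * (xproj r s t k * z0 + y k * z1) / A + t * (z0 ^+ 2 + z1 ^+ 2) / A ^+ 2.
  have -> : d2 q (a k) (b 2) = (xproj r s t k ^+ 2 + y k ^+ 2) / w ^+ 2
     - 2 * (xproj r s t k * z0 + y k * z1) / A + w ^+ 2 * (z0 ^+ 2 + z1 ^+ 2) / A ^+ 2.
    rewrite /d2 /frame !placeE /= -/A -/z0 -/z1; field; by rewrite w0 nA.
  by rewrite xy w2 mulfK.
have h0 : d2 q (a 0) (b 2) = c 0.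
  apply/eqP; rewrite -subr_eq0 base; apply/eqP.
  transitivity (residue r s c t y / A ^+ 2); last by rewrite res mul0r.
  by rewrite /residue -/A -/z0 -/z1; field.
have step k (m := gap r c k) : (xproj r s t k - xproj r s t 0) * z0 + (y k - y 0) * z1 = m * A / 2 ->
    d2 q (a k) (b 2) = c k.
  move=> hk; apply: (addIr (- d2 q (a 0) (b 2))); rewrite {2}h0 !base.
  transitivity (r k - r 0 - 2 * ((xproj r s t k - xproj r s t 0) * z0 + (y k - y 0) * z1) / A); first by field.
  by rewrite hk /m /gap; field.
by elim/I3P: i => //; apply: step; rewrite /z0 /z1 /A /cramer0 /cramer1 /area2; field.
Qed.

End Frame.

Lemma ratfun_Da i j : ratfun (fun z : T * 'I_2 -> R => Da (fun v k => z (v, k)) j i).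
Proof. exact: ratfun_d2. Qed.

Variable e : rel T.
Hypotheses (se : simple_graph e) (eab : forall i j, e (a i) (b j)).
Hypothesis eE : forall x y, e x y ->
  exists i j, (x = a i /\ y = b j) \/ (x = b j /\ y = a i).

Lemma K33_sparse : sparse (edges e).
Proof.
split; first exact: edges_edge_set.
move=> W; pose A := [set a i | i : 'I_3]; pose B := [set b i | i : 'I_3].
have cA : (#|W :&: A| <= 3)%N.
  apply: leq_trans (subset_leq_card (subsetIr _ _)) _.
  by rewrite (card_imset _ a_inj) card_ord.
have cB : (#|W :&: B| <= 3)%N.
  apply: leq_trans (subset_leq_card (subsetIr _ _)) _.
  by rewrite (card_imset _ b_inj) card_ord.
have AB : (#|W :&: A| + #|W :&: B| <= #|W|)%N.
  rewrite -cardsUI; have -> : W :&: A :&: (W :&: B) = set0.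
    apply/setP => x; rewrite !inE; apply/negP => /andP[/andP[_ /imsetP[i _ ->]] /andP[_ /imsetP[j _ h]]].
    by have := ab i j; rewrite h eqxx.
  by rewrite cards0 addn0; apply: subset_leq_card; rewrite -setIUr subsetIl.
have le : (#|restr (edges e) W| <= #|W :&: A| * #|W :&: B|)%N.
  rewrite -cardsX; apply: leq_trans (leq_imset_card (fun xy => [set xy.1; xy.2]) _).
  apply: subset_leq_card; apply/subsetP => h; rewrite inE => /andP[/edgesP[x [y [exy ->]]]].
  rewrite subUset !sub1set => /andP[xW yW]; have [i [j [[ex ey]|[ex ey]]]] := eE exy; rewrite ex ey in xW yW *.
    by apply/imsetP; exists (a i, b j) => //; rewrite !inE xW yW /= !imset_f.
  apply/imsetP; exists (a i, b j); last by rewrite setUC.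
  by rewrite !inE xW yW /= !imset_f.
move: (#|W :&: A|) (#|W :&: B|) (#|W|) cA cB AB le => al be n.
by case: al => [|[|[|[|al]]]] //; case: be => [|[|[|[|be]]]] //; clear; lia.
Qed.

Lemma K33_not_globally_rigid : ~ globally_rigid R e.
Proof.
move=> [p [gp grp]]; pose r := Da p 0; pose s := Da p 1; pose c := Da p 2.
have Da_gt0 i j : 0 < Da p j i.
  by rewrite lt_neqAle d2_ge0 andbT eq_sym generic_d2_neq0.
have rs i : r i != s i.
  rewrite -subr_eq0; apply: (generic_neq0 gp (g := fun q => Da q 0 i - Da q 1 i)
    (q := place (fun=> (0, 0)) (fun j => ((j != 0)%:R, 0)))).
    by apply: ratfunB; exact: ratfun_Da.
  rewrite [X in X != 0](_ : _ = - 1) ?oppr_eq0 ?oner_eq0 //.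
  by rewrite /Da /d2 !placeE /=; ring.
have bb i j : i != j -> b i != b j by apply: contra => /eqP/b_inj->.
have aa i j : i != j -> a i != a j by apply: contra => /eqP/a_inj->.
(* [cramer1] only involves differences of [xproj], in which [t] cancels. *)
have nZ t : cramer1 r s c t != 0.
  have -> : cramer1 r s c t = cramer1 r s c (Tb p) by rewrite /cramer1 /xproj; field.
  by rewrite cramer1E mulf_neq0 //; apply: generic_cross_neq0; rewrite ?bb ?aa.
have nY k : Yc p k != 0 by apply: generic_cross_neq0; rewrite 1?eq_sym ?ab ?bb // eq_sym ab.
have [lo [hi [i [j [hlo hhi [k0 elo] hI]]]]] := height2_interval (Da_gt0^~ 0) (Da_gt0^~ 1).
rewrite -/r -/s in hlo hhi elo hI.
have lo0 : 0 < lo by rewrite elo; apply: low_gt0 => //; exact: Da_gt0.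
(* The signs of the heights at [p]; [f ep] below is the residue along the arc with signs [ep]. *)
pose ep0 := [ffun k => Yc p k < 0].
pose Y (ep : {ffun 'I_3 -> bool}) t k := (-1) ^+ (ep k) * Num.sqrt (height2 r s t k).
pose f ep t := residue r s c t (Y ep t).
have Yq q : Da q 0 =1 r -> Da q 1 =1 s -> (forall k, 0 < Yc q k * Yc p k) ->
    lo <= Tb q <= hi /\ f ep0 (Tb q) = residue (Da q 0) (Da q 1) c (Tb q) (Yc q).
  move=> /funext er /funext es sg.
  have hq k : height2 r s (Tb q) k = Yc q k ^+ 2 by rewrite -er -es height2_cross.
  split; first by apply/hI => k; rewrite hq sqr_ge0.
  rewrite /f er es; congr residue; apply/funext => k; rewrite /Y hq sqrtr_sqr ffunE.
  have h := sg k; case: (ltrP (Yc p k) 0) => n; rewrite ?expr1 ?expr0.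
    by rewrite ler0_norm ?mulN1r ?opprK //; rewrite nmulr_lgt0 // in h; apply: ltW.
  have n' : 0 < Yc p k by rewrite lt_neqAle eq_sym nY.
  by rewrite ger0_norm ?mul1r //; rewrite pmulr_lgt0 // in h; apply: ltW.
have [t0I ft0] : lo <= Tb p <= hi /\ f ep0 (Tb p) = 0.
  have [//|//|k|h1 ->] := Yq p; first by rewrite -expr2 exprn_even_gt0 //= nY.
  by split=> //; rewrite (@residue_perturbed p c 0) ?addr0 // mulr0 mul0r.
pose D q := cross q (a 0) (a 1) (a 2); pose K q := cross q (a 0) (a 1) (b 2).
pose near (d : R) (x : realisation R T * R) :=
  (forall v k, `|x.1 v k - p v k| <= d) /\ `|x.2| <= d.
have mono d d' x : d <= d' -> near d x -> near d' x.
  by move=> dd [h1 h2]; split=> [v k|]; apply: le_trans dd.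
have tp v k : tends near (fun x => x.1 v k) (p v k).
  move=> eps e0; exists (eps / 2); first by rewrite divr_gt0.
  by move=> x [h _]; apply: le_lt_trans (h v k) _; lra.
have tt : tends near (fun x => x.2) 0.
  move=> eps e0; exists (eps / 2); first by rewrite divr_gt0.
  by move=> x [_ h]; rewrite subr0; apply: le_lt_trans h _; lra.
have tcross u v w : tends near (fun x => cross x.1 u v w) (cross p u v w).
  by apply: tendsB => //; apply: tendsM => //; apply: tendsB.
have td2 u v : tends near (fun x => d2 x.1 u v) (d2 p u v).
  by rewrite /d2 !expr2; apply: tendsD => //; apply: tendsM => //; apply: tendsB.
have nDK : D p * K p + 0 / 4 * d2 p (a 0) (a 1) != 0.
  rewrite !mul0r addr0 mulf_neq0 //; apply: generic_cross_neq0; rewrite ?aa ?ab //.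
have tDK : tends near (fun x => D x.1 * K x.1 + x.2 / 4 * d2 x.1 (a 0) (a 1))
    (D p * K p + 0 / 4 * d2 p (a 0) (a 1)).
  apply: tendsD => //; first by apply: tendsM => //; exact: tcross.
  by apply: tendsM => //; apply: tendsM => //; apply: tendsC.
set L := (X in X != 0) in nDK; rewrite -/L in tDK.
have [d d0 hd] : exists2 d, 0 < d & forall x, near d x ->
    0 < (D x.1 * K x.1 + x.2 / 4 * d2 x.1 (a 0) (a 1)) * L /\ (forall k, 0 < Yc x.1 k * Yc p k).
  apply: near_and => //; first exact: tends_sign.
  have [d1 d10 h1] := near_and mono (tends_sign (tcross (b 0) (b 1) (a 0)) (nY 0))
    (tends_sign (tcross (b 0) (b 1) (a 1)) (nY 1)).
  have [d2 d20 h2] := near_and mono (ex_intro2 _ _ d1 d10 h1)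
    (tends_sign (tcross (b 0) (b 1) (a 2)) (nY 2)).
  by exists d2 => // x /h2[[? ?] ?]; elim/I3P.
have [del del0 hdel] := local_flex [set a 2; b 2] (edges_edge_set se) (laman gp K33_sparse) d0.
pose tau := Num.min d del; have tau0 : 0 < tau by rewrite lt_min d0.
(* Changing only the squared length between [a 2] and [b 2], by [sg * tau], gives a point of the arc
   of [ep0] where the residue has the sign of [sg * L]. *)
have flex sg : `|sg| = 1 -> exists2 t, lo <= t <= hi & 0 < f ep0 t * (sg * L).
  move=> sg1; have [|q [nq qF qe]] := hdel (sg * tau).
    by rewrite normrM sg1 mul1r gtr0_norm // /tau ge_min lexx orbT.
  have [|pos sgn] := hd (q, sg * tau).
    by split=> //=; rewrite normrM sg1 mul1r gtr0_norm // /tau ge_min lexx.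
  have inE' i' j' : [set a i'; b j'] \in edges e by rewrite in_edges.
  have same i' j' : (i' != 2) || (j' != 2) -> Da q j' i' = Da p j' i'.
    move=> h; rewrite /Da -!len2; apply: qF => //; apply: contraTneq h => /setP h.
    have := h (a i'); have := h (b j'); rewrite !inE !eqxx orbT /= !(eq_sym (b _) (a _)).
    rewrite !(negPf (ab _ _)) /= orbF => /esym/eqP/b_inj-> /esym/eqP/a_inj->; by rewrite eqxx.
  have [k|k|//|tI fq] := Yq q; [by apply: same; rewrite orbT..|].
  have c0 : c 0 = Da q 2 0 by rewrite same.
  have c1 : c 1 = Da q 2 1 by rewrite same.
  have c2 : Da q 2 2 = c 2 + sg * tau by rewrite /c /Da -!len2 qe.
  exists (Tb q) => //; rewrite fq (residue_perturbed c0 c1 c2).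
  have nT : Tb q != 0 by rewrite gt_eqF //; apply: lt_le_trans lo0 _; case/andP: tI.
  have alg (x y z u v : R) : x * (y * z) * u * (y * v) = (x * y ^+ 2 * z) * (u * v) by ring.
  rewrite alg; apply: mulr_gt0 pos; rewrite mulr_gt0 // mulr_gt0 ?exprn_even_gt0 //=.
  by rewrite -normr_eq0 sg1 oner_eq0.
have [t1 t1I f1] := flex 1 (normr1 _); have [t2 t2I f2] := flex (-1) (normrN1 _).
have neg : f ep0 t1 * f ep0 t2 < 0.
  have : 0 < (f ep0 t1 * (1 * L)) * (f ep0 t2 * (-1 * L)) by rewrite mulr_gt0.
  have -> : f ep0 t1 * (1 * L) * (f ep0 t2 * (-1 * L)) = - (L ^+ 2 * (f ep0 t1 * f ep0 t2)) by ring.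
  by rewrite oppr_gt0 pmulr_rlt0 // exprn_even_gt0.
have cf ep t : lo <= t <= hi -> tends (near_real t) (f ep) (f ep t).
  move=> _; have tid : tends (near_real t) id t.
    move=> eps e0; exists (eps / 2); first by rewrite divr_gt0.
    by move=> x h; apply: le_lt_trans h _; lra.
  have mono' := @near_real_mono R t.
  apply: tends_residue => // k; apply: tendsM => //; first exact: tendsC.
  apply: tends_sqrt; rewrite /height2 !expr2; apply: tendsB => //.
    by apply: tendsM => //; exact: tendsC.
  have tx : tends (near_real t) (fun t => xproj r s t k) (xproj r s t k).
    apply: tendsM => //; last exact: tendsC.
    by apply: tendsB => //; [apply: tendsD => //|]; exact: tendsC.
  by apply: tendsM.
have glue k t ep : height2 r s t k = 0 -> f (flip k ep) t = f ep t.
  move=> h0; rewrite /f; congr residue; apply/funext => l; rewrite /Y ffunE.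
  by have [->|] := eqVneq l k; rewrite ?h0 ?sqrtr0 ?mulr0 // addbF.
have [t [ep [tI ft other]]] := second_zero t0I cf (glue i lo ^~ hlo) (glue j hi ^~ hhi) ft0 t1I t2I neg.
have t0 : 0 < t by apply: lt_le_trans lo0 _; case/andP: tI.
have hY k : Y ep t k ^+ 2 = height2 r s t k.
  by rewrite /Y exprMn sqrr_sign mul1r sqr_sqrtr //; move: tI => /hI; exact.
(* With zero area the residue would be at least [t * cramer1 ^+ 2], which is positive; so Cramer's
   rule places the third point. *)
have nA : area2 r s t (Y ep t) != 0.
  apply/eqP => A0; move: ft; rewrite /f /residue A0 expr0n /= mulr0 !mul0r subr0 addr0 => /eqP.
  rewrite gt_eqF // mulr_gt0 // ltr_wpDl ?sqr_ge0 // exprn_even_gt0 //=.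
pose q := frame r s c t (Y ep t).
have eqv : equivalent e p q.
  have hab i' j' : d2 p (a i') (b j') = d2 q (a i') (b j').
    elim/I3P: j'; [by rewrite frame_ab0|by rewrite frame_ab1|by rewrite frame_ab2].
  move=> x y /eE[i' [j' [[-> ->]|[-> ->]]]]; apply/dist_eq; first exact: hab.
  by rewrite d2C [RHS]d2C.
have cg x y : d2 p x y = d2 q x y by apply/dist_eq; apply: grp.
(* Congruence excludes a different [t]; in the other alternative two heights have a different
   relative sign, which changes the distance of [a k] and [a l]. *)
have et : t = Tb p by rewrite /Tb cg frame_b01.
case: other => [/eqP//|[k [l /eqP h]]]; apply: h.
have Ep : Yc p =1 Y ep0 (Tb p).
  move=> k'; rewrite /Y height2_cross sqrtr_sqr ffunE; case: (ltrP (Yc p k') 0) => n; rewrite ?expr1 ?expr0.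
    by rewrite ltr0_norm // mulN1r opprK.
  by rewrite ger0_norm // mul1r.
have /eqP : Y ep (Tb p) k * Y ep (Tb p) l = Y ep0 (Tb p) k * Y ep0 (Tb p) l.
  have h1 := cg (a k) (a l); rewrite frame_aa // et in h1.
  have h2 : d2 p (a k) (a l) = r k + r l - 2 * (xproj r s (Tb p) k * xproj r s (Tb p) l + Yc p k * Yc p l) / Tb p.
    apply: (mulIf (x := Tb p)); first by rewrite -et gt_eqF.
    rewrite mulrBl divfK; last by rewrite -et gt_eqF.
    by rewrite !xprojE /r /Yc /Tb /Da /cross /d2; ring.
  rewrite -!Ep; rewrite h2 in h1; move: h1 => /addrI/oppr_inj h1.
  have n0 : Tb p != 0 by rewrite -et gt_eqF.
  by have := mulIf (invr_neq0 n0) h1; lra.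
have nh k' : Num.sqrt (height2 r s (Tb p) k') != 0 by rewrite height2_cross sqrtr_sqr normr_eq0.
rewrite /Y mulrACA -signr_addb [X in _ == X]mulrACA -signr_addb => /eqP E0.
have E nz := mulIf nz E0.
exact: signr_inj (E (mulf_neq0 (nh k) (nh l))).
Qed.

End K33.


(** * Graphs with few edges *)

Section Nbhd.
Local Open Scope nat_scope.
Variables (T : finType) (e : rel T).
Hypothesis se : simple_graph e.

Definition nbhd x : {set T} := [set y | e x y].

Lemma nbhd_self x : x \notin nbhd x.
Proof. by rewrite inE se.1. Qed.

Lemma nbhdC x y : (x \in nbhd y) = (y \in nbhd x).
Proof. by rewrite !inE se.2. Qed.

Lemma nbhd_perm (g : {perm T}) x : is_automorphism e g -> nbhd (g x) = g @: nbhd x.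
Proof.
move=> ge; apply/setP => y; rewrite -[y in RHS](permKV g) mem_imset; last exact: perm_inj.
by rewrite !inE -(ge x) permKV.
Qed.

Lemma sum_degree : (\sum_x degree e x = 2 * #|edges e|).
Proof.
rewrite -(sum_inc (edges_edge_set se)); apply: eq_bigr => x _.
by rewrite card_inc_edges.
Qed.

Definition complete_bipartite (A : {set T}) := forall x y, e x y = ((x \in A) != (y \in A)).

Lemma full_degree_bipartite (A : {set T}) : (forall x y, e x y -> (x \in A) = (y \notin A)) ->
  (forall x, x \in A -> degree e x = #|~: A|) -> complete_bipartite A.
Proof.
move=> bip full; have h x : x \in A -> nbhd x = ~: A.
  move=> xA; apply/eqP; rewrite eqEcard [#|nbhd x|](full x xA) leqnn andbT.
  by apply/subsetP => y; rewrite !inE => /bip <-.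
move=> x y; have [xA|xA] := boolP (x \in A).
  by have := h x xA => /setP/(_ y); rewrite !inE => ->; case: (y \in A).
have [yA|yA] := boolP (y \in A).
  by rewrite se.2; have := h y yA => /setP/(_ x); rewrite !inE => ->; rewrite xA.
by apply/negP => /bip; rewrite (negPf xA) (negPf yA).
Qed.

Lemma complete_bipartite_iso (A : {set T}) m n : (0 < m) -> #|A| = m -> #|~: A| = n ->
  complete_bipartite A -> isomorphic (Kbip m n) e.
Proof.
move=> m0 cA cB h; have [x0 _] : exists x, x \in A by apply/card_gt0P; rewrite cA.
pose s := enum A ++ enum (~: A).
have ss : size s = (m + n) by rewrite size_cat -!cardE cA cB.
have us : uniq s.
  rewrite cat_uniq !enum_uniq /= andbT; apply/hasPn => x; rewrite !mem_enum inE => //.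
pose f (i : 'I_(m + n)) := nth x0 s i.
have fA i : (f i \in A) = (i < m).
  rewrite /f nth_cat -cardE cA; case: ltnP => im.
    by rewrite -mem_enum mem_nth // -cardE cA.
  apply: negbTE; have : nth x0 (enum (~: A)) (i - m) \in enum (~: A).
    by rewrite mem_nth // -cardE cB; have := ltn_ord i; move: im; clear; lia.
  by rewrite mem_enum inE.
exists f; split=> [|x y]; last by rewrite h !fA.
apply: inj_card_bij => [i j /eqP|].
  by rewrite /f nth_uniq ?ss // => /eqP/val_inj.
by rewrite card_ord -cA -cB cardsC.
Qed.

Lemma complete_bipartite33 (R : realType) (A : {set T}) : #|A| = 3 -> #|~: A| = 3 ->
  complete_bipartite A -> ~ globally_rigid R e.
Proof.
move=> cA cB h; have [x0 _] : exists x, x \in A by apply/card_gt0P; rewrite cA.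
pose a (i : 'I_3) := nth x0 (enum A) i; pose b (i : 'I_3) := nth x0 (enum (~: A)) i.
have aA i : a i \in A by rewrite -mem_enum mem_nth // -cardE cA.
have bA i : b i \notin A.
  have : b i \in enum (~: A) by rewrite mem_nth // -cardE cB.
  by rewrite mem_enum inE.
have sA x : x \in A -> exists i, x = a i.
  move=> xA; have lt : (index x (enum A) < 3) by rewrite -cA cardE index_mem mem_enum.
  by exists (Ordinal lt); rewrite /a nth_index // mem_enum.
have sB x : x \notin A -> exists i, x = b i.
  move=> xA; have xB : x \in enum (~: A) by rewrite mem_enum inE.
  have lt : (index x (enum (~: A)) < 3) by rewrite -cB cardE index_mem.
  by exists (Ordinal lt); rewrite /b nth_index.
apply: (@K33_not_globally_rigid R T a b).
- by move=> i j /eqP; rewrite /a nth_uniq ?enum_uniq -?cardE ?cA // => /eqP/val_inj.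
- by move=> i j /eqP; rewrite /b nth_uniq ?enum_uniq -?cardE ?cB // => /eqP/val_inj.
- by move=> i j; apply: contraNneq (bA j) => <-.
- exact: se.
- by move=> i j; rewrite h aA (negPf (bA j)).
move=> x y; rewrite h; have [xA|xA] := boolP (x \in A); have [yA|yA] // := boolP (y \in A) => _.
  by have [i ->] := sA x xA; have [j ->] := sB y yA; exists i, j; left.
by have [i ->] := sA y yA; have [j ->] := sB x xA; exists i, j; right.
Qed.

Hypotheses (ce : connected_graph e) (et : edge_transitive e).

Lemma common_nbrs_perm (g : {perm T}) x y : is_automorphism e g ->
  #|nbhd (g x) :&: nbhd (g y)| = #|nbhd x :&: nbhd y|.
Proof.
move=> ge; rewrite !nbhd_perm // -imsetI; last by move=> u v _ _; exact: perm_inj.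
by rewrite card_imset_perm.
Qed.

(** Adjacent vertices have a constant number [lam] of common neighbours, so a neighbourhood, of
    three vertices, induces a [lam]-regular graph: 1 is excluded by parity, 2 makes a component with
    four vertices, and 0 leaves the complete bipartite graph. *)
Lemma cubic_six : (forall x, degree e x = 3) -> #|T| = 6 ->
  exists A : {set T}, [/\ #|A| = 3, #|~: A| = 3 & complete_bipartite A].
Proof.
move=> d3 T6.
have cN x : #|nbhd x| = 3 by exact: d3.
have [x _] : exists x : T, x \in [set: T] by apply/card_gt0P; rewrite cardsT T6.
have [y0 xy0] : exists y, y \in nbhd x by apply/card_gt0P; rewrite cN.
pose N := nbhd x; pose lam := #|N :&: nbhd y0|.
have cst u v : e u v -> #|nbhd u :&: nbhd v| = lam.
  rewrite inE in xy0; move=> euv; have [g [ge [[<- <-]|[gx gy]]]] := et xy0 euv.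
    exact: common_nbrs_perm.
  by rewrite setIC -gx -gy common_nbrs_perm.
have lamN y : y \in N -> #|N :&: nbhd y| = lam by rewrite inE => /cst.
have sub y : N :&: nbhd y \subset N :\ y.
  by apply/subsetP => z /setIP[zN zy]; rewrite in_setD1 zN andbT; apply: contraTneq zy => ->; exact: nbhd_self.
have cN1 y : y \in N -> #|N :\ y| = 2.
  by move=> yN; have := cardsD1 y N; rewrite yN cN; case: #|_| => [|[|[|]]].
have lam2 : (lam <= 2) by rewrite -(cN1 y0 xy0); apply: subset_leq_card.
have lam_ne1 : lam <> 1.
  move=> l1; have /cards1P[y1 e1] : #|N :&: nbhd y0| == 1 by rewrite -/lam l1.
  have /setIP[y1N y01] : y1 \in N :&: nbhd y0 by rewrite e1 set11.
  have /cards1P[z e2] : #|N :&: nbhd y1| == 1 by rewrite lamN ?l1.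
  have y0z : y0 = z by apply/eqP; rewrite -in_set1 -e2 inE xy0 nbhdC.
  have n01 : y1 \in N :\ y0 by apply: (subsetP (sub y0)); rewrite e1 set11.
  have /cards1P[y2 ey2] : #|N :\ y0 :\ y1| == 1.
    by have := cardsD1 y1 (N :\ y0); rewrite n01 cN1 // => /eqP; rewrite eqSS eq_sym.
  have : y2 \in N :\ y0 :\ y1 by rewrite ey2 set11.
  rewrite !in_setD1 => /and3P[y21 y20 y2N].
  have /cards1P[u e3] : #|N :&: nbhd y2| == 1 by rewrite lamN ?l1.
  have /setIP[uN y2u] : u \in N :&: nbhd y2 by rewrite e3 set11.
  have uy2 : u != y2 by apply: contraTneq y2u => ->; exact: nbhd_self.
  have uc : (u == y0) || (u == y1).
    apply: contraT; rewrite negb_or => /andP[u0 u1].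
    by have := in_set1 u y2; rewrite -ey2 !in_setD1 u0 u1 uN (negPf uy2).
  case/orP: uc => /eqP eu.
    by have : y2 \in N :&: nbhd y0; [rewrite inE y2N nbhdC -eu|rewrite e1 inE (negPf y21)].
  by have : y2 \in N :&: nbhd y1; [rewrite inE y2N nbhdC -eu|rewrite e2 -y0z inE (negPf y20)].
have lam_ne2 : lam <> 2.
  move=> l2; have full y : y \in N -> N :&: nbhd y = N :\ y.
    by move=> yN; apply/eqP; rewrite eqEcard sub lamN // l2 cN1.
  have : x |: N = setT.
    apply: (@connected_closed _ e _ x ce (setU11 _ _)) => u v /setU1P[->|uN] euv.
      by rewrite setU1r // inE.
    have : nbhd u = x |: (N :\ u).
      apply/esym/eqP; rewrite eqEcard cN cardsU1 cN1 // in_setD1 (negPf (nbhd_self x)) andbF andbT.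
      by rewrite subUset sub1set nbhdC uN -full // subsetIr.
    move/setP/(_ v); rewrite inE euv => /esym; rewrite in_setU1 in_setD1 => /orP[/eqP->|/andP[_ vN]].
      exact: setU11.
    exact: setU1r.
  by move/(congr1 (fun S : {set T} => #|S|)); rewrite cardsT T6 cardsU1 cN nbhd_self.
have lam0 : lam = 0 by move: lam2 lam_ne1 lam_ne2; move: (lam) => [|[|[|]]].
have cC : #|~: N| = 3 by have := cardsC N; rewrite cN T6; case: #|_| => [|[|[|[|]]]].
have NC y : y \in N -> nbhd y = ~: N.
  move=> yN; apply/eqP; rewrite eqEcard cN cC andbT; apply/subsetP => z zy; rewrite inE; apply/negP => zN.
  by have := lamN y yN; rewrite lam0 => /eqP; rewrite cards_eq0 => /eqP/setP/(_ z); rewrite !inE; move: zN zy; rewrite !inE => -> ->.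
exists N; split; [exact: cN|exact: cC|]; apply: full_degree_bipartite => [u v euv|y yN]; last by rewrite cC d3.
have [uN|uN] := boolP (u \in N); first by have := NC u uN => /setP/(_ v); rewrite !inE euv.
apply/esym/negbTE; rewrite negbK; apply: contraT => vN.
have /eqP : nbhd u = N.
  apply/esym/eqP; rewrite eqEcard !cN andbT; apply/subsetP => y yN.
  by rewrite nbhdC NC // inE.
by move/eqP/setP/(_ v); rewrite inE euv (negPf vN).
Qed.

End Nbhd.


(** * Permutations of 5-power order on fewer than 25 points *)

Section FiveElement.
Local Open Scope nat_scope.
Variables (T : finType) (g : {perm T}).
Hypotheses (T25 : #|T| < 25) (g5 : (5.-elt g)%g).

(** The length of a cycle is a power of 5 below 25. *)
Lemma porbit_five t : #|porbit g t| = (if g t == t then 1 else 5).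
Proof.
have h : 5.-nat #|porbit g t|.
  by apply: pnat_dvd g5; rewrite porbitE /order; apply: dvdn_orbit.
have [k ek] := p_natP h.
have lt : #|porbit g t| < 25 by apply: leq_ltn_trans (max_card _) T25.
have k2 : k < 2 by move: lt; rewrite ek -[25]/(5 ^ 2) ltn_exp2l.
have i1 := iter_porbit g t.
case: eqP => gt.
  rewrite -(cards1 t); apply: eq_card => y; rewrite inE; apply/idP/eqP => [|->]; last exact: porbit_id.
  by case/porbitP=> i ->; rewrite permX; elim: i => //= i ->.
case: k k2 ek => [|[|//]] _ ek //.
by rewrite ek in i1.
Qed.

Lemma iter5 t : iter 5 g t = t.
Proof.
have := iter_porbit g t; rewrite porbit_five; case: eqP => // h _.
by rewrite /= !h.
Qed.

Lemma iter_mod5 n t : iter n g t = iter (n %% 5) g t.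
Proof.
rewrite {1}(divn_eq n 5) addnC iterD; congr iter.
by elim: (n %/ 5) => // k ih; rewrite mulSn iterD ih iter5.
Qed.

Lemma orbit_five t u : g t != t -> u \in porbit g t -> exists2 i, i < 5 & u = iter i g t.
Proof. by move=> /negPf gt; rewrite porbit_traject porbit_five gt => /trajectP. Qed.

Lemma iter_inj5 t i j : g t != t -> i < 5 -> j < 5 -> iter i g t = iter j g t -> i = j.
Proof.
move=> /negPf gt i5 j5 h; have := uniq_traject_porbit g t; rewrite porbit_five gt => u.
by apply/eqP; rewrite -(nth_uniq t _ _ u) ?size_traject // !nth_traject // h.
Qed.

Lemma closed_porbit (S : {set T}) t : (forall u, u \in S -> g u \in S) -> t \in S ->
  porbit g t \subset S.
Proof.
move=> cl tS; apply/subsetP => u /porbitP[i ->]; rewrite permX.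
by elim: i => //= i ih; apply: cl.
Qed.

Lemma small_fixed (S : {set T}) t : (forall u, u \in S -> g u \in S) -> #|S| < 5 -> t \in S ->
  g t = t.
Proof.
move=> cl S5 tS; apply/eqP; apply: contraTT S5 => /negPf gt.
by rewrite -leqNgt; have := subset_leq_card (closed_porbit cl tS); rewrite porbit_five gt.
Qed.

Lemma five_porbit (S : {set T}) t : (forall u, u \in S -> g u \in S) -> #|S| = 5 -> t \in S ->
  g t != t -> porbit g t = S.
Proof.
move=> cl S5 tS /negPf gt; apply/eqP.
by rewrite eqEcard closed_porbit // porbit_five gt S5.
Qed.

Lemma fix_mod5 (S : {set T}) : (forall u, u \in S -> g u \in S) ->
  #|S| = #|[set y in S | g y == y]| %[mod 5].
Proof.
move=> cl; have ac : [acts <[g]>%g, on S | 'P]%g.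
  rewrite cycle_subG !inE; apply/subsetP => u uS; rewrite inE; exact: cl.
rewrite (pgroup_fix_mod g5 ac) afix_cycle ?inE //; congr (_ %% _); apply: eq_card => y.
by rewrite in_setI [RHS]inE; congr (_ && _); apply/afix1P/eqP.
Qed.

End FiveElement.

(** * Bipartite graphs with degrees 3 and 5 *)

Section ThreeFive.
Local Open Scope nat_scope.
Variables (T : finType) (e : rel T) (A : {set T}).
Hypotheses (se : simple_graph e) (ce : connected_graph e) (et : edge_transitive e).
Local Notation G := (aut_group e).
Local Notation N := (nbhd e).
Hypothesis GA : forall g x, g \in G -> (g x \in A) = (x \in A).
Hypothesis trB : forall x y, x \notin A -> y \notin A -> exists2 g, g \in G & g x = y.
Hypothesis bip : forall x y, e x y -> (x \in A) = (y \notin A).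
Hypothesis degA : forall x, x \in A -> degree e x = 3.
Hypothesis degB : forall x, x \notin A -> degree e x = 5.

Let nbhdA x : x \notin A -> N x \subset A.
Proof. by move=> xA; apply/subsetP => y; rewrite inE => /bip; rewrite (negPf xA) => /esym/negbFE. Qed.

Let nbhdB v x : v \in A -> x \in N v -> x \notin A.
Proof. by move=> vA; rewrite inE => /bip <-. Qed.

Let flag_tr u x v y : u \in A -> v \in A -> e u x -> e v y ->
  exists g, [/\ g \in G, g u = v & g x = y].
Proof.
move=> uA vA eux evy; have [g [ga [[gu gx]|[gu gx]]]] := et eux evy.
  by exists g; split=> //; apply/aut_setP.
have gG : g \in G by apply/aut_setP.
by have := bip evy; rewrite -gu GA // uA vA.
Qed.

(** The three common neighbours of the vertices of [N x] all have [N x] as their neighbourhood, so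
    these 3 + 5 vertices are closed under adjacency. *)
Lemma twins_A x : x \notin A -> (forall u v, u \in N x -> v \in N x -> N u = N v) -> #|T| <= 8.
Proof.
move=> xA tw; have [v vx] : exists v, v \in N x by apply/card_gt0P; rewrite -[#|_|]/(degree e x) degB.
have vA := subsetP (nbhdA xA) v vx.
have c8 : #|N v :|: N x| <= 8.
  have [c _] := leq_card_setU (N v) (N x); apply: leq_trans c _.
  by rewrite -[#|N v|]/(degree e v) -[#|N x|]/(degree e x) degA // degB.
suff S : N v :|: N x = setT by rewrite -cardsT -S.
apply: (@connected_closed _ e _ v ce); first by rewrite inE vx orbT.
move=> a b /setUP[av|ax] eab; apply/setUP; last by left; rewrite (tw v a) // inE.
right; have aA := nbhdB vA av; suff -> : N x = N a by rewrite inE.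
apply/eqP; rewrite eqEcard -[#|N x|]/(degree e x) -[#|N a|]/(degree e a) !degB // leqnn andbT.
by apply/subsetP => u ux; rewrite nbhdC // (tw u v).
Qed.

(** By flag transitivity every [u] in [N v] has a twin in [N v]. Two pairs in a set of three meet,
    so all three vertices are twins. *)
Lemma twins_B v y z : v \in A -> y \in N v -> z \in N v -> y != z -> N y = N z -> #|T| <= 8.
Proof.
move=> vA yv zv yz tw.
have cv : #|N v| = 3 by exact: degA.
have all u : u \in N v -> N u = N y.
  move=> uv; have [->//|uy] := eqVneq u y; have [->//|uz] := eqVneq u z.
  have [h [hG hv hy]] : exists h, [/\ h \in G, h v = v & h y = u].
    by apply: flag_tr => //; [move: yv|move: uv]; rewrite inE.
  have ha : is_automorphism e h by apply/aut_setP.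
  have tu : N u = N (h z) by rewrite -hy !nbhd_perm // tw.
  have hzv : h z \in N v by rewrite -hv nbhd_perm // imset_f.
  have : (h z == y) || (h z == z).
    have hzu : h z != u by rewrite -hy (inj_eq perm_inj) eq_sym.
    apply: contraT; rewrite negb_or => /andP[hy' hz'].
    have : #|[set y; z] :|: [set u; h z]| <= 3.
      by rewrite -cv; apply: subset_leq_card; rewrite !subUset !sub1set yv zv uv hzv.
    rewrite cardsU !cards2 yz [u == _]eq_sym hzu.
    rewrite (_ : _ :&: _ = set0) ?cards0 //; apply/setP => t; rewrite !inE.
    apply/negP => /andP[/orP[]/eqP-> /orP[]/eqP h0].
    - by rewrite h0 eqxx in uy.
    - by rewrite -h0 eqxx in hy'.
    - by rewrite h0 eqxx in uz.
    - by rewrite -h0 eqxx in hz'.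
  by case/orP=> /eqP h0; rewrite tu h0.
have yA := nbhdB vA yv.
have c8 : #|N v :|: N y| <= 8.
  have [c _] := leq_card_setU (N v) (N y); apply: leq_trans c _.
  by rewrite cv -[#|N y|]/(degree e y) degB.
suff S : N v :|: N y = setT by rewrite -cardsT -S.
apply: (@connected_closed _ e _ y ce); first by rewrite inE yv.
move=> a b /setUP[av|ay] eab; apply/setUP; first by right; rewrite -(all a av) inE.
left; have aA := subsetP (nbhdA yA) a ay; suff -> : N v = N a by rewrite inE.
apply/eqP; rewrite eqEcard cv -[#|N a|]/(degree e a) degA // andbT.
by apply/subsetP => u uv; rewrite nbhdC // (all u uv).
Qed.

(** The stabiliser of [x] is transitive on its five neighbours, so within it the stabiliser of a
    neighbour has index 5 and contains no Sylow 5-subgroup. *)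
Lemma five_element x : x \notin A ->
  exists g, [/\ g \in G, (5.-elt g)%g, g x = x & exists2 v, v \in N x & g v != v].
Proof.
move=> xA; have [v vx] : exists v, v \in N x by apply/card_gt0P; rewrite -[#|_|]/(degree e x) degB.
have vA := subsetP (nbhdA xA) v vx.
pose S := ('C_G[x | 'P])%G.
have oS : orbit 'P S v = N x.
  apply/setP => u; apply/orbitP/idP => [[g /setIP[gG /astab1P gx] <-]|ux].
    have ga : is_automorphism e g by apply/aut_setP.
    have gx' : g x = x := gx.
    have : g v \in N x by rewrite -gx' inE ga; move: vx; rewrite inE.
    by [].
  have uA := subsetP (nbhdA xA) u ux.
  have [g [gG gv gx]] : exists g, [/\ g \in G, g v = u & g x = x].
    by apply: flag_tr => //; [move: vx|move: ux]; rewrite inE se.2.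
  by exists g => //; apply/setIP; split=> //; apply/astab1P.
have iS : #|S : 'C_S[v | 'P]|%g = 5 by rewrite -card_orbit oS; exact: degB.
have [P /and3P[sPS pP nP]] := Sylow_exists 5 S.
have : ~~ (P \subset 'C_S[v | 'P]%g).
  apply/negP => sPC; have : 5 %| #|S : P|%g.
    by rewrite -iS; apply: indexgS.
  by move=> d5; have := pnat_dvd d5 nP; rewrite pnatE.
case/subsetPn=> g gP gC; have gS := subsetP sPS g gP.
have /setIP[gG /astab1P gx] := gS.
exists g; split=> //; first exact: mem_p_elt pP gP.
exists v => //; apply: contra gC => /eqP gv; apply/setIP; split=> //; exact/astab1P.
Qed.

Section Stabiliser.
Variable g : {perm T}.
Hypotheses (T25 : #|T| < 25) (T8 : 8 < #|T|) (gG : g \in G) (g5 : (5.-elt g)%g).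

Let ga : is_automorphism e g. Proof. exact/aut_setP. Qed.

Lemma closed_nbhd y : g y = y -> forall u, u \in N y -> g u \in N y.
Proof. by move=> gy u uy; rewrite -gy nbhd_perm // imset_f. Qed.

Lemma moved_nbhd y v u : y \notin A -> g y = y -> v \in N y -> g v != v -> u \in N y -> g u != u.
Proof.
move=> yA gy vy gv uy; have eN := five_porbit T25 g5 (closed_nbhd gy) (degB yA) vy gv.
have : u \in porbit g v by rewrite eN.
rewrite -eq_porbit_mem => /eqP eo; have := porbit_five T25 g5 u.
by rewrite eo (porbit_five T25 g5) (negPf gv); case: ifP.
Qed.

(** If [g] fixed everything outside [A], the neighbours of [x], which form one cycle of [g], would
    be twins. *)
Lemma moved_point x v : x \notin A -> g x = x -> v \in N x -> g v != v ->
  exists2 y, y \notin A & g y != y.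
Proof.
move=> xA gx vx gv; apply: contrapT => no.
have all y : y \notin A -> g y = y by move=> yA; apply/eqP; apply: contraT => h; case: no; exists y.
have tw u : u \in N x -> N u = N v.
  have uA := subsetP (nbhdA xA).
  rewrite -(five_porbit T25 g5 (closed_nbhd gx) (degB xA) vx gv) => /(orbit_five T25 g5 gv)[i _ ->].
  elim: i => //= i <-; rewrite nbhd_perm // -[RHS]imset_id; apply: eq_in_imset => y yi; apply: all.
  apply: (nbhdB _ yi); elim: i {yi} => [|i ih] /=; [exact: uA|by rewrite GA].
suff : #|T| <= 8 by rewrite leqNgt T8.
by apply: (twins_A xA) => u u' /tw-> /tw->.
Qed.

Lemma fixed_block v : v \in A -> g v = v -> forall y, y \in N v -> g y = y.
Proof. by move=> vA gv y; apply: (small_fixed T25 g5 (closed_nbhd gv)); rewrite [#|_|](degA vA). Qed.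

End Stabiliser.

(** The automorphism fixes four of the nine vertices, by counting modulo 5. Their neighbourhoods are
    cycles of length 5, disjoint since there are no twins, and would need 20 vertices in [A]. *)
Lemma no_fifteen_nine : #|A| = 15 -> #|~: A| = 9 -> False.
Proof.
move=> cA cB; have T24 : #|T| = 24 by rewrite -(cardsC A) cA cB.
have T25 : #|T| < 25 by rewrite T24. have T8 : 8 < #|T| by rewrite T24.
have [x] : exists x, x \in ~: A by apply/card_gt0P; rewrite cB.
rewrite inE => xA; have [g [gG g5 gx [v vx gv]]] := five_element xA.
pose F := [set y in ~: A | g y == y].
have FP y : y \in F -> y \notin A /\ g y = y by rewrite !inE => /andP[? /eqP].
have xF : x \in F by rewrite !inE xA gx eqxx.
have cF : #|F| = 4.
  have clB u : u \in ~: A -> g u \in ~: A by rewrite !inE GA.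
  have := fix_mod5 g5 clB; rewrite -/F cB.
  have [y yA gy] := moved_point T25 T8 gG g5 xA gx vx gv.
  have lt : #|F| < 9.
    rewrite -cB; apply: proper_card; apply/properP; split; first by apply/subsetP => u /FP[]; rewrite inE.
    by exists y; rewrite !inE // (negPf gy) andbF.
  have gt : 0 < #|F| by apply/card_gt0P; exists x.
  by move: lt gt; case: #|F| => [|[|[|[|[|[|[|[|[|]]]]]]]]].
have cFx : #|F :\ x| = 3.
  by have := cardsD1 x F; rewrite xF cF => /eqP; rewrite eqSS => /eqP <-.
(* One fixed neighbour would make all neighbours of [y] fixed, and each would see exactly the three
   fixed vertices other than [x]. *)
have mv y u : y \in F -> u \in N y -> g u != u.
  move=> yF uy; apply: contraT; rewrite negbK => /eqP gu; have [yA gy] := FP y yF.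
  have fixN u' : u' \in N y -> g u' = u'.
    move=> u'y; apply/eqP; apply: contraT => h.
    by have := moved_nbhd T25 gG g5 yA gy u'y h uy; rewrite gu eqxx.
  have eN u' : u' \in N y -> N u' = F :\ x.
    move=> u'y; have u'A := subsetP (nbhdA yA) u' u'y.
    apply/eqP; rewrite eqEcard [#|N u'|](degA u'A) cFx leqnn andbT; apply/subsetP => z zu'; rewrite in_setD1 !inE (nbhdB u'A zu').
    rewrite (fixed_block T25 gG g5 u'A (fixN u' u'y) zu') !eqxx !andbT.
    apply/eqP => ezx; have u'x : u' \in N x by rewrite nbhdC // -ezx.
    by have := moved_nbhd T25 gG g5 xA gx vx gv u'x; rewrite fixN // eqxx.
  suff : #|T| <= 8 by rewrite T24.
  by apply: (twins_A yA) => u1 u2 /eN-> /eN->.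
have dis y z : y \in F -> z \in F -> y != z -> [disjoint N y & N z].
  move=> yF zF yz; apply/pred0P => u /=; apply/negP => /andP[uy uz].
  have [yA gy] := FP y yF; have [zA gz] := FP z zF.
  have uA := subsetP (nbhdA yA) u uy.
  suff : #|T| <= 8 by rewrite T24.
  apply: (@twins_B u y z uA) => //; rewrite 1?nbhdC //.
  rewrite -(five_porbit T25 g5 (closed_nbhd gG gy) (degB yA) uy (mv y u yF uy)).
  by rewrite -(five_porbit T25 g5 (closed_nbhd gG gz) (degB zA) uz (mv z u zF uz)).
have : \sum_(y in F) #|N y| <= #|A|.
  rewrite -[leqRHS]sum1_card; under eq_bigr => y _ do rewrite -sum1_card.
  rewrite (exchange_big_dep (mem A)) /=; last by move=> y u /FP[yA _]; exact/subsetP/nbhdA.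
  apply: leq_sum => u uA; rewrite sum1dep_card; apply/card_le1_eqP => y z.
  rewrite ![_ \in finset _]inE => /andP[yF uy] /andP[zF uz]; apply/eqP; apply: contraT => yz.
  have [yF' zF'] : y \in F /\ z \in F by rewrite !inE.
  by have /pred0P/(_ u) := dis z y zF' yF' yz; rewrite /= !inE uy uz.
rewrite (eq_bigr (fun=> 5)); last by move=> y /FP[yA _]; exact: degB.
by rewrite sum_nat_const cF cA.
Qed.

End ThreeFive.


(** * Recognition of the graph with parts 6 and 10 *)

Section Labelling.
Local Open Scope nat_scope.

Definition H610_rel i j := (j \in H610_nbrs i) || (i \in H610_nbrs j).

(** Decided by evaluation. It makes a labelling that respects adjacency injective. *)
Lemma H610_twinfree i j : i < 16 -> j < 16 ->
  (forall k, k < 16 -> H610_rel i k = H610_rel j k) -> i = j.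
Proof.
move=> i16 j16 h.
have := isT : all (fun i => all (fun j => (i == j) ||
  has (fun k => H610_rel i k != H610_rel j k) (iota 0 16)) (iota 0 16)) (iota 0 16).
move/allP/(_ i); rewrite mem_iota => /(_ i16)/allP/(_ j); rewrite mem_iota => /(_ j16).
case/orP=> [/eqP//|/hasP[k]]; rewrite mem_iota => k16.
by rewrite h ?eqxx.
Qed.

(* The parts are [x, c_0 .. c_4] and [v_0 .. v_4, w_0 .. w_4]; the vertices
   [v_i] and [w_i] see [x, c_i, c_(i+1)] and [c_i, c_(i+1), c_(i+3)]. *)
Lemma H610_labelled (T : finType) (e : rel T) (A : {set T}) (x : T) (c v w : nat -> T) :
  simple_graph e -> (forall y z, e y z -> (y \in A) = (z \notin A)) -> #|T| = 16 ->
  x \notin A -> (forall i, c i \notin A) -> (forall i, v i \in A) -> (forall i, w i \in A) ->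
  (forall i, e x (v i)) -> (forall i, e x (w i) = false) ->
  (forall i j, i < 5 -> j < 5 -> e (c i) (v j) = ((i + 5 - j) %% 5 \in [:: 0; 1])) ->
  (forall i j, i < 5 -> j < 5 -> e (c i) (w j) = ((i + 5 - j) %% 5 \in [:: 0; 1; 3])) ->
  isomorphic H610 e.
Proof.
move=> se bip T16 xA cA vA wA exv exw ecv ecw.
pose s := [:: x; c 2; c 0; c 1; c 3; c 4; v 0; w 1; v 4; v 2; v 1; w 0; w 2; w 4; w 3; v 3].
have sA i : i < 16 -> (nth x s i \in A) = (6 <= i).
  case: i => [|[|[|[|[|[|[|[|[|[|[|[|[|[|[|[|i]]]]]]]]]]]]]]]] //= _; by rewrite ?(negPf xA) ?(negPf (cA _)) ?vA ?wA.
have key i j : i < 6 -> 6 <= j < 16 -> e (nth x s i) (nth x s j) = H610_rel i j.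
  case: i => [|[|[|[|[|[|i]]]]]] // _; case: j => [|[|[|[|[|[|[|[|[|[|[|[|[|[|[|[|j]]]]]]]]]]]]]]]] // _; by rewrite [nth x s _]/= [nth x s _]/= ?exv ?exw ?ecv ?ecw.
have hom i j : i < 16 -> j < 16 -> e (nth x s i) (nth x s j) = H610_rel i j.
  move=> i16 j16; have [i6|i6] := ltnP i 6; have [j6|j6] := ltnP j 6.
  - transitivity false; first by apply/negP => /bip; rewrite !sA // (leqNgt 6 i) i6 (leqNgt 6 j) j6.
    by move: i6 j6; clear; case: i => [|[|[|[|[|[|i]]]]]] //; case: j => [|[|[|[|[|[|j]]]]]] //.
  - by apply: key => //; rewrite j6.
  - by rewrite se.2 key ?i6 // /H610_rel orbC.
  - transitivity false; first by apply/negP => /bip; rewrite !sA // i6 j6.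
    by move: i6 j6; rewrite /H610_rel; clear; case: i => [|[|[|[|[|[|i]]]]]] //; case: j => [|[|[|[|[|[|j]]]]]] //.
pose f (i : 'I_16) := nth x s i.
exists f; split=> [|i j]; last exact: hom.
apply: inj_card_bij; last by rewrite card_ord T16.
move=> i j fij; apply: val_inj; apply: (H610_twinfree (ltn_ord i) (ltn_ord j)) => k k16.
by rewrite -!hom // -!/(f _) fij.
Qed.

End Labelling.

(** * Degrees 3 and 5 on 10 + 6 vertices *)

Section SixTen.
Local Open Scope nat_scope.
Variables (T : finType) (e : rel T) (A : {set T}).
Hypotheses (se : simple_graph e) (ce : connected_graph e) (et : edge_transitive e).
Local Notation G := (aut_group e).
Local Notation N := (nbhd e).
Hypothesis GA : forall g x, g \in G -> (g x \in A) = (x \in A).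
Hypothesis trB : forall x y, x \notin A -> y \notin A -> exists2 g, g \in G & g x = y.
Hypothesis bip : forall x y, e x y -> (x \in A) = (y \notin A).
Hypothesis degA : forall x, x \in A -> degree e x = 3.
Hypothesis degB : forall x, x \notin A -> degree e x = 5.
Hypotheses (cA : #|A| = 10) (cB : #|~: A| = 6).

Let T16 : #|T| = 16. Proof. by rewrite -(cardsC A) cA cB. Qed.
Let T25 : #|T| < 25. Proof. by rewrite T16. Qed.
Let T8 : 8 < #|T|. Proof. by rewrite T16. Qed.

Let nbhdA x : x \notin A -> N x \subset A.
Proof. by move=> xA; apply/subsetP => y; rewrite inE => /bip; rewrite (negPf xA) => /esym/negbFE. Qed.

Let nbhdB v x : v \in A -> x \in N v -> x \notin A.
Proof. by move=> vA; rewrite inE => /bip <-. Qed.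

(** The fixed vertices among the six outside [A] number 1 modulo 5 and are not all six; a fixed
    vertex of [A] would have three fixed neighbours. *)
Lemma one_fixed_point x : x \notin A ->
  exists g, [/\ g \in G, (5.-elt g)%g, g x = x & forall t, t != x -> g t != t].
Proof.
move=> xA; have [g [gG g5 gx [v vx gv]]] := five_element se et GA bip degB xA.
exists g; split=> //; pose F := [set y in ~: A | g y == y].
have xF : x \in F by rewrite !inE xA gx eqxx.
have cF : #|F| = 1.
  have clB u : u \in ~: A -> g u \in ~: A by rewrite !inE GA.
  have := fix_mod5 g5 clB; rewrite -/F cB.
  have [y yA gy] := moved_point se ce GA bip degA degB T25 T8 gG g5 xA gx vx gv.
  have lt : #|F| < 6.
    rewrite -cB; apply: proper_card; apply/properP; split; first by apply/subsetP => u; rewrite !inE => /andP[].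
    by exists y; rewrite !inE // (negPf gy) andbF.
  have gt : 0 < #|F| by apply/card_gt0P; exists x.
  by move: lt gt; case: #|F| => [|[|[|[|[|[|]]]]]].
have onlyx y : y \notin A -> g y = y -> y = x.
  move=> yA gy; have /card_le1_eqP := eq_leq cF; apply=> //; by rewrite !inE yA gy eqxx.
move=> t tx; apply: contra tx => /eqP gt; apply/eqP.
have [tA|tA] := boolP (t \in A); last exact: onlyx.
have all y : y \in N t -> y = x.
  by move=> yt; apply: onlyx; [exact: nbhdB yt|exact: (fixed_block degA T25 gG g5 tA gt yt)].
have : N t \subset [set x] by apply/subsetP => y /all->; rewrite set11.
by move/subset_leq_card; rewrite cards1 [#|_|](degA tA).
Qed.

Lemma card3P (S : {set T}) x : #|S| = 3 -> x \in S ->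
  exists y z, [/\ y != x, z != x, y != z & S = [set x; y; z]].
Proof.
move=> S3 xS; have := cardsD1 x S; rewrite xS S3 => /eqP; rewrite eqSS eq_sym => /cards2P[y [z [yz e2]]].
have yS : y \in S :\ x by rewrite e2 set21.
have zS : z \in S :\ x by rewrite e2 set22.
exists y, z; split=> //; [by case/setD1P: yS|by case/setD1P: zS|].
by rewrite -setUA -e2 setD1K.
Qed.

(* After replacing [g] by a power, the two cyclic neighbours [y], [g y] of a
   vertex adjacent to [x] are consecutive. *)
Lemma normalised_rotation x v : x \notin A -> v \in N x ->
  exists g y, [/\ g \in G, (5.-elt g)%g, g x = x, forall t, t != x -> g t != t &
    N v = [set x; y; g y] /\ y \notin A].
Proof.
move=> xA vx; have [g [gG g5 gx mv]] := one_fixed_point xA.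
have vA := subsetP (nbhdA xA) v vx.
have [y [z [yx zx yz eN]]] : exists y z, [/\ y != x, z != x, y != z & N v = [set x; y; z]].
  by apply: card3P; [exact: degA|rewrite nbhdC].
have yA : y \notin A by apply: (nbhdB vA); rewrite eN !inE eqxx orbT.
have zA : z \notin A by apply: (nbhdB vA); rewrite eN !inE eqxx orbT.
have oy : porbit g y = ~: A :\ x.
  apply: (five_porbit T25 g5); last exact: mv.
  - move=> u; rewrite !inE GA // => /andP[ux ->]; rewrite andbT.
    by rewrite -gx (inj_eq perm_inj).
  - by have := cardsD1 x (~: A); rewrite inE xA cB => /eqP; rewrite eqSS => /eqP <-.
  - by rewrite !inE yx yA.
have [d d5 zE] : exists2 d, d < 5 & z = iter d g y.
  by apply: (orbit_five T25 g5 (mv y yx)); rewrite oy !inE zx zA.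
have d0 : 0 < d by case: d zE {d5} => // h; rewrite h eqxx in yz.
have ix i : iter i g x = x by elim: i => //= i ->.
exists (g ^+ d)%g, y; split.
- exact: groupX.
- exact: p_eltX.
- by rewrite permX ix.
- move=> t tx; rewrite permX; apply/eqP => h.
  by have := iter_inj5 T25 g5 (mv t tx) d5 (isT : 0 < 5) h => h0; rewrite h0 in d0.
- by rewrite permX -zE eN.
Qed.

(** The two rotation classes of three-element subsets of the cyclic group of order 5: intervals and
    the others. *)
Lemma rotation_pattern (be : seq bool) : size be = 5 -> count id be = 3 ->
  exists2 m, m < 5 & rot m be = [:: true; true; false; true; false] \/
    rot m be = [:: true; true; true; false; false].
Proof.
move: be => [|b0 [|b1 [|b2 [|b3 [|b4 [|]]]]]] // _ h.
have : has (fun m => (rot m [:: b0; b1; b2; b3; b4] == [:: true; true; false; true; false]) ||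
   (rot m [:: b0; b1; b2; b3; b4] == [:: true; true; true; false; false])) (iota 0 5).
  by move: h; case: b0; case: b1; case: b2; case: b3; case: b4.
case/hasP=> m; rewrite mem_iota => m5 /orP[]/eqP h'; exists m => //; by [left|right].
Qed.

Lemma six_ten_iso : isomorphic H610 e.
Proof.
have [x] : exists x, x \in ~: A by apply/card_gt0P; rewrite cB.
rewrite inE => xA.
have [v vx] : exists v, v \in N x by apply/card_gt0P; rewrite [#|_|](degB xA).
have vA := subsetP (nbhdA xA) v vx.
have [g [y [gG g5 gx mv [eN yA]]]] := normalised_rotation xA vx.
have ga : is_automorphism e g by apply/aut_setP.
have ix i : iter i g x = x by elim: i => //= i ->.
have iA i t : (iter i g t \in A) = (t \in A) by elim: i => //= i ih; rewrite GA.
have iter_aut k s t : e (iter k g s) (iter k g t) = e s t by elim: k => //= k ih; rewrite ga.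
have rotE i j s t : j <= 5 -> e (iter i g s) (iter j g t) = e (iter ((i + 5 - j) %% 5) g s) t.
  move=> j5; rewrite -(iter_mod5 T25 g5) -[RHS](iter_aut j) -iterD subnKC; last by apply: leq_trans (leq_addl _ _).
  by rewrite iterD iter5.
have AC t : t \in A -> t != x by apply: contraTneq => ->.
have yx : y != x.
  have := degA vA; rewrite -[degree e v]/#|N v| eN; apply: contra_eq_neq => ->.
  by rewrite gx !setUid cards1.
pose c i := iter i g y; pose vv i := iter i g v.
have it_inj i s t : iter i g s = iter i g t -> s = t by elim: i => //= i ih /perm_inj/ih.
have cx i : c i != x by apply: contra yx => /eqP h; apply/eqP/(it_inj i); rewrite ix.
have cov t : t \notin A -> t != x -> exists2 i, i < 5 & t = c i.
  move=> tA tx; apply: (orbit_five T25 g5 (mv y yx)).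
  rewrite (@five_porbit _ g T25 g5 (~: A :\ x)) ?inE ?tx ?yx //; last exact: mv.
    move=> u; rewrite !inE GA // => /andP[ux ->]; rewrite andbT.
    by rewrite -gx (inj_eq perm_inj).
  by have := cardsD1 x (~: A); rewrite inE xA cB => /eqP; rewrite eqSS => /eqP <-.
have ecv0 k : k < 5 -> e (c k) v = (k \in [:: 0; 1]).
  move=> k5; rewrite se.2; have -> : e v (c k) = (c k \in N v) by rewrite inE.
  rewrite eN !inE (negPf (cx k)) /=; congr (_ || _); apply/eqP/eqP => [h|-> //].
    exact: (@iter_inj5 _ g T25 g5 y k 0 (mv y yx)).
  exact: (@iter_inj5 _ g T25 g5 y k 1 (mv y yx)).
have exv i : e x (vv i) by rewrite -(ix i) iter_aut; move: vx; rewrite inE.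
have cW : #|A :\: N x| = 5.
  have := cardsD A (N x); rewrite (setIidPr (nbhdA xA)) cA [#|N x|](degB xA) => //.
have [w] : exists w, w \in A :\: N x by apply/card_gt0P; rewrite cW.
rewrite !inE => /andP[/negPf exw wA].
pose be := [seq e (c j) w | j <- iota 0 5].
have cbe : count id be = 3.
  rewrite -(degA wA) -[degree e w]/#|N w| /be count_map.
  pose l := [seq c j | j <- iota 0 5 & e (c j) w].
  have ul : uniq l.
    rewrite map_inj_in_uniq ?filter_uniq ?iota_uniq // => i j.
    rewrite !mem_filter !mem_iota => /andP[_ i5] /andP[_ j5]; exact: iter_inj5 (mv y yx) i5 j5.
  rewrite (@eq_card _ (N w) (mem l)) ?(card_uniqP ul) ?size_map ?size_filter // => t.
  rewrite [in LHS]inE; apply/idP/mapP => [ewt|[j]]; last first.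
    by rewrite mem_filter => /andP[h _] ->; rewrite se.2.
  have [||i i5 et'] := cov t; [by rewrite -(bip ewt)| |].
    by apply: contraTneq ewt => ->; rewrite se.2 exw.
  by exists i => //; rewrite mem_filter mem_iota i5 -et' se.2 ewt.
have [m m5 pat] := rotation_pattern (erefl : size be = 5) cbe.
(* Rotated so that the incidences of [w'] with [c 0], ..., [c 4] are the list [rot m be]. *)
pose w' := iter (5 - m) g w.
have w'A : w' \in A by rewrite iA.
have exw' : e x w' = false by rewrite -(ix (5 - m)) iter_aut.
have ecw j : j < 5 -> e (c j) w' = nth false (rot m be) j.
  move=> j5; rewrite rotE ?leq_subr //.
  by case: m m5 {pat w' w'A exw'} => [|[|[|[|[|]]]]] // _; case: j j5 => [|[|[|[|[|]]]]].
have ecvE i j : i < 5 -> j < 5 -> e (c i) (vv j) = ((i + 5 - j) %% 5 \in [:: 0; 1]).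
  by move=> i5 j5; rewrite rotE ?ecv0 ?ltn_pmod // ltnW.
have ecwE i j : i < 5 -> j < 5 -> e (c i) (iter j g w') = nth false (rot m be) ((i + 5 - j) %% 5).
  by move=> i5 j5; rewrite rotE ?ecw ?ltn_pmod // ltnW.
case: pat => pat.
  apply: (@H610_labelled T e A x c vv (fun i => iter i g w')) => //; try by move=> i; rewrite iA.
    by move=> i; rewrite -(ix i) iter_aut.
  move=> i j i5 j5; rewrite ecwE // pat.
  by move: (ltn_pmod (i + 5 - j) (isT : 0 < 5)); move: (_ %% 5) => [|[|[|[|[|]]]]].
(* The interval pattern contradicts transitivity outside [A]: [x] has two common neighbours with
   every [c j], while [c 0] and [c 2] have only [w'] in common. *)
have c0A : c 0 \notin A by rewrite iA.
have [h hG hx] := trB xA c0A.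
have ha : is_automorphism e h by apply/aut_setP.
pose t := (h^-1)%g (c 2).
have ht : h t = c 2 by rewrite permKV.
have tA : t \notin A by rewrite -(GA t hG) ht iA.
have tx : t != x.
  apply: contraTneq isT => h0; rewrite h0 hx in ht.
  by have := iter_inj5 T25 g5 (mv y yx) (isT : 0 < 5) (isT : 2 < 5) ht.
have [j j5 tj] := cov t tA tx.
have gt1 : 1 < #|N x :&: N t|.
  apply/card_gt1P; exists (vv j), (vv ((j + 4) %% 5)); rewrite ![_ \in _ :&: _]inE ![_ \in N _]inE !exv tj.
  rewrite !ecvE ?ltn_pmod //; split; [..|apply/eqP => h0]; last first.
    have := iter_inj5 T25 g5 (mv v (AC v vA)) j5 (ltn_pmod (j + 4) (isT : 0 < 5)) h0.
    by move: j5; clear; case: j => [|[|[|[|[|]]]]].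
  - by move: j5; clear; case: j => [|[|[|[|[|]]]]].
  - by move: j5; clear; case: j => [|[|[|[|[|]]]]].
have : #|N x :&: N t| <= #|[set w']|; last by rewrite cards1 leqNgt gt1.
rewrite -(common_nbrs_perm x t ha) hx ht; apply: subset_leq_card; apply/subsetP => u.
rewrite !inE => /andP[u0 u2].
have uA : u \in A by have := bip u0; rewrite (negPf c0A) => /esym/negbFE.
have [ux|ux] := boolP (u \in N x).
  have [i i5 ui] : exists2 i, i < 5 & u = vv i.
    apply: (orbit_five T25 g5 (mv v (AC v vA))).
    rewrite (five_porbit T25 g5 (closed_nbhd gG gx) (degB xA) vx) //; exact: mv (AC v vA).
  move: u0 u2; rewrite ui !ecvE //; move: i5; clear.
  by case: i => [|[|[|[|[|]]]]].
have [i i5 ui] : exists2 i, i < 5 & u = iter i g w'.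
  apply: (orbit_five T25 g5 (mv w' (AC w' w'A))).
  rewrite (@five_porbit _ g T25 g5 (A :\: N x)) ?inE ?w'A ?exw' //; last exact: mv (AC w' w'A).
    by rewrite uA andbT; move: ux; rewrite inE.
  by move=> z; rewrite !inE GA // -{2}gx ga.
move: u0 u2; rewrite ui !ecwE // pat; move: i5; clear.
by case: i => [|[|[|[|[|]]]]].
Qed.

End SixTen.


(** * The classification *)

Section Classification.
Local Open Scope nat_scope.
Variables (T : finType) (e : rel T).
Hypotheses (se : simple_graph e) (ce : connected_graph e) (et : edge_transitive e).

Lemma degree_lt x : degree e x < #|T|.
Proof.
rewrite -cardsT; apply: proper_card; apply/properP; split; first exact: subsetT.
by exists x; rewrite !inE // se.1.
Qed.

Lemma leq_min_degree k : (k <= min_degree e) = (k <= #|T|) && [forall x, k <= degree e x].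
Proof.
rewrite /min_degree; have -> : [forall x, k <= degree e x] = all (fun x => k <= degree e x) (index_enum T).
  by apply/forallP/allP => h x; [move=> _; exact: h|apply: h; exact: mem_index_enum].
by elim: (index_enum T) => [|x s ih]; rewrite ?big_nil ?andbT // big_cons leq_min ih /= andbCA.
Qed.

Lemma min_degree_eq3 x : (forall y, 3 <= degree e y) -> degree e x = 3 -> min_degree e = 3.
Proof.
move=> d3 dx; apply/eqP; rewrite eqn_leq; apply/andP; split.
  by rewrite -dx; have := leqnn (min_degree e); rewrite leq_min_degree => /andP[_ /forallP].
rewrite leq_min_degree; apply/andP; split; last exact/forallP.
by rewrite -dx ltnW // degree_lt.
Qed.

(** Degrees of a concrete graph become counts on lists of numbers, decided by evaluation. The
    inequality is the edge bound doubled, with the degree sum for twice the edges. *)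
Lemma isomorphic_counts n (h : rel nat) :
  isomorphic (fun i j : 'I_n => h i j) e ->
  all (fun i => 3 <= count (h i) (iota 0 n)) (iota 0 n) ->
  4 * n <= sumn [seq count (h i) (iota 0 n) | i <- iota 0 n] + 4 ->
  (forall x, 3 <= degree e x) /\ 2 * #|T| <= #|edges e| + 2.
Proof.
move=> [f [bf fe]] /allP ge3 le4; have [f' fK f'K] := bf.
have dE i : degree e (f i) = count (h i) (iota 0 n).
  have -> : degree e (f i) = #|[set j : 'I_n | h i j]|.
    rewrite -(card_imset _ (bij_inj bf)); apply: eq_card => y; rewrite inE.
    by rewrite -{2}(f'K y) mem_imset ?inE -?fe ?f'K //; exact: bij_inj.
  rewrite -sum1dep_card -(big_mkord (h i) (fun=> 1)) sum1_count /index_iota subn0 //.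
have cT : #|T| = n by rewrite -(bij_eq_card bf) card_ord.
split=> [x|].
  by rewrite -(f'K x) dE; apply: ge3; rewrite mem_iota ltn_ord.
have := sum_degree se; rewrite (reindex f) /=; last exact: onW_bij.
rewrite (eq_bigr (fun i : 'I_n => count (h i) (iota 0 n))) // -(big_mkord xpredT (fun i => count (h i) (iota 0 n))).
rewrite /index_iota subn0 -(big_map (fun i => count (h i) (iota 0 n)) xpredT id) -sumnE => es.
by move: le4; rewrite es cT; clear; lia.
Qed.

Lemma regular_count k : (forall x, degree e x = k) -> #|T| * k = 2 * #|edges e|.
Proof.
by move=> dk; rewrite -(sum_degree se) (eq_bigr (fun=> k)) // sum_nat_const.
Qed.

Lemma listed_counts :
  [\/ 4 <= min_degree e, min_degree e = 3 /\ 6 <= max_degree e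
    | [\/ isomorphic (Kbip 3 4) e, isomorphic (Kbip 3 5) e,
          isomorphic H610 e | complete_graph e]] -> ~ complete_graph e ->
  (forall x, 3 <= degree e x) /\ 2 * #|T| <= #|edges e| + 2.
Proof.
move=> cases nc; case: cases => [|[m3 M6]|[k|k|k|//]].
- rewrite leq_min_degree => /andP[_ /forallP d4]; split=> [x|]; first exact: ltnW.
  have : \sum_(x : T) 4 <= \sum_x degree e x by apply: leq_sum.
  by rewrite (sum_degree se) sum_nat_const; move: #|edges e|; rewrite (eq_card (_ : _ =i T)) //; clear; lia.
- have d3 x : 3 <= degree e x.
    by have := leqnn (min_degree e); rewrite leq_min_degree m3 => /andP[_ /forallP].
  split=> //.
  have [x0 _] : exists x : T, true by apply: contrapT => h; apply: nc => x; case: h; exists x.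
  have [x1 dx1] : exists x, degree e x = 3.
    apply: contrapT => no; have : 4 <= min_degree e; last by rewrite m3.
    rewrite leq_min_degree (leq_ltn_trans (d3 x0) (degree_lt x0)); apply/forallP => x.
    by rewrite ltn_neqAle d3 andbT; apply/eqP => h; apply: no; exists x.
  have [x2 dx2] : exists x, 6 <= degree e x.
    have T0 : 0 < #|T| by apply/card_gt0P; exists x0.
    by have [x ex] := bigop.eq_bigmax (degree e) T0; exists x; rewrite -ex.
  case: (edge_transitive_orbits se et d3) => [tr|[A [p [q [GA trA trB bip [dA dB pq]]]]]].
    have [g /aut_setP ga gx] := tr x1 x2; rewrite -gx degree_perm // dx1 in dx2.
    by [].
  have [p3 q6] : p = 3 /\ 6 <= q.
    have [a1|a1] := boolP (x1 \in A); have [a2|a2] := boolP (x2 \in A);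
      move: dx1 dx2 pq; rewrite ?(dA _ a1) ?(dB _ a1) ?(dA _ a2) ?(dB _ a2); clear; lia.
  have c1 := card_edges_A se bip dA; have c2 := card_edges_B se bip dB.
  have c3 := cardsC A; rewrite p3 in c1.
  (* [#|A|] is a third and [#|~: A|] at most a sixth of the number of edges, so
     [2 * #|T| <= #|edges e|]. *)
  have le : #|~: A| * 6 <= #|edges e| by rewrite c2 leq_mul2l q6 orbT.
  by move: c1 le c3; move: #|edges e| #|A| #|~: A| #|T|; clear; lia.
- by apply: (@isomorphic_counts 7 (fun i j => (i < 3) != (j < 3))).
- by apply: (@isomorphic_counts 8 (fun i j => (i < 3) != (j < 3))).
- by apply: (@isomorphic_counts 16 H610_rel).
Qed.

Hypothesis deg3 : forall x, 3 <= degree e x.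

(** The margin 3 instead of 2 admits one further graph, the one with parts 3 and 3, which needs its
    own argument. *)
Lemma classification : 2 * #|T| <= #|edges e| + 3 -> ~ complete_graph e ->
  [\/ 4 <= min_degree e, min_degree e = 3 /\ 6 <= max_degree e
    | [\/ isomorphic (Kbip 3 4) e, isomorphic (Kbip 3 5) e,
          isomorphic H610 e | complete_graph e]] \/
  exists A : {set T}, [/\ #|A| = 3, #|~: A| = 3 & complete_bipartite e A].
Proof.
move=> cE nc.
have [x0 _] : exists x : T, true by apply: contrapT => h; apply: nc => x; case: h; exists x.
have T5 : 4 < #|T| by rewrite ltnNge; apply/negP => h; apply: nc; exact: complete_small.
have T0 : 3 < #|T| by exact: leq_ltn_trans (deg3 x0) (degree_lt x0).
have four : (forall x, 4 <= degree e x) -> 4 <= min_degree e.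
  by move=> d4; rewrite leq_min_degree T0; apply/forallP.
case: (edge_transitive_orbits se et deg3) => [tr|[A [p [q [GA trA trB bip [dA dB pq]]]]]].
  have dE x : degree e x = degree e x0.
    by have [g /aut_setP ga <-] := tr x0 x; apply: degree_perm.
  have [d4|d3] := leqP 4 (degree e x0); first by left; constructor 1; apply: four => x; rewrite dE.
  have d3E x : degree e x = 3 by apply/eqP; rewrite dE eqn_leq deg3 -ltnS d3.
  (* The edge bound allows at most six vertices, the number is even, and there are more than
     four. *)
  right; apply: cubic_six => //.
  have := regular_count d3E; move: cE T5; clear.
  by move: #|T| #|edges e|; lia.
have c1 := card_edges_A se bip dA; have c2 := card_edges_B se bip dB; have c3 := cardsC A.
have [a aA] : exists a, a \in A.
  have [|x0A] := boolP (x0 \in A); first by exists x0.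
  have /card_gt0P[y] : 0 < degree e x0 by apply: leq_trans (deg3 x0).
  by rewrite inE => /bip; rewrite (negPf x0A) => /esym/negbFE; exists y.
have [b bB] : exists b, b \notin A.
  have /card_gt0P[y] : 0 < degree e a by apply: leq_trans (deg3 a).
  by rewrite inE => /bip; rewrite aA => /esym h; exists y.
have p3 : 3 <= p by rewrite -(dA a aA).
have [p4|p3'] := leqP 4 p.
  left; constructor 1; apply: four => x; have [xA|xA] := boolP (x \in A).
    by rewrite dA.
  by rewrite dB // (leq_trans p4).
have ep : p = 3 by apply/eqP; rewrite eqn_leq p3 -ltnS p3'.
have [q6|q5] := leqP 6 q.
  left; constructor 2; split; first by apply: (min_degree_eq3 (x := a)) => //; rewrite dA.
  by rewrite (leq_trans q6) // -(dB b bB); exact: leq_bigmax.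
rewrite ep in c1 dA pq.
have cba : #|~: A| * q = #|A| * 3 by rewrite -c2 c1.
have b0 : 0 < #|~: A| by apply/card_gt0P; exists b; rewrite inE.
have key : 2 * (#|A| + #|~: A|) <= #|A| * 3 + 3 by rewrite c3 -c1.
have full : #|~: A| = 3 -> complete_bipartite e A.
  by move=> b3; apply: full_degree_bipartite => // x xA; rewrite dA.
have fullC : #|~: A| = 3 -> complete_bipartite e (~: A).
  by move=> /full h x y; rewrite h !inE; case: (x \in A); case: (y \in A).
have b3 : 3 <= #|~: A|.
  rewrite -(dA a aA); apply: subset_leq_card; apply/subsetP => y; rewrite !inE => /bip.
  by rewrite aA.
have [q3|q4|q5'] : [\/ q = 3, q = 4 | q = 5].
  by move: pq q5; clear; case: q => [|[|[|[|[|[|q]]]]]] // _ _; [constructor 1|constructor 2|constructor 3].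
- right; exists A; rewrite q3 in cba.
  have [a3 b3'] : #|A| = 3 /\ #|~: A| = 3.
    by move: cba key b3; move: #|A| #|~: A|; clear; lia.
  by split=> //; apply: full.
- left; constructor 3; constructor 1; rewrite q4 in cba.
  have [a4 b3'] : #|A| = 4 /\ #|~: A| = 3.
    by move: cba key b3; move: #|A| #|~: A|; clear; lia.
  by apply: (complete_bipartite_iso (A := ~: A)) => //; rewrite ?setCK //; exact: fullC.
(* Counting edges from both sides gives the ratio 5 to 3, and [2 * (5 * k + 3 * k) <= 15 * k + 3]
   bounds [k]. The values 1 and 2 are listed graphs, 3 is [no_fifteen_nine]. *)
have [k [ak bk k3]] : exists k, [/\ #|A| = 5 * k, #|~: A| = 3 * k & 0 < k <= 3].
  exists (#|A| %/ 5); rewrite q5' in cba; move: cba key b3; move: #|A| #|~: A|; clear=> s t h1 h2 h3.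
  by split; lia.
rewrite q5' in dB.
left; constructor 3; case: k k3 ak bk => [|[|[|[|]]]] // _ ak bk.
- constructor 2.
  by apply: (complete_bipartite_iso (A := ~: A)) => //; rewrite ?setCK //; exact: fullC.
- by constructor 3; exact: (six_ten_iso se ce et GA trB bip dA dB).
- by case: (no_fifteen_nine se ce et GA bip dA dB).
Qed.

End Classification.

Theorem theorem1p2 (R : realType) (T : finType) (e : rel T) :
  simple_graph e -> connected_graph e -> edge_transitive e ->
  (globally_rigid R e <->
     [\/ (4 <= min_degree e)%N,
         min_degree e = 3%N /\ (6 <= max_degree e)%N
       | [\/ isomorphic (Kbip 3 4) e, isomorphic (Kbip 3 5) e,
             isomorphic H610 e | complete_graph e]]).
Proof.
move=> se ce et; have [cg|nc] := pselect (complete_graph e).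
  split=> _; first by constructor 3; constructor 4.
  have [p gp] := generic_realisation R T; exists p; split=> // q eq x y.
  by have [->|/cg/eq//] := eqVneq x y; apply/dist_eq; rewrite !d2xx.
split=> [gr|cases].
  have d3 := globally_rigid_degree se ce gr nc.
  case: (classification se ce et d3 (globally_rigid_card se gr) nc) => // -[A [a3 b3 cb]].
  by case: (complete_bipartite33 se a3 b3 cb gr).
have [d3 cE] := listed_counts se et cases nc; exact: sufficiency.
Qed.
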